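(* Let $E \in \mathrm{GL}_n(\mathbb{C})$ with $n \geq 2$. The algebra $\mathcal{B}(E)$ is smooth of dimension $3$. In particular $H_k(\mathcal{B}(E), M)=(0)=H^k(\mathcal{B}(E),M)$ for any $\mathcal{B}(E)$-bimodule $M$ and any $k \geq 4$.
   Context: The base field is $\mathbb{C}$. For $E \in \mathrm{GL}_n(\mathbb{C})$, $\mathcal{B}(E)$ is the algebra presented by generators $(u_{ij})_{1\le i,j\le n}$ and relations $E^{-1}u^tEu = I_n = uE^{-1}u^tE$, where $u=(u_{ij})$. An algebra $A$ is said to be smooth of dimension $d$ if the $A$-bimodule $A$ has a finite resolution of length $d$ by finitely generated projective $A$-bimodules, with $d$ being the smallest possible length for such a resolution. $H_*(A,M)$ and $H^*(A,M)$ denote the Hochschild homology and cohomology groups of $A$ with coefficients in the $A$-bimodule $M$. *)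

(* Defs.v *)
From HB Require Import structures.
From mathcomp Require Import all_boot all_algebra.
From mathcomp Require Import finmap monalg.
From mathcomp Require Import boolp functions reals complex.

Set Implicit Arguments.
Unset Strict Implicit.
Unset Printing Implicit Defensive.

Import GRing.Theory.
Local Open Scope ring_scope.
Local Open Scope quotient_scope.

(* The two-sided ideal of A generated by S, and the quotient algebra A / (S). *)
Section IdealQuotient.
Variables (K : comNzRingType) (A : algType K).

Definition gen_ideal (S : A -> Prop) : {pred A} := fun x => `[< exists2 s :
  seq (A * A * A), (forall t, t \in s -> S t.1.2) &
  x = \sum_(t <- s) t.1.1 * t.1.2 * t.2 >].

Variable S : A -> Prop.

Lemma gen_ideal_zmod_closed : zmod_closed (gen_ideal S).
Proof.
split; first by apply/asboolP; exists [::]; rewrite ?big_nil.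
move=> x y /asboolP[s sS ->] /asboolP[t tS ->]; apply/asboolP.
exists (s ++ [seq (- u.1.1, u.1.2, u.2) | u <- t]).
  by move=> u; rewrite mem_cat => /orP[/sS//|/mapP[v /tS ? ->]].
rewrite big_cat big_map -sumrN /=; congr (_ + _).
by apply: eq_bigr => u _; rewrite !mulNr.
Qed.

HB.instance Definition _ :=
  GRing.isZmodClosed.Build A (gen_ideal S) gen_ideal_zmod_closed.

Lemma gen_idealMl a x : x \in gen_ideal S -> a * x \in gen_ideal S.
Proof.
move=> /asboolP[s sS ->]; apply/asboolP.
exists [seq (a * u.1.1, u.1.2, u.2) | u <- s].
  by move=> u /mapP[v /sS ? ->].
by rewrite big_map mulr_sumr; apply: eq_bigr => u _; rewrite !mulrA.
Qed.

Lemma gen_idealMr a x : x \in gen_ideal S -> x * a \in gen_ideal S.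
Proof.
move=> /asboolP[s sS ->]; apply/asboolP.
exists [seq (u.1.1, u.1.2, u.2 * a) | u <- s].
  by move=> u /mapP[v /sS ? ->].
by rewrite big_map mulr_suml; apply: eq_bigr => u _; rewrite !mulrA.
Qed.

Lemma gen_idealZ c x : x \in gen_ideal S -> c *: x \in gen_ideal S.
Proof. by move=> xS; rewrite -[x]mul1r scalerAl gen_idealMl. Qed.

Lemma gen_ideal_gen x : S x -> x \in gen_ideal S.
Proof.
move=> Sx; apply/asboolP; exists [:: (1, x, 1)].
  by move=> t; rewrite inE => /eqP->.
by rewrite big_seq1 mul1r mulr1.
Qed.

(* Needed because MathComp's algType excludes the zero ring. *)
Hypothesis S1 : 1 \notin gen_ideal S.

Definition quot_alg : Type := let _ := S1 in {ideal_quot gen_ideal S}.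

HB.instance Definition _ :=
  GRing.Zmodule.copy quot_alg {ideal_quot gen_ideal S}.

Definition qpi (x : A) : quot_alg := \pi_{ideal_quot gen_ideal S} x.

Lemma qpiP x y : reflect (qpi x = qpi y) (x - y \in gen_ideal S).
Proof. by rewrite Quotient.idealrBE; exact: eqP. Qed.

Let rep (x : quot_alg) : A := repr (x : {ideal_quot gen_ideal S}).

Let repK : cancel rep qpi.
Proof. by move=> x; exact: (@reprK _ _ (x : {ideal_quot gen_ideal S})). Qed.

Lemma qpi_surj (x : quot_alg) : {y | x = qpi y}.
Proof. by exists (rep x); rewrite repK. Qed.

Fact qpi_is_zmod_morphism : zmod_morphism qpi.
Proof. by move=> x y; rewrite /qpi raddfB. Qed.

HB.instance Definition _ := GRing.isZmodMorphism.Build A quot_alg qpi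
  qpi_is_zmod_morphism.

Definition qone : quot_alg := qpi 1.
Definition qmul (x y : quot_alg) : quot_alg := qpi (rep x * rep y).
Definition qscale (c : K) (x : quot_alg) : quot_alg := qpi (c *: rep x).

Let repP z : rep (qpi z) - z \in gen_ideal S.
Proof. by apply/qpiP; rewrite repK. Qed.

Let qpi_mul x y : qmul (qpi x) (qpi y) = qpi (x * y).
Proof.
apply/qpiP; rewrite -(subrK (x * rep (qpi y)) (_ * _)) -mulrBl -addrA -mulrBr.
by apply: rpredD; [exact/gen_idealMr/repP | exact/gen_idealMl/repP].
Qed.

Let qpi_scale c x : qscale c (qpi x) = qpi (c *: x).
Proof. by apply/qpiP; rewrite -scalerBr gen_idealZ. Qed.

Fact qmulA : associative qmul.
Proof.
move=> x y z; case: (qpi_surj x) => x' ->; case: (qpi_surj y) => y' ->.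
case: (qpi_surj z) => z' ->.
by rewrite !qpi_mul mulrA.
Qed.

Fact qmul1 : left_id qone qmul.
Proof. by move=> x; case: (qpi_surj x) => x' ->; rewrite qpi_mul mul1r. Qed.

Fact qmulr1 : right_id qone qmul.
Proof. by move=> x; case: (qpi_surj x) => x' ->; rewrite qpi_mul mulr1. Qed.

Fact qmulDl : left_distributive qmul +%R.
Proof.
move=> x y z; case: (qpi_surj x) => x' ->; case: (qpi_surj y) => y' ->.
case: (qpi_surj z) => z' ->.
by rewrite -raddfD !qpi_mul mulrDl raddfD.
Qed.

Fact qmulDr : right_distributive qmul +%R.
Proof.
move=> x y z; case: (qpi_surj x) => x' ->; case: (qpi_surj y) => y' ->.
case: (qpi_surj z) => z' ->.
by rewrite -raddfD !qpi_mul mulrDr raddfD.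
Qed.

Fact qone_neq0 : qone != 0.
Proof.
apply: contra S1 => /eqP; rewrite -(raddf0 qpi) => /qpiP.
by rewrite subr0.
Qed.

HB.instance Definition _ := GRing.Zmodule_isNzRing.Build quot_alg
  qmulA qmul1 qmulr1 qmulDl qmulDr qone_neq0.

Fact qscaleA a b x : qscale a (qscale b x) = qscale (a * b) x.
Proof. by case: (qpi_surj x) => x' ->; rewrite !qpi_scale scalerA. Qed.

Fact qscale1 : left_id 1 qscale.
Proof. by move=> x; case: (qpi_surj x) => x' ->; rewrite qpi_scale scale1r. Qed.

Fact qscaleDr : right_distributive qscale +%R.
Proof.
move=> a x y; case: (qpi_surj x) => x' ->; case: (qpi_surj y) => y' ->.
by rewrite -raddfD !qpi_scale scalerDr raddfD.
Qed.

Fact qscaleDl x : {morph qscale^~ x : a b / a + b}.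
Proof.
move=> a b; case: (qpi_surj x) => x' ->.
by rewrite !qpi_scale scalerDl raddfD.
Qed.

HB.instance Definition _ := GRing.Zmodule_isLmodule.Build K quot_alg
  qscaleA qscale1 qscaleDr qscaleDl.

Fact qscaleAl c (x y : quot_alg) : c *: (x * y) = (c *: x) * y.
Proof.
case: (qpi_surj x) => x' ->; case: (qpi_surj y) => y' ->.
rewrite [LHS](congr1 (qscale c) (qpi_mul _ _)) qpi_scale scalerAl -qpi_mul.
by rewrite -qpi_scale.
Qed.

HB.instance Definition _ := GRing.Lmodule_isLalgebra.Build K quot_alg qscaleAl.

Fact qscaleAr c (x y : quot_alg) : c *: (x * y) = x * (c *: y).
Proof.
case: (qpi_surj x) => x' ->; case: (qpi_surj y) => y' ->.
rewrite [LHS](congr1 (qscale c) (qpi_mul _ _)) qpi_scale scalerAr -qpi_mul.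
by rewrite -qpi_scale.
Qed.

HB.instance Definition _ := GRing.Lalgebra_isAlgebra.Build K quot_alg qscaleAr.

Fact qpi_is_monoid_morphism : monoid_morphism qpi.
Proof. by split=> // x y; rewrite -qpi_mul. Qed.

HB.instance Definition _ := GRing.isMonoidMorphism.Build A quot_alg qpi
  qpi_is_monoid_morphism.

Fact qpi_is_scalable : scalable qpi.
Proof. by move=> c x; rewrite -qpi_scale. Qed.

HB.instance Definition _ := GRing.isScalable.Build K A quot_alg *:%R qpi
  qpi_is_scalable.

End IdealQuotient.

Section FreeAlgebra.
Variables (K : comNzRingType) (I : choiceType).

(* Noncommutative polynomials: finitely supported functions on words in I. *)
Definition free_alg : Type := {malg K[{fmonom I}]}.

HB.instance Definition _ := GRing.Lalgebra.copy free_alg {malg K[{fmonom I}]}.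

Fact free_scaleAr c (x y : free_alg) : c *: (x * y) = x * (c *: y).
Proof.
apply/malgP => k; rewrite mcoeffZ.
rewrite (mcoeffMlw _ (fsubset_refl _) (fsubset_refl _)).
rewrite (mcoeffMlw _ (fsubset_refl _) (msuppZ_le _ _)) mulr_sumr.
apply: eq_bigr => i _; rewrite mulr_sumr; apply: eq_bigr => j _.
by rewrite mcoeffZ mulrCA mulrnAr.
Qed.

HB.instance Definition _ :=
  GRing.Lalgebra_isAlgebra.Build K free_alg free_scaleAr.

Definition free_gen (i : I) : free_alg := << fmu i >>.

End FreeAlgebra.

Definition scal_mx (K : comNzRingType) (A : algType K) n (M : 'M[K]_n) :
  'M[A]_n := map_mx (in_alg A) M.

Section BilinearRelations.
Variables (K : fieldType) (n : nat) (E : 'M[K]_n) (A : algType K).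

(* E^-1 u^t E u and u E^-1 u^t E *)
Definition BE_left (u : 'M[A]_n) : 'M[A]_n :=
  scal_mx A (invmx E) *m u^T *m scal_mx A E *m u.

Definition BE_right (u : 'M[A]_n) : 'M[A]_n :=
  u *m scal_mx A (invmx E) *m u^T *m scal_mx A E.

Lemma BE_counit (f : {rmorphism A -> K}) (u : 'M[A]_n) :
    E \in unitmx -> (forall c, f c%:A = c) -> map_mx f u = 1%:M ->
  map_mx f (BE_left u) = 1%:M /\ map_mx f (BE_right u) = 1%:M.
Proof.
move=> Eu fA fu.
have fM M : map_mx f (scal_mx A M) = M by apply/matrixP => i j; rewrite !mxE fA.
rewrite /BE_left /BE_right !map_mxM -map_trmx !fM fu trmx1 !mulmx1 mul1mx.
by rewrite mulVmx.
Qed.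

End BilinearRelations.

Lemma map_BE (K : fieldType) n (E : 'M[K]_n) (A B : algType K)
    (f : {lrmorphism A -> B}) (u : 'M[A]_n) :
  map_mx f (BE_left E u) = BE_left E (map_mx f u) /\
  map_mx f (BE_right E u) = BE_right E (map_mx f u).
Proof.
have fM M : map_mx f (scal_mx A M) = scal_mx B M.
  by apply/matrixP => i j; rewrite !mxE rmorph_alg.
by rewrite /BE_left /BE_right !map_mxM -map_trmx !fM.
Qed.

Section BE.
Variables (K : fieldType) (n : nat) (E : 'M[K]_n).

Local Notation F := (free_alg K ('I_n * 'I_n)%type).

Definition BE_u : 'M[F]_n := \matrix_(i, j) free_gen K (i, j).

Definition BE_rel (x : F) : Prop := exists i j,
  x = (BE_left E BE_u - 1%:M) i j \/ x = (BE_right E BE_u - 1%:M) i j.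

(* The character u_ij |-> delta_ij shows that the relations are proper. *)
Definition word_counit (w : {fmonom ('I_n * 'I_n)%type}) : K :=
  \prod_(ij <- fmonom_val w) (ij.1 == ij.2)%:R.

Fact word_counit_morph : mmorphism word_counit.
Proof.
by split=> [x y|]; rewrite /word_counit ?fm1 ?big_nil // fmM big_cat.
Qed.

HB.instance Definition _ := isMultiplicative.Build _ _ word_counit
  word_counit_morph.

Definition free_counit : F -> K := mmap idfun word_counit.

HB.instance Definition _ :=
  GRing.RMorphism.copy free_counit (mmap idfun word_counit).

Lemma free_counit_alg (c : K) : free_counit c%:A = c.
Proof. by rewrite /free_counit mmapZ rmorph1 mulr1. Qed.

Lemma free_counit_u : map_mx free_counit BE_u = 1%:M.
Proof.
apply/matrixP => i j; rewrite !mxE /free_counit /free_gen mmapU /= mul1r.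
by rewrite /word_counit fmU big_seq1.
Qed.

Hypothesis E_unit : E \in unitmx.

Lemma free_counit_rel x : BE_rel x -> free_counit x = 0.
Proof.
have [e1 e2] := BE_counit E_unit free_counit_alg free_counit_u.
have e (M : 'M[F]_n) i j : map_mx free_counit M = 1%:M ->
  free_counit ((M - 1%:M) i j) = 0.
  move=> /matrixP/(_ i j); rewrite !mxE rmorphB rmorph_nat /= => ->.
  by rewrite subrr.
case=> i [j [|]] ->; [exact: (e _ i j e1) | exact: (e _ i j e2)].
Qed.

Lemma BE_rel_proper : 1 \notin gen_ideal BE_rel.
Proof.
apply/asboolP => -[s sR /(congr1 free_counit)]; rewrite rmorph1 => /eqP.
rewrite raddf_sum big_seq big1 ?oner_eq0 // => t /sR /free_counit_rel t0.
by rewrite /= !rmorphM /= t0 mulr0 mul0r.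
Qed.

(* The algebra B(E), with BE_gen its matrix of generators. *)
Definition BE : algType K := quot_alg BE_rel_proper.

Definition BE_gen : 'M[BE]_n := map_mx (qpi BE_rel_proper) BE_u.

Lemma BE_gen_rel : BE_left E BE_gen = 1%:M /\ BE_right E BE_gen = 1%:M.
Proof.
have [<- <-] := map_BE E (qpi BE_rel_proper : {lrmorphism _ -> _}) BE_u.
rewrite -(map_mx1 (qpi BE_rel_proper)).
split; apply/matrixP => i j; rewrite ![map_mx _ _ _ _]mxE; apply/qpiP;
apply: gen_ideal_gen; exists i, j; [left | right];
by rewrite [RHS]mxE; congr (_ + _); rewrite [RHS]mxE.
Qed.

End BE.

(* The scalars act through A on both sides in the same way, since lact and ract
   are K-bilinear: these are the modules over A (x) A^op. *)
Record bimodule (K : comNzRingType) (A : algType K) := Bimodule {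
  bimod_sort :> lmodType K;
  lact : A -> bimod_sort -> bimod_sort;
  ract : bimod_sort -> A -> bimod_sort;
  lact_linear : forall a, linear (lact a);
  lact_linearl : forall m, linear (lact^~ m);
  lact1 : forall m, lact 1 m = m;
  lactM : forall a b m, lact (a * b) m = lact a (lact b m);
  ract_linear : forall a, linear (ract^~ a);
  ract_linearr : forall m, linear (ract m);
  ract1 : forall m, ract m 1 = m;
  ractM : forall m a b, ract m (a * b) = ract (ract m a) b;
  lractA : forall a m b, lact a (ract m b) = ract (lact a m) b }.

Section Smooth.
Variables (K : comNzRingType) (A : algType K).
Implicit Types M N P : bimodule A.

Program Definition regular_bimodule : bimodule A :=
  @Bimodule K A A *%R *%R _ _ (@mul1r A) _ _ _ (@mulr1 A) _ _.
Next Obligation. by move=> c x y; rewrite mulrDr scalerAr. Qed.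
Next Obligation. by move=> c x y; rewrite mulrDl scalerAl. Qed.
Next Obligation. by rewrite mulrA. Qed.
Next Obligation. by move=> c x y; rewrite mulrDl scalerAl. Qed.
Next Obligation. by move=> c x y; rewrite mulrDr scalerAr. Qed.
Next Obligation. by rewrite mulrA. Qed.
Next Obligation. by rewrite mulrA. Qed.

Definition bimod_hom M N (f : M -> N) := [/\ linear f,
  forall a m, f (lact a m) = lact a (f m) &
  forall m a, f (ract m a) = ract (f m) a].

Definition projective P := forall M N (g : M -> N) (f : P -> N),
  bimod_hom g -> (forall y, exists x, g x = y) -> bimod_hom f ->
  exists2 h : P -> M, bimod_hom h & forall x, g (h x) = f x.

Definition fin_gen M := exists s : seq M, forall m, exists2 t : seq (A * M * A),
  (forall u, u \in t -> u.1.2 \in s) &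
  m = \sum_(u <- t) ract (lact u.1.1 u.1.2) u.2.

(* Exact 0 -> P_l -> ... -> P_0 -> A -> 0, extended by P_i = 0 for i > l. *)
Definition has_fgp_resolution (l : nat) :=
  exists (P : nat -> bimodule A) (d : forall i, P i.+1 -> P i)
         (e : P 0%N -> regular_bimodule),
  [/\ forall i, projective (P i) /\ fin_gen (P i),
      forall i, (l < i)%N -> forall x : P i, x = 0,
      bimod_hom e /\ forall i, bimod_hom (d i),
      (forall a, exists x, e x = a) /\
      (forall x, e x = 0 <-> exists y, d 0%N y = x) &
      forall i x, d i x = 0 <-> exists y, d i.+1 y = x].

Definition smooth_of_dim (d : nat) :=
  has_fgp_resolution d /\ forall l, has_fgp_resolution l -> (d <= l)%N.

End Smooth.

(* ker g / (im f :&: ker g); in all uses below g \o f = 0. *)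
Section Homology.
Variables (U V W : zmodType) (f : {additive U -> V}) (g : {additive V -> W}).

Definition ker_pred : {pred V} := fun x => g x == 0.

Fact ker_zmod_closed : zmod_closed ker_pred.
Proof.
split=> [|x y]; rewrite !unfold_in ?raddf0 // => /eqP gx /eqP gy.
by rewrite raddfB gx gy subrr.
Qed.

HB.instance Definition _ := GRing.isZmodClosed.Build V ker_pred ker_zmod_closed.

Definition cycles : Type := {x : V | x \in ker_pred}.
HB.instance Definition _ := SubChoice.on cycles.
HB.instance Definition _ := [SubChoice_isSubZmodule of cycles by <:].

Definition boundaries : {pred cycles} := fun z => `[< exists y, f y = val z >].

Fact boundaries_zmod_closed : zmod_closed boundaries.
Proof.
split; first by apply/asboolP; exists 0; rewrite raddf0.
move=> x y /asboolP[x' fx] /asboolP[y' fy]; apply/asboolP.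
by exists (x' - y'); rewrite raddfB fx fy.
Qed.

HB.instance Definition _ :=
  GRing.isZmodClosed.Build cycles boundaries boundaries_zmod_closed.

Definition homology : zmodType := {ideal_quot boundaries}.

End Homology.

Section Tuples.
Variables (K : comNzRingType) (A : algType K) (k : nat).

(* upd a p x replaces the p-th entry of a by x. *)
Definition upd m (a : {ffun 'I_m -> A}) (p : 'I_m) (x : A) : {ffun 'I_m -> A} :=
  [ffun j => if j == p then x else a j].

Variable a : {ffun 'I_k.+1 -> A}.

Definition tup_behead : {ffun 'I_k -> A} := [ffun j => a (lift ord0 j)].

Definition tup_belast : {ffun 'I_k -> A} :=
  [ffun j => a (widen_ord (leqnSn k) j)].

(* (a_0, ..., a_k) |-> (a_0, ..., a_i * a_(i+1), ..., a_k) *)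
Definition tup_merge (i : 'I_k) : {ffun 'I_k -> A} :=
  [ffun j : 'I_k => if (j < i)%N then a (widen_ord (leqnSn k) j)
   else if j == i then a (widen_ord (leqnSn k) j) * a (lift ord0 j)
   else a (lift ord0 j)].

End Tuples.

Section TupleLemmas.
Variables (K : comNzRingType) (A : algType K) (k : nat).
Implicit Types (a : {ffun 'I_k.+1 -> A}) (p : 'I_k.+1).

Lemma upd_same m (a : {ffun 'I_m -> A}) (p : 'I_m) x : upd a p x p = x.
Proof. by rewrite ffunE eqxx. Qed.

Lemma upd_neq m (a : {ffun 'I_m -> A}) (p : 'I_m) x j :
  j != p -> upd a p x j = a j.
Proof. by rewrite ffunE => /negPf->. Qed.

Lemma behead_upd0 a x : tup_behead (upd a ord0 x) = tup_behead a.
Proof. by apply/ffunP => j; rewrite !ffunE. Qed.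

Lemma behead_upd a (q : 'I_k) x :
  tup_behead (upd a (lift ord0 q) x) = upd (tup_behead a) q x.
Proof. by apply/ffunP => j; rewrite !ffunE (inj_eq lift_inj). Qed.

Lemma belast_upd_max a x : tup_belast (upd a ord_max x) = tup_belast a.
Proof.
apply/ffunP => j; rewrite !ffunE -val_eqE /= ifN //.
by rewrite neq_ltn ltn_ord.
Qed.

Lemma belast_upd a (q : 'I_k) x :
  tup_belast (upd a (widen_ord (leqnSn k) q) x) = upd (tup_belast a) q x.
Proof. by apply/ffunP => j; rewrite !ffunE -val_eqE. Qed.

Lemma merge_upd a p (i : 'I_k) : exists (q : 'I_k) (b c : A),
  forall x, tup_merge (upd a p x) i = upd (tup_merge a i) q (b * x * c).
Proof.
case: (ltngtP p i) => pi.
- exists (Ordinal (ltn_trans pi (ltn_ord i))), 1, 1 => x.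
  apply/ffunP => j; rewrite !ffunE -!val_eqE /= mul1r mulr1.
  case: (eqVneq (j : nat) p) => [-> | jp]; first by rewrite pi.
  case: ltngtP => //= ji.
    by rewrite ifN // /bump leq0n neq_ltn (ltn_trans pi) ?orbT // ltnS ltnW.
  by rewrite ifN // /bump leq0n neq_ltn ji (ltn_trans pi) ?orbT // ltnS.
- have [->|ne] := eqVneq p (lift ord0 i).
    exists i, (a (widen_ord (leqnSn k) i)), 1 => x.
    apply/ffunP => j; rewrite !ffunE -!val_eqE /= mulr1 /bump leq0n add1n.
    case: ltngtP => //= ji.
    - by rewrite ifN // neq_ltn ltnS ltnW.
    - by rewrite eqSS gtn_eqF.
    by rewrite ji eqxx ltn_eqF //; congr (a _ * _); apply/val_inj; rewrite /= ji.
  case: (unliftP ord0 p) => [q pq|p0]; last by rewrite p0 in pi.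
  have qi : (i < q)%N.
    by move: pi ne; rewrite pq -val_eqE /= /bump leq0n add1n ltnS leq_eqVlt eqSS
      eq_sym => /orP[/eqP->|//]; rewrite eqxx.
  exists q, 1, 1 => x; rewrite pq.
  apply/ffunP => j; rewrite !ffunE -!val_eqE /= mulr1 mul1r /bump !leq0n !add1n.
  rewrite !eqSS; case: (ltngtP j i) => //= ji.
  - by rewrite !ifN // neq_ltn ?(ltn_trans ji) // ltnS ltnW // (ltn_trans ji).
  by rewrite ji !ifN // neq_ltn ?qi // ltnS ltnW.
exists i, 1, (a (lift ord0 i)) => x.
apply/ffunP => j; rewrite !ffunE -!val_eqE /= mul1r /bump leq0n add1n pi.
case: ltngtP => //= ji.
- by rewrite gtn_eqF // ltnS ltnW.
by rewrite ji gtn_eqF //; congr (_ * a _); apply/val_inj; rewrite /= ji.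
Qed.

Lemma merge_updD a p (i : 'I_k) (c : K) x y : exists (q : 'I_k) (x' y' : A),
  [/\ tup_merge (upd a p (c *: x + y)) i = upd (tup_merge a i) q (c *: x' + y'),
      tup_merge (upd a p x) i = upd (tup_merge a i) q x' &
      tup_merge (upd a p y) i = upd (tup_merge a i) q y'].
Proof.
have [q [b [d e]]] := merge_upd a p i.
exists q, (b * x * d), (b * y * d); rewrite !e; split=> //; congr upd.
by rewrite mulrDr mulrDl -scalerAr -scalerAl.
Qed.

Variant first_slot_spec : 'I_k.+1 -> Prop :=
| First_slot : first_slot_spec ord0
| Later_slot (q : 'I_k) : first_slot_spec (lift ord0 q).

Lemma first_slotP p : first_slot_spec p.
Proof. by case: (unliftP ord0 p) => [q|] ->; constructor. Qed.

Variant last_slot_spec : 'I_k.+1 -> Prop :=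
| Last_slot : last_slot_spec ord_max
| Earlier_slot (q : 'I_k) : last_slot_spec (widen_ord (leqnSn k) q).

Lemma last_slotP p : last_slot_spec p.
Proof.
case: (unliftP ord_max p) => [q|] ->; last by constructor.
suff -> : lift ord_max q = widen_ord (leqnSn k) q by constructor.
by apply/val_inj; rewrite /= /bump leqNgt ltn_ord.
Qed.

End TupleLemmas.

Section LinearExtension.
Variables (K : comNzRingType) (T : choiceType) (V : lmodType K) (h : T -> V).

Definition malg_lift (g : {malg K[T]}) : V := \sum_(t <- msupp g) g@_t *: h t.

Lemma malg_lift_sub (d : {fset T}) g : (msupp g `<=` d)%fset ->
  malg_lift g = \sum_(t <- d) g@_t *: h t.
Proof.
move=> le; rewrite [LHS](big_fset_incl _ le) => //= x xd /mcoeff_outdom ->.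
by rewrite scale0r.
Qed.

Fact malg_lift_is_linear : linear malg_lift.
Proof.
move=> c x y; pose d := (msupp x `|` msupp y)%fset.
have dx : (msupp x `<=` d)%fset by apply: fsubsetUl.
have dy : (msupp y `<=` d)%fset by apply: fsubsetUr.
rewrite (malg_lift_sub dx) (malg_lift_sub dy) (@malg_lift_sub d); last first.
  apply/fsubsetP => t; apply: contraLR => td.
  rewrite -mcoeff_eq0 mcoeffD mcoeffZ !mcoeff_outdom ?mulr0 ?addr0 //.
    by apply: contra td; apply/fsubsetP.
  by apply: contra td; apply/fsubsetP.
rewrite scaler_sumr -big_split /=; apply: eq_bigr => t _.
by rewrite mcoeffD mcoeffZ scalerDl scalerA.
Qed.

HB.instance Definition _ := GRing.isLinear.Build K {malg K[T]} V *:%R malg_lift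
  malg_lift_is_linear.

Lemma malg_liftU t : malg_lift << t >> = h t.
Proof.
by rewrite (@malg_lift_sub [fset t]%fset) ?msuppU_le // big_seq_fset1 mcoeffUU
  scale1r.
Qed.

End LinearExtension.

Section LinearSpan.
Variables (K : comNzRingType) (V : lmodType K).

Definition lin_span (S : V -> Prop) : {pred V} := fun x => `[< exists2 s :
  seq (K * V), (forall t, t \in s -> S t.2) & x = \sum_(t <- s) t.1 *: t.2 >].

Fact lin_span_submod_closed S : submod_closed (lin_span S).
Proof.
split; first by apply/asboolP; exists [::]; rewrite ?big_nil.
move=> c x y /asboolP[s sS ->] /asboolP[t tS ->]; apply/asboolP.
exists ([seq (c * u.1, u.2) | u <- s] ++ t).
  by move=> u; rewrite mem_cat => /orP[/mapP[v /sS ? ->]|/tS].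
rewrite big_cat big_map scaler_sumr /=; congr (_ + _).
by apply: eq_bigr => u _; rewrite scalerA.
Qed.

HB.instance Definition _ (S : V -> Prop) :=
  GRing.isSubmodClosed.Build K V (lin_span S) (lin_span_submod_closed S).

Lemma lin_span_gen (S : V -> Prop) x : S x -> x \in lin_span S.
Proof.
move=> xS; apply/asboolP; exists [:: (1, x)]; last by rewrite big_seq1 scale1r.
by move=> t; rewrite inE => /eqP->.
Qed.

Definition lin_span_eq S (c : K) (u v w : V) := u - (c *: v + w) \in lin_span S.

Lemma lin_span_eqD S c u v w u' v' w' :
  lin_span_eq S c u v w -> lin_span_eq S c u' v' w' ->
  lin_span_eq S c (u + u') (v + v') (w + w').
Proof.
move=> uvw uvw'; rewrite /lin_span_eq scalerDr [X in _ - X]addrACA opprD addrACA.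
exact: rpredD.
Qed.

Lemma lin_span_eqZ S c e u v w :
  lin_span_eq S c u v w -> lin_span_eq S c (e *: u) (e *: v) (e *: w).
Proof.
move=> uvw; rewrite /lin_span_eq scalerA mulrC -scalerA -scalerDr -scalerBr.
exact: rpredZ.
Qed.

Lemma lin_span_eq_sum S c l (u v w : 'I_l -> V) :
  (forall i, lin_span_eq S c (u i) (v i) (w i)) ->
  lin_span_eq S c (\sum_i u i) (\sum_i v i) (\sum_i w i).
Proof.
move=> uvw; rewrite /lin_span_eq scaler_sumr -big_split -sumrB.
by apply: rpred_sum => i _; apply: uvw.
Qed.

End LinearSpan.

Lemma lin_span_map (K : comNzRingType) (V W : lmodType K) (f : {linear V -> W})
    (S : V -> Prop) (T : W -> Prop) :
  (forall x, S x -> f x \in lin_span T) ->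
  forall x, x \in lin_span S -> f x \in lin_span T.
Proof.
move=> fS x /asboolP[s sS ->]; rewrite linear_sum big_seq.
by apply: rpred_sum => t /sS /fS; rewrite linearZ; apply: rpredZ.
Qed.

(* The Hochschild complex M (x) A^(x)k over K. The tensor product is the free
   K-module on M * A^k modulo the relations of multilinearity. *)
Section Chains.
Variables (K : comNzRingType) (A : algType K) (M : bimodule A).

Section Fixed.
Variable k : nat.

Local Notation F := {malg K[(M * {ffun 'I_k -> A})%type]}.

Definition pure_tensor (m : M) (a : {ffun 'I_k -> A}) : F := << (m, a) >>.

Inductive tensor_rel : F -> Prop :=
| Tensor_rel_mod c m1 m2 a : tensor_rel
    (pure_tensor (c *: m1 + m2) a - (c *: pure_tensor m1 a + pure_tensor m2 a))
| Tensor_rel_arg c m a p x y : tensor_rel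
    (pure_tensor m (upd a p (c *: x + y)) -
     (c *: pure_tensor m (upd a p x) + pure_tensor m (upd a p y))).

Definition tensor_null : {pred F} := lin_span tensor_rel.

HB.instance Definition _ := GRing.SubmodClosed.on tensor_null.

Definition hoch_chain : Type := {ideal_quot tensor_null}.
HB.instance Definition _ :=
  ZmodQuotient.copy hoch_chain {ideal_quot tensor_null}.

End Fixed.

(* b(m (x) a_0 (x) ... (x) a_k) = m a_0 (x) a_1 (x) ... (x) a_k
   + sum_(i < k) (-1)^(i+1) m (x) a_0 (x) ... (x) a_i a_(i+1) (x) ... (x) a_k
   + (-1)^(k+1) a_k m (x) a_0 (x) ... (x) a_(k-1) *)
Section Boundary.
Variable k : nat.

Local Notation F l := {malg K[(M * {ffun 'I_l -> A})%type]}.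

Definition hoch_b_gen (ma : M * {ffun 'I_k.+1 -> A}) : F k :=
  let: (m, a) := ma in
  pure_tensor (ract m (a ord0)) (tup_behead a) +
  \sum_(i < k) (-1) ^+ i.+1 *: pure_tensor m (tup_merge a i) +
  (-1) ^+ k.+1 *: pure_tensor (lact (a ord_max) m) (tup_belast a).

Definition hoch_b_free : F k.+1 -> F k := malg_lift hoch_b_gen.

HB.instance Definition _ := GRing.Linear.on hoch_b_free.

Lemma hoch_b_rel (x : F k.+1) : tensor_rel x -> hoch_b_free x \in @tensor_null k.
Proof.
pose lin c (u v w : F k) := lin_span_eq (@tensor_rel k) c u v w.
have lin_mod c m1 m2 a : lin c (pure_tensor (c *: m1 + m2) a)
    (pure_tensor m1 a) (pure_tensor m2 a).
  exact/lin_span_gen/Tensor_rel_mod.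
have lin_arg c m a p x1 x2 : lin c (pure_tensor m (upd a p (c *: x1 + x2)))
    (pure_tensor m (upd a p x1)) (pure_tensor m (upd a p x2)).
  exact/lin_span_gen/Tensor_rel_arg.
have bE m a : hoch_b_free (pure_tensor m a) = hoch_b_gen (m, a).
  exact: malg_liftU.
case=> {x} [c m1 m2 a|c m a p x y]; rewrite linearB linearD linearZ /= !bE.
  apply: lin_span_eqD; first apply: lin_span_eqD.
  - by rewrite ract_linear.
  - by apply: lin_span_eq_sum => i; apply: lin_span_eqZ.
  by apply: lin_span_eqZ; rewrite lact_linear.
apply: lin_span_eqD; first apply: lin_span_eqD.
- case: (first_slotP p) => [|q].
    by rewrite !upd_same !behead_upd0 ract_linearr.
  by rewrite !behead_upd !upd_neq.
- apply: lin_span_eq_sum => i; apply: lin_span_eqZ.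
  by have [q [x' [y' [-> -> ->]]]] := merge_updD a p i c x y.
apply: lin_span_eqZ; case: (last_slotP p) => [|q].
  by rewrite !upd_same !belast_upd_max lact_linearl.
by rewrite !belast_upd !upd_neq // -val_eqE /= gtn_eqF.
Qed.

Definition hoch_b (x : hoch_chain k.+1) : hoch_chain k :=
  \pi_(hoch_chain k) (hoch_b_free (repr x)).

Lemma hoch_b_pi x : hoch_b (\pi x) = \pi_(hoch_chain k) (hoch_b_free x).
Proof.
apply/eqP; rewrite -Quotient.idealrBE -raddfB; apply: (lin_span_map hoch_b_rel).
by rewrite Quotient.idealrBE reprK.
Qed.

Fact hoch_b_is_zmod_morphism : zmod_morphism hoch_b.
Proof.
move=> x y; rewrite -[x]reprK -[y]reprK -raddfB !hoch_b_pi.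
by rewrite !raddfB.
Qed.

HB.instance Definition _ := GRing.isZmodMorphism.Build
  (hoch_chain k.+1) (hoch_chain k) hoch_b hoch_b_is_zmod_morphism.

End Boundary.

Definition hoch_homology (k : nat) : zmodType :=
  match k with
  | 0 => homology (@hoch_b 0) (\0 : {additive hoch_chain 0 -> hoch_chain 0})
  | k.+1 => homology (@hoch_b k.+1) (@hoch_b k)
  end.

End Chains.

(* The Hochschild complex of multilinear maps A^k -> M. *)
Section Cochains.
Variables (K : comNzRingType) (A : algType K) (M : bimodule A).

Definition multilinear k (f : {ffun 'I_k -> A} -> M) :=
  forall a p, linear (fun x => f (upd a p x)).

Section Fixed.
Variable k : nat.

Definition multilinear_pred : {pred {ffun 'I_k -> A} -> M} :=
  fun f => `[< multilinear f >].

Fact multilinear_zmod_closed : zmod_closed multilinear_pred.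
Proof.
split=> [|f g /asboolP fl /asboolP gl]; apply/asboolP => a p c x y.
  by rewrite scaler0 addr0.
by rewrite !fctE fl gl scalerBr opprD addrACA.
Qed.

HB.instance Definition _ := GRing.isZmodClosed.Build ({ffun 'I_k -> A} -> M)
  multilinear_pred multilinear_zmod_closed.

Definition hoch_cochain : Type :=
  {f : {ffun 'I_k -> A} -> M | f \in multilinear_pred}.
HB.instance Definition _ := SubChoice.on hoch_cochain.
HB.instance Definition _ := [SubChoice_isSubZmodule of hoch_cochain by <:].

End Fixed.

Section Coboundary.
Variable k : nat.

Definition hoch_d_fun (f : {ffun 'I_k -> A} -> M) (a : {ffun 'I_k.+1 -> A}) : M :=
  lact (a ord0) (f (tup_behead a)) +
  \sum_(i < k) (-1) ^+ i.+1 *: f (tup_merge a i) +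
  (-1) ^+ k.+1 *: ract (f (tup_belast a)) (a ord_max).

Lemma hoch_d_multilinear f : multilinear f -> multilinear (hoch_d_fun f).
Proof.
move=> fl a p c x y; rewrite /hoch_d_fun.
have linD (u v w u' v' w' : M) : u = c *: v + w -> u' = c *: v' + w' ->
    u + u' = c *: (v + v') + (w + w').
  by move=> -> ->; rewrite scalerDr addrACA.
have linZ e (u v w : M) : u = c *: v + w -> e *: u = c *: (e *: v) + e *: w.
  by move=> ->; rewrite scalerDr !scalerA mulrC.
apply: (linD _ _ _ _ _ _); first apply: (linD _ _ _ _ _ _).
- case: (first_slotP p) => [|q].
    by rewrite !upd_same !behead_upd0 lact_linearl.
  by rewrite !behead_upd !upd_neq // fl lact_linear.
- rewrite scaler_sumr -big_split; apply: eq_bigr => i _; apply: (linZ _ _ _ _).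
  by have [q [x' [y' [-> -> ->]]]] := merge_updD a p i c x y; apply: fl.
apply: (linZ _ _ _ _); case: (last_slotP p) => [|q].
  by rewrite !upd_same !belast_upd_max ract_linearr.
by rewrite !belast_upd !upd_neq ?fl ?ract_linear // -val_eqE /= gtn_eqF.
Qed.

Fact hoch_d_subproof (f : hoch_cochain k) :
  hoch_d_fun (val f) \in @multilinear_pred k.+1.
Proof.
by apply/asboolP/hoch_d_multilinear; have /asboolP := svalP f.
Qed.

Definition hoch_d (f : hoch_cochain k) : hoch_cochain k.+1 :=
  Sub (hoch_d_fun (val f)) (hoch_d_subproof f).

Fact hoch_d_is_zmod_morphism : zmod_morphism hoch_d.
Proof.
have lactB b m1 m2 : lact b (m1 - m2) = lact b m1 - lact b m2 :> M.
  by rewrite addrC -scaleN1r lact_linear scaleN1r addrC.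
have ractB b m1 m2 : ract (m1 - m2) b = ract m1 b - ract m2 b :> M.
  by rewrite addrC -scaleN1r ract_linear scaleN1r addrC.
move=> f g; apply/val_inj/funext => a; rewrite /= fctE /hoch_d_fun /=.
rewrite !fctE lactB ractB scalerBr !opprD [RHS]addrACA; congr (_ + _).
rewrite [RHS]addrACA -sumrB; congr (_ + _).
by apply: eq_bigr => i _; rewrite -scalerBr.
Qed.

HB.instance Definition _ := GRing.isZmodMorphism.Build
  (hoch_cochain k) (hoch_cochain k.+1) hoch_d hoch_d_is_zmod_morphism.

End Coboundary.

Definition hoch_cohomology (k : nat) : zmodType :=
  match k with
  | 0 => homology (\0 : {additive hoch_cochain 0 -> hoch_cochain 0}) (@hoch_d 0)
  | k.+1 => homology (@hoch_d k) (@hoch_d k.+1)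
  end.

End Cochains.

(* Main.v *)
Require Import Defs.
From HB Require Import structures.
From mathcomp Require Import all_boot all_algebra.
From mathcomp Require Import finmap monalg.
From mathcomp Require Import boolp functions reals complex.
From mathcomp Require Import zify ring.

Set Implicit Arguments.
Unset Strict Implicit.
Unset Printing Implicit Defensive.

Import GRing.Theory.
Local Open Scope ring_scope.
Local Open Scope quotient_scope.

(** Over an algebraically closed field, B(E) is treated in a symmetric form: two
    invertible forms E and G and a matrix u of generators with u G u^T = E^-1 and
    u^T E u = G^-1. A bilinear form of rank at least 2 has an isotropic vector, so
    in suitable bases one row of E is the unit vector at q <> p, and one row of G
    that at q' <> p' ([adapted_basis], [BE_adapted_presentation]).
    In these bases the entry (i, j) of each relation can be solved for its term in
    E p q, resp. G p' q', and becomes a rewriting rule for words of length two.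
    The overlaps are resolved by u G (u^T E u) = (u G u^T) E u, and the only word
    with two rules by the contraction of both relations with E and G, whose
    constants agree because G is a transform of E^-1. By the diamond lemma the
    words containing no redex form a basis ([normal_form]).

    Differentiating the relations gives a complex of free bimodules
        0 -> A (x) A -> A (x) U' (x) A -> A (x) U (x) A -> A (x) A -> A -> 0,
    with U spanned by the entries of u and U' dual to it. The last map sends the
    generator to the syzygy that both contractions have the same derivative. The
    complex is exact because the leading words of the differentials are distinct
    normal words: modulo an image each term is spanned by a family on which the
    next map is injective ([lead_independence], [aug_exact], [exact1], [exact2],
    [d2_inj]). This is the resolution of length 3.

    No resolution is shorter: comparing with one of length at most 2 would give a
    retraction of the last map ([short_resolution_split]). The isometries a with
    a^T E a = G^-1 are the characters of A, and each has a partner b with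
    E^T a G = E b G^T. On the ground field, with A acting through a on the left and
    through b on the right, every homomorphism kills the syzygy, so that there is
    no retraction ([d2_not_split]).

    The vanishing is obtained by shifting degrees through the bimodules of linear
    maps A -> M that vanish at 1: three shifts turn cocycles of degree 4 into
    derivations with values in a bimodule for which, by the resolution, all
    derivations are inner ([factors_shift], [derivation_inner],
    [coboundaries_shift]). Homology follows by duality, from the cohomology with
    values in Hom(M, V), V being chains modulo boundaries
    ([hoch_homology_eq0]). *)

(** * Linear maps, quotients and extension by linearity *)

Section LinearMaps.
Variables (K : comNzRingType) (U V : lmodType K) (f : U -> V).
Hypothesis fL : linear f.

Definition lin_of : {linear U -> V} :=
  HB.pack f (GRing.isLinear.Build K U V *:%R f fL).

Lemma linear0P : f 0 = 0. Proof. exact: (linear0 lin_of). Qed.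
Lemma linearDP x y : f (x + y) = f x + f y. Proof. exact: (linearD lin_of). Qed.
Lemma linearBP x y : f (x - y) = f x - f y. Proof. exact: (linearB lin_of). Qed.
Lemma linearZP c x : f (c *: x) = c *: f x.
Proof. by rewrite -[c *: x]addr0 fL linear0P addr0. Qed.

Lemma linear_sumP I r (P : pred I) F :
  f (\sum_(i <- r | P i) F i) = \sum_(i <- r | P i) f (F i).
Proof. exact: (linear_sum lin_of). Qed.

End LinearMaps.

Lemma linear_comp (K : comNzRingType) (U V W : lmodType K) (f : V -> W)
  (g : U -> V) : linear f -> linear g -> linear (f \o g).
Proof. by move=> fL gL c x y /=; rewrite gL fL. Qed.

Section MalgExt.
Variables (K : comNzRingType) (T : choiceType) (V : lmodType K).

Lemma malgE (g : {malg K[T]}) : g = \sum_(t <- msupp g) g@_t *: << t >>.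
Proof.
rewrite [LHS]monalgE; apply: eq_bigr => t _.
by apply/malgP => k; rewrite mcoeffZ !mcoeffU mulr_natr.
Qed.

Lemma malg_ext (f h : {malg K[T]} -> V) : linear f -> linear h ->
  (forall t, f << t >> = h << t >>) -> f =1 h.
Proof.
move=> fL hL fh g; rewrite (malgE g) (linear_sumP fL) (linear_sumP hL).
by apply: eq_bigr => t _; rewrite (linearZP fL) (linearZP hL) fh.
Qed.

End MalgExt.

Section LinearQuotient.
Variables (K : comNzRingType) (V : lmodType K) (S : V -> Prop).

Definition lquot : Type := {ideal_quot lin_span S}.

HB.instance Definition _ := GRing.Zmodule.copy lquot {ideal_quot lin_span S}.

Definition lpi (x : V) : lquot := \pi_{ideal_quot lin_span S} x.
Definition lrep (x : lquot) : V := repr (x : {ideal_quot lin_span S}).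

Lemma lrepK : cancel lrep lpi.
Proof. by move=> x; exact: (@reprK _ _ (x : {ideal_quot lin_span S})). Qed.

Lemma lpiP x y : reflect (lpi x = lpi y) (x - y \in lin_span S).
Proof. by rewrite Quotient.idealrBE; exact: eqP. Qed.

Lemma lpiD x y : lpi (x + y) = lpi x + lpi y.
Proof. by rewrite /lpi raddfD. Qed.

Definition lquot_scale (c : K) (x : lquot) : lquot := lpi (c *: lrep x).

Lemma lquot_scaleE c x : lquot_scale c (lpi x) = lpi (c *: x).
Proof.
by apply/lpiP; rewrite -scalerBr; apply: rpredZ; apply/lpiP; rewrite lrepK.
Qed.

Fact lquot_scaleA a b x :
  lquot_scale a (lquot_scale b x) = lquot_scale (a * b) x.
Proof. by rewrite -[x]lrepK !lquot_scaleE scalerA. Qed.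

Fact lquot_scale1 : left_id 1 lquot_scale.
Proof. by move=> x; rewrite -[x]lrepK lquot_scaleE scale1r. Qed.

Fact lquot_scaleDr : right_distributive lquot_scale +%R.
Proof.
by move=> a x y; rewrite -[x]lrepK -[y]lrepK -lpiD !lquot_scaleE scalerDr lpiD.
Qed.

Fact lquot_scaleDl x : {morph lquot_scale^~ x : a b / a + b}.
Proof. by move=> a b; rewrite -[x]lrepK !lquot_scaleE scalerDl lpiD. Qed.

HB.instance Definition _ := GRing.Zmodule_isLmodule.Build K lquot
  lquot_scaleA lquot_scale1 lquot_scaleDr lquot_scaleDl.

Fact lpi_linear : linear lpi.
Proof. by move=> c x y; rewrite lpiD -lquot_scaleE. Qed.

HB.instance Definition _ := GRing.isLinear.Build K V lquot *:%R lpi lpi_linear.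

Section Lift.
Variables (W : lmodType K) (f : V -> W).
Hypotheses (fL : linear f) (fS : forall x, S x -> f x = 0).

Definition lquot_lift (x : lquot) : W := f (lrep x).

Lemma lquot_liftE x : lquot_lift (lpi x) = f x.
Proof.
apply/eqP; rewrite -subr_eq0 -(linearBP fL); apply/eqP.
have /lpiP/asboolP[s sS ->] : lpi (lrep (lpi x)) = lpi x by rewrite lrepK.
rewrite (linear_sumP fL) big_seq big1 // => t /sS /fS t0.
by rewrite (linearZP fL) t0 scaler0.
Qed.

Lemma lquot_lift_linear : linear lquot_lift.
Proof.
move=> c x y; rewrite -[x]lrepK -[y]lrepK -linearZ -linearD !lquot_liftE.
exact: fL.
Qed.

End Lift.
End LinearQuotient.

(** * Free bimodules *)

Section BimoduleTheory.
Variables (K : comNzRingType) (A : algType K).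
Implicit Types M N P : bimodule A.

HB.instance Definition _ M a :=
  GRing.isLinear.Build K M M *:%R (@lact K A M a) (lact_linear a).

Lemma ract_suml M a I r (Q : pred I) (F : I -> M) :
  ract (\sum_(i <- r | Q i) F i) a = \sum_(i <- r | Q i) ract (F i) a.
Proof. exact: (linear_sumP (ract_linear a)). Qed.

Lemma ractDl M (m n : M) a : ract (m + n) a = ract m a + ract n a.
Proof. exact: (linearDP (ract_linear a)). Qed.

Lemma ractBl M (m n : M) a : ract (m - n) a = ract m a - ract n a.
Proof. exact: (linearBP (ract_linear a)). Qed.

Lemma ractZl M c (m : M) a : ract (c *: m) a = c *: ract m a.
Proof. exact: (linearZP (ract_linear a)). Qed.

Lemma bimod_hom_comp M N P (f : N -> P) (g : M -> N) :
  bimod_hom f -> bimod_hom g -> bimod_hom (f \o g).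
Proof.
move=> [fL fl fr] [gL gl gr]; split=> [|a m|m a] /=.
- exact: linear_comp.
- by rewrite gl fl.
- by rewrite gr fr.
Qed.

Lemma bimod_hom_id M : bimod_hom (@id M).
Proof. by split. Qed.

Lemma bimod_homB M N (f g : M -> N) :
  bimod_hom f -> bimod_hom g -> bimod_hom (fun x => f x - g x).
Proof.
move=> [fL fl fr] [gL gl gr]; split=> [c x y|a m|m a].
- by rewrite fL gL scalerBr opprD addrACA.
- by rewrite fl gl linearB.
- by rewrite fr gr ractBl.
Qed.

End BimoduleTheory.

Arguments lact : simpl never.
Arguments ract : simpl never.

Section FreeBimoduleCarrier.
Variables (K : comNzRingType) (A : algType K) (X : choiceType).

Local Notation F := {malg K[(A * X * A)%type]}.

Inductive trilinear_rel : F -> Prop :=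
| Trilinear_rel_left c a a' x b : trilinear_rel
    (<< (c *: a + a', x, b) >> - (c *: << (a, x, b) >> + << (a', x, b) >>))
| Trilinear_rel_right c a x b b' : trilinear_rel
    (<< (a, x, c *: b + b') >> - (c *: << (a, x, b) >> + << (a, x, b') >>)).

(** A (x) K[X] (x) A. *)
Definition free_bimod : Type := lquot trilinear_rel.
HB.instance Definition _ := GRing.Lmodule.on free_bimod.

End FreeBimoduleCarrier.

(** Locked, so that unification does not look into the quotient. *)
HB.lock Definition ten (K : comNzRingType) (A : algType K) (X : choiceType)
  (a : A) (x : X) (b : A) : free_bimod A X :=
  lpi (@trilinear_rel K A X) << (a, x, b) >>.

Section FreeBimodule.
Variables (K : comNzRingType) (A : algType K) (X : choiceType).

Local Notation trilinear_rel := (@trilinear_rel K A X).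
Local Notation free_bimod := (free_bimod A X).
Local Notation ten := (@ten K A X).

Lemma tenE a x b : ten a x b = lpi trilinear_rel << (a, x, b) >>.
Proof. by rewrite ten.unlock. Qed.

Lemma ten_linearl x b : linear (fun a => ten a x b).
Proof.
move=> c a a'; rewrite !tenE -linearZ -linearD; apply/lpiP/lin_span_gen.
exact: Trilinear_rel_left.
Qed.

Lemma ten_linearr a x : linear (ten a x).
Proof.
move=> c b b'; rewrite !tenE -linearZ -linearD; apply/lpiP/lin_span_gen.
exact: Trilinear_rel_right.
Qed.

Lemma tenDl a a' x b : ten (a + a') x b = ten a x b + ten a' x b.
Proof. exact: (linearDP (ten_linearl x b)). Qed.
Lemma tenZl c a x b : ten (c *: a) x b = c *: ten a x b.
Proof. exact: (linearZP (ten_linearl x b)). Qed.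
Lemma ten_suml I r (P : pred I) (f : I -> A) x b :
  ten (\sum_(i <- r | P i) f i) x b = \sum_(i <- r | P i) ten (f i) x b.
Proof. exact: (linear_sumP (ten_linearl x b)). Qed.
Lemma tenDr a x b b' : ten a x (b + b') = ten a x b + ten a x b'.
Proof. exact: (linearDP (ten_linearr a x)). Qed.
Lemma tenZr c a x b : ten a x (c *: b) = c *: ten a x b.
Proof. exact: (linearZP (ten_linearr a x)). Qed.
Lemma ten_sumr I r (P : pred I) (f : I -> A) a x :
  ten a x (\sum_(i <- r | P i) f i) = \sum_(i <- r | P i) ten a x (f i).
Proof. exact: (linear_sumP (ten_linearr a x)). Qed.

Lemma free_bimodE (y : free_bimod) :
  exists s : seq (A * X * A), y = \sum_(t <- s) ten t.1.1 t.1.2 t.2.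
Proof.
rewrite -[y]lrepK; move: (lrep y) => g; rewrite (malgE g) linear_sum.
exists [seq (g@_t *: t.1.1, t.1.2, t.2) | t <- msupp g].
rewrite big_map; apply: eq_bigr => -[[a x] b] _ /=.
by rewrite linearZ tenZl tenE.
Qed.

Lemma free_bimod_ext (V : lmodType K) (f h : free_bimod -> V) :
  linear f -> linear h ->
  (forall a x b, f (ten a x b) = h (ten a x b)) -> f =1 h.
Proof.
move=> fL hL fh y; have [s ->] := free_bimodE y.
by rewrite (linear_sumP fL) (linear_sumP hL); apply: eq_bigr => t _; apply: fh.
Qed.

End FreeBimodule.

HB.lock Definition ten_lift (K : comNzRingType) (A : algType K) (X : choiceType)
  (V : lmodType K) (f : A -> X -> A -> V) : free_bimod A X -> V :=
  lquot_lift (malg_lift (fun t : A * X * A => f t.1.1 t.1.2 t.2)).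

Section FreeBimoduleLift.
Variables (K : comNzRingType) (A : algType K) (X : choiceType).
Variables (V : lmodType K) (f : A -> X -> A -> V).
Hypotheses (fl : forall x b, linear (fun a => f a x b))
           (fr : forall a x, linear (f a x)).

Let ten_lift_rel x : @trilinear_rel K A X x ->
  malg_lift (fun t : A * X * A => f t.1.1 t.1.2 t.2) x = 0.
Proof.
set h := malg_lift _.
have hE a y b : h << (a, y, b) >> = f a y b by apply: malg_liftU.
have hL : linear h by move=> c u v; apply: linearP.
clearbody h.
have hr c u v w : h (u - (c *: v + w)) = h u - (c *: h v + h w).
  by rewrite (linearBP hL) (linearDP hL) (linearZP hL).
case=> [c a a' y b|c a y b b']; apply: etrans (hr _ _ _ _) _;
  apply/eqP; rewrite subr_eq0; apply/eqP.
  apply: etrans (hE _ _ _) (etrans (fl y b c a a') _).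
  by congr (_ *: _ + _); apply: esym (hE _ _ _).
apply: etrans (hE _ _ _) (etrans (fr a y c b b') _).
by congr (_ *: _ + _); apply: esym (hE _ _ _).
Qed.

Lemma ten_lift_linear : linear (ten_lift f).
Proof. by rewrite ten_lift.unlock; apply: lquot_lift_linear => // c x y; rewrite linearP. Qed.

Lemma ten_liftE a x b : ten_lift f (ten a x b) = f a x b.
Proof.
rewrite ten_lift.unlock tenE lquot_liftE ?malg_liftU // => c u v.
exact: linearP.
Qed.

End FreeBimoduleLift.

Section FreeBimoduleActions.
Variables (K : comNzRingType) (A : algType K) (X : choiceType).

Local Notation free_bimod := (free_bimod A X).
Local Notation ten := (@ten K A X).

Definition free_lact (c : A) : free_bimod -> free_bimod :=
  ten_lift (fun a x b => ten (c * a) x b).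
Definition free_ract (y : free_bimod) (c : A) : free_bimod :=
  ten_lift (fun a x b => ten a x (b * c)) y.

Let lactl c x b : linear (fun a => ten (c * a) x b).
Proof. by move=> d a a'; rewrite mulrDr -scalerAr ten_linearl. Qed.
Let lactr c a x : linear (ten (c * a) x).
Proof. exact: ten_linearr. Qed.
Let ractl c x b : linear (fun a => ten a x (b * c)).
Proof. exact: ten_linearl. Qed.
Let ractr c a x : linear (fun b => ten a x (b * c)).
Proof. by move=> d b b'; rewrite mulrDl -scalerAl ten_linearr. Qed.

Let free_lactE c a x b : free_lact c (ten a x b) = ten (c * a) x b.
Proof. by rewrite /free_lact ten_liftE. Qed.
Let free_ractE c a x b : free_ract (ten a x b) c = ten a x (b * c).
Proof. by rewrite /free_ract ten_liftE. Qed.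
Let free_lact_linear c : linear (free_lact c).
Proof. exact: ten_lift_linear. Qed.
Let free_ract_linear c : linear (free_ract^~ c).
Proof. by apply: ten_lift_linear. Qed.

Let free_lact_linearl y : linear (free_lact^~ y).
Proof.
move=> c a a'; have [s ->] := free_bimodE y.
rewrite !(linear_sumP (free_lact_linear _)) scaler_sumr -big_split.
apply: eq_bigr => t _ /=.
by rewrite !free_lactE mulrDl -scalerAl ten_linearl.
Qed.

Let free_ract_linearr y : linear (free_ract y).
Proof.
move=> c a a'; have [s ->] := free_bimodE y.
rewrite !(linear_sumP (free_ract_linear _)) scaler_sumr -big_split.
apply: eq_bigr => t _ /=.
by rewrite !free_ractE mulrDr -scalerAr ten_linearr.
Qed.

Let free_lact1 y : free_lact 1 y = y.
Proof.
move: y; apply: (free_bimod_ext (f := free_lact 1) (h := id)).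
- exact: free_lact_linear.
- by [].
by move=> a x b; rewrite free_lactE mul1r.
Qed.

Let free_ract1 y : free_ract y 1 = y.
Proof.
move: y; apply: (free_bimod_ext (f := free_ract^~ 1) (h := id)).
- exact: free_ract_linear.
- by [].
by move=> a x b; rewrite free_ractE mulr1.
Qed.

Let free_lactM a b y : free_lact (a * b) y = free_lact a (free_lact b y).
Proof.
move: y; apply: (free_bimod_ext (f := free_lact (a * b))
  (h := free_lact a \o free_lact b)).
- exact: free_lact_linear.
- exact: linear_comp (free_lact_linear _) (free_lact_linear _).
by move=> a' x b'; rewrite /= !free_lactE mulrA.
Qed.

Let free_ractM y a b : free_ract y (a * b) = free_ract (free_ract y a) b.
Proof.
move: y; apply: (free_bimod_ext (f := free_ract^~ (a * b))
  (h := free_ract^~ b \o free_ract^~ a)).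
- exact: free_ract_linear.
- exact: linear_comp (free_ract_linear _) (free_ract_linear _).
by move=> a' x b'; rewrite /= !free_ractE mulrA.
Qed.

Let free_lractA a y b :
  free_lact a (free_ract y b) = free_ract (free_lact a y) b.
Proof.
move: y; apply: (free_bimod_ext (f := free_lact a \o free_ract^~ b)
  (h := free_ract^~ b \o free_lact a)).
- exact: linear_comp (free_lact_linear _) (free_ract_linear _).
- exact: linear_comp (free_ract_linear _) (free_lact_linear _).
by move=> a' x b'; rewrite /= !(free_lactE, free_ractE).
Qed.

Definition FreeB : bimodule A := @Bimodule K A free_bimod
  free_lact free_ract free_lact_linear free_lact_linearl free_lact1 free_lactM
  free_ract_linear free_ract_linearr free_ract1 free_ractM free_lractA.

Lemma lact_ten c a x b : lact c (ten a x b : FreeB) = ten (c * a) x b.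
Proof. exact: free_lactE. Qed.

Lemma ract_ten c a x b : ract (ten a x b : FreeB) c = ten a x (b * c).
Proof. exact: free_ractE. Qed.

Lemma free_hom_ext (M : bimodule A) (f h : FreeB -> M) :
  bimod_hom f -> bimod_hom h ->
  (forall x, f (ten 1 x 1) = h (ten 1 x 1)) -> f =1 h.
Proof.
move=> [fL fl fr] [hL hl hr] fh; apply: free_bimod_ext => // a x b.
have -> : ten a x b = lact a (ract (ten 1 x 1 : FreeB) b).
  by rewrite ract_ten lact_ten mul1r mulr1.
by rewrite fl fr hl hr fh.
Qed.

Section Hom.
Variables (M : bimodule A) (f : X -> M).

Definition free_hom : FreeB -> M :=
  ten_lift (fun a x b => ract (lact a (f x)) b).

Let free_homl x b : linear (fun a => ract (lact a (f x)) b).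
Proof. by move=> c a a'; rewrite lact_linearl ract_linear. Qed.
Let free_homr a x : linear (ract (lact a (f x))).
Proof. exact: ract_linearr. Qed.

Lemma free_homE a x b : free_hom (ten a x b) = ract (lact a (f x)) b.
Proof. by rewrite /free_hom ten_liftE. Qed.

Lemma free_hom1 x : free_hom (ten 1 x 1) = f x.
Proof. by rewrite free_homE ract1 lact1. Qed.

Lemma free_homP : bimod_hom free_hom.
Proof.
have hL : linear free_hom by apply: ten_lift_linear.
split=> [//|a|m a].
  apply: (free_bimod_ext (f := free_hom \o free_lact a)
    (h := @lact _ _ M a \o free_hom)) => [||a' x b].
  - exact: linear_comp hL (free_lact_linear _).
  - exact: linear_comp (@lact_linear _ _ M a) hL.
  by rewrite /= free_lactE !free_homE lractA lactM.
move: m; apply: (free_bimod_ext (f := free_hom \o free_ract^~ a)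
  (h := (@ract _ _ M)^~ a \o free_hom)) => [||a' x b].
- exact: linear_comp hL (free_ract_linear _).
- exact: linear_comp (@ract_linear _ _ M a) hL.
by rewrite /= free_ractE !free_homE ractM.
Qed.

End Hom.

(** Unlike for projectivity, [g] need not be surjective: it is enough to lift the
    images of the basis. *)
Lemma free_lifting (M N : bimodule A) (g : M -> N) (f : FreeB -> N) :
  bimod_hom g -> bimod_hom f ->
  (forall x, exists m, g m = f (ten 1 x 1)) ->
  exists2 h : FreeB -> M, bimod_hom h & forall y, g (h y) = f y.
Proof.
move=> gH fH gf; have {}gf x : exists m, g m == f (ten 1 x 1).
  by have [m <-] := gf x; exists m.
exists (free_hom (fun x => xchoose (gf x))); first exact: free_homP.
apply: (@free_hom_ext _ (g \o _) f) => //.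
  exact: bimod_hom_comp (free_homP _).
by move=> x /=; rewrite free_hom1; apply/eqP/(xchooseP (gf x)).
Qed.

Lemma free_projective : projective FreeB.
Proof.
by move=> M N g f gH gs fH; apply: free_lifting => // x; apply: gs.
Qed.

End FreeBimoduleActions.

Arguments FreeB : simpl never.

Lemma free_fin_gen (K : comNzRingType) (A : algType K) (X : finType) :
  fin_gen (FreeB A X).
Proof.
exists [seq ten 1 x 1 : FreeB A X | x <- enum X] => y.
have [s ->] := free_bimodE y.
exists [seq (t.1.1, ten 1 t.1.2 1 : FreeB A X, t.2) | t <- s].
  by move=> u /mapP[t _ ->] /=; apply: map_f; rewrite mem_enum.
rewrite big_map; apply: eq_bigr => t _.
by rewrite /= lact_ten ract_ten mulr1 mul1r.
Qed.

(** A projective bimodule is a retract of the free bimodule on its elements, so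
    it inherits the lifting property along exact pairs. *)
Lemma projective_lifting (K : comNzRingType) (A : algType K)
    (P M N : bimodule A) (g : M -> N) (f : P -> N) :
  projective P -> bimod_hom g -> bimod_hom f ->
  (forall x, exists m, g m = f x) ->
  exists2 h : P -> M, bimod_hom h & forall y, g (h y) = f y.
Proof.
move=> Pp gH fH gf; pose r := free_hom (@id P).
have rH : bimod_hom r by apply: free_homP.
have rs y : exists x, r x = y by exists (ten 1 y 1); rewrite /r free_hom1.
have [i iH ri] := Pp _ _ r id rH rs (bimod_hom_id P).
have [h hH gh] : exists2 h, bimod_hom h & forall y, g (h y) = f (r y).
  by apply: (free_lifting gH (bimod_hom_comp fH rH)) => x; apply: gf.
exists (h \o i); first exact: bimod_hom_comp.
by move=> y; rewrite /= gh ri.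
Qed.

(** * Noncommutative polynomials and the diamond lemma *)

Lemma linear_mul_span (K : comNzRingType) (T B : algType K) (I : Type)
    (e : I -> T) (f : {linear T -> B}) :
  (forall x, exists s : seq (K * I), x = \sum_(t <- s) t.1 *: e t.2) ->
  (forall i j, f (e i * e j) = f (e i) * f (e j)) -> {morph f : x y / x * y}.
Proof.
move=> span fM x y; have [s ->] := span x; have [s' ->] := span y.
rewrite mulr_suml !linear_sum mulr_suml; apply: eq_bigr => t _.
rewrite mulr_sumr !linear_sum mulr_sumr; apply: eq_bigr => t' _.
by rewrite -scalerAl -scalerAr !linearZ /= fM -scalerAl -scalerAr.
Qed.

Section FreeAlgebraTheory.
Variables (K : comNzRingType) (X : choiceType).

Local Notation T := (free_alg K X).

Definition wd (w : seq X) : T := << FMonom w >>.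

Lemma wd_nil : wd [::] = 1.
Proof. by congr (<< _ >>); apply/eqP; rewrite fmP fm1. Qed.

Lemma wd_cat a b : wd (a ++ b) = wd a * wd b.
Proof.
rewrite /wd [RHS](@malgME {fmonom X} K) !msuppU1 !big_seq_fset1 !mcoeffUU mulr1.
by congr (<< _ >>); apply/eqP; rewrite fmP fmM.
Qed.

Lemma wd_cons x w : wd (x :: w) = wd [:: x] * wd w.
Proof. exact: (wd_cat [:: x]). Qed.

Lemma free_genE x : free_gen K x = wd [:: x].
Proof. by congr (<< _ >>); apply/eqP; rewrite fmP fmU. Qed.

Lemma free_algE (f : T) :
  exists s : seq (K * seq X), f = \sum_(t <- s) t.1 *: wd t.2.
Proof.
exists [seq (f@_m, fmonom_val m) | m <- msupp f].
by rewrite big_map [LHS](@malgE K {fmonom X}); apply: eq_bigr => -[].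
Qed.

Lemma free_alg_ext (V : lmodType K) (f h : T -> V) : linear f -> linear h ->
  (forall w, f (wd w) = h (wd w)) -> f =1 h.
Proof. by move=> fL hL fh; apply: malg_ext => // -[w]; apply: fh. Qed.

Section Lift.
Variables (B : algType K) (g : X -> B).

Definition free_lift : T -> B :=
  malg_lift (fun m : {fmonom X} => \prod_(x <- fmonom_val m) g x).

HB.instance Definition _ := GRing.Linear.on free_lift.

Lemma free_lift_wd w : free_lift (wd w) = \prod_(x <- w) g x.
Proof. exact: malg_liftU. Qed.

Lemma free_lift_gen x : free_lift (free_gen K x) = g x.
Proof. by rewrite free_genE free_lift_wd big_seq1. Qed.

Fact free_lift_is_monoid_morphism : monoid_morphism free_lift.
Proof.
split; first by rewrite -wd_nil free_lift_wd big_nil.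
apply: linear_mul_span free_algE _ => v w.
by rewrite -wd_cat /= !free_lift_wd big_cat.
Qed.

HB.instance Definition _ := GRing.isMonoidMorphism.Build T B free_lift
  free_lift_is_monoid_morphism.

End Lift.
End FreeAlgebraTheory.

(** Bergman's diamond lemma for rules rewriting words of length two. Rules are
    indexed by [J]; the rule [j] rewrites the word [lead j] into [tail j], and
    the measure [mu] of words decreases under every rule. The free algebra is
    given by its words [wd] and by extension by linearity [ext]. *)
Section Diamond.
Variables (K : comNzRingType) (X : choiceType) (J : finType).
Variables (T : algType K) (wd : seq X -> T).
Variable ext : (seq X -> {malg K[seq X]}) -> {linear T -> {malg K[seq X]}}.
Hypothesis wd_cat : forall a b, wd (a ++ b) = wd a * wd b.
Hypothesis ext_wd : forall f w, ext f (wd w) = f w.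
Variables (lead1 lead2 : J -> X) (tail : J -> T).
Variable mu : seq X -> nat.

Definition lead j : seq X := [:: lead1 j; lead2 j].
Definition reln j : T := wd (lead j) - tail j.

Definition irreducible x y := [forall j, lead j != [:: x; y]].
Definition normal w := sorted irreducible w.

(** Elements of the ideal whose cofactors keep the leading word below a bound:
    these are what an induction on leading words controls. *)
Definition low_rel N (f : T) :=
  exists a j b, (mu (a ++ lead j ++ b) < N)%N /\ f = wd a * reln j * wd b.

Hypothesis mu_cat : forall a b v w,
  (mu v < mu w)%N -> (mu (a ++ v ++ b) < mu (a ++ w ++ b))%N.
Hypothesis tail_low : forall j, exists s : seq (K * seq X),
  (forall t, t \in s -> (mu t.2 < mu (lead j))%N) /\
  tail j = \sum_(t <- s) t.1 *: wd t.2.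
Hypothesis same_lead : forall j j', lead j = lead j' ->
  reln j - reln j' \in lin_span (low_rel (mu (lead j))).
Hypothesis overlap : forall j j', lead2 j = lead1 j' ->
  reln j * wd [:: lead2 j'] - wd [:: lead1 j] * reln j'
  \in lin_span (low_rel (mu [:: lead1 j, lead2 j & [:: lead2 j']])).

Lemma low_rel_cat a b v f : f \in lin_span (low_rel (mu v)) ->
  wd a * f * wd b \in lin_span (low_rel (mu (a ++ v ++ b))).
Proof.
move=> /asboolP[s sS ->]; rewrite mulr_sumr mulr_suml big_seq.
apply: rpred_sum => t /sS[a' [j [b' [lt ->]]]].
rewrite -scalerAr -scalerAl; apply/rpredZ/lin_span_gen.
exists (a ++ a'), j, (b' ++ b); split; last by rewrite !wd_cat !mulrA.
by have := mu_cat a b lt; rewrite -!catA.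
Qed.

Fixpoint first_redex (w : seq X) : option (seq X * J * seq X) :=
  if w is x :: w' then
    if w' is y :: b then
      if [pick j | lead j == [:: x; y]] is Some j then Some ([::], j, b)
      else omap (fun t => (x :: t.1.1, t.1.2, t.2)) (first_redex w')
    else None
  else None.

Lemma first_redex_cons x y b : first_redex [:: x, y & b] =
  if [pick j | lead j == [:: x; y]] is Some j then Some ([::], j, b)
  else omap (fun t => (x :: t.1.1, t.1.2, t.2)) (first_redex (y :: b)).
Proof. by []. Qed.

Lemma first_redex_normal w : (first_redex w == None) = normal w.
Proof.
elim: w => // x [|y b] //= IH; rewrite /irreducible.
case: pickP => [j e|e] /=.
  by symmetry; apply/negbTE; rewrite negb_and; apply/orP; left;
     apply/forallPn; exists j; rewrite negbK.
have -> : [forall j, lead j != [:: x; y]] by apply/forallP => j; rewrite e.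
by rewrite /= -[RHS]IH /=; case: (match b with [::] => _ | _ => _ end).
Qed.

Lemma first_redexE w a j b :
  first_redex w = Some (a, j, b) -> w = a ++ lead j ++ b.
Proof.
elim: w a j b => // x [|y c] //= IH a j b.
case: pickP => [j0 /eqP[<- <-]|_] /=; first by case=> <- <- <-.
case E: (match c with [::] => _ | _ => _ end) => [[[a' j'] b']|] //=.
by case=> <- <- <-; rewrite (IH _ _ _ E).
Qed.

Lemma first_redex_first a j b : exists a0 j0 b0,
  first_redex (a ++ lead j ++ b) = Some (a0, j0, b0) /\
  exists d, a = a0 ++ d.
Proof.
elim: a => [|x a [a0 [j0 [b0 [e [d ad]]]]]].
  rewrite cat0s [lead j ++ b]/= first_redex_cons.
  case: pickP => [j0 _|/(_ j)]; last by rewrite /lead eqxx.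
  by exists [::], j0, b; split=> //; exists [::].
rewrite cat_cons; case E: (a ++ _) e => [|y c] // e.
rewrite first_redex_cons; case: pickP => [j1 _|_].
  by exists [::], j1, c; split=> //; exists (x :: a).
exists (x :: a0), j0, b0; rewrite e; split=> //; exists d.
by rewrite ad.
Qed.

Fixpoint reduce_fuel k (w : seq X) : {malg K[seq X]} :=
  if k is k'.+1 then
    if first_redex w is Some (a, j, b) then
      ext (reduce_fuel k') (wd a * tail j * wd b)
    else << w >>
  else 0.

Definition reduce_word w := reduce_fuel (mu w).+1 w.
Definition reduce : {linear T -> {malg K[seq X]}} := ext reduce_word.

Lemma reduce_wd w : reduce (wd w) = reduce_word w.
Proof. exact: ext_wd. Qed.

Lemma tail_ctx a j b : exists s : seq (K * seq X),
  (forall t, t \in s -> (mu t.2 < mu (a ++ lead j ++ b))%N) /\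
  wd a * tail j * wd b = \sum_(t <- s) t.1 *: wd t.2.
Proof.
have [s [lt ->]] := tail_low j.
exists [seq (t.1, a ++ t.2 ++ b) | t <- s]; split.
  by move=> _ /mapP[t /lt + ->] /=; apply: mu_cat.
rewrite big_map mulr_sumr mulr_suml; apply: eq_bigr => t _ /=.
by rewrite !wd_cat -scalerAr -scalerAl mulrA.
Qed.

Lemma reduce_fuelE k w : (mu w < k)%N -> reduce_fuel k w = reduce_word w.
Proof.
have [N] := ubnP (mu w); elim: N k w => // N IH [|k] w //= wN wk.
rewrite /reduce_word /=; case e: (first_redex w) => [[[a j] b]|] //.
have [s [lt ->]] := tail_ctx a j b.
rewrite !linear_sum !big_seq; apply: eq_bigr => t ts; rewrite !linearZ /=.
have {}lt : (mu t.2 < mu w)%N by rewrite (first_redexE e) lt.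
by rewrite !ext_wd !IH // (leq_trans lt).
Qed.

Lemma reduce_redex w a j b : first_redex w = Some (a, j, b) ->
  reduce (wd w) = reduce (wd a * tail j * wd b).
Proof.
move=> e; rewrite reduce_wd /reduce_word /= e.
have [s [lt ->]] := tail_ctx a j b.
rewrite !linear_sum !big_seq; apply: eq_bigr => t ts; rewrite !linearZ /=.
by rewrite ext_wd reduce_wd reduce_fuelE // (first_redexE e) lt.
Qed.

Lemma reduce_normal w : normal w -> reduce (wd w) = << w >>.
Proof.
by rewrite -first_redex_normal reduce_wd /reduce_word /= => /eqP->.
Qed.

Lemma reduce_ctx a j b : reduce (wd a * reln j * wd b) =
  reduce (wd (a ++ lead j ++ b)) - reduce (wd a * tail j * wd b).
Proof. by rewrite -linearB /reln mulrBr mulrBl !wd_cat mulrA. Qed.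

(** Two occurrences of leading words in one word are compared through the first
    redex: they coincide, overlap in a letter or are disjoint, and in each case
    the two reductions differ by relations with smaller leading words. *)
Lemma reduce_rel a j b : reduce (wd a * reln j * wd b) = 0.
Proof.
have [N] := ubnP (mu (a ++ lead j ++ b)); elim: N a j b => // N IH a j b.
rewrite ltnS => wN; pose w := a ++ lead j ++ b.
have {}IH f : f \in lin_span (low_rel (mu w)) -> reduce f = 0.
  move=> /asboolP[s sS ->]; rewrite linear_sum big_seq big1 // => t /sS.
  move=> [a' [j' [b' [lt ->]]]]; rewrite linearZ /= IH ?scaler0 //.
  exact: leq_trans lt wN.
have [a0 [j0 [b0 [e [d ad]]]]] := first_redex_first a j b.
have r0 : reduce (wd a0 * reln j0 * wd b0) = 0.
  by rewrite reduce_ctx -(first_redexE e) (reduce_redex e) subrr.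
rewrite -[LHS]subr0 -[X in _ - X]r0 -linearB; apply: IH.
have {e} := first_redexE e; rewrite {}/w {r0}; subst a => {wN}.
rewrite -!catA => /eqP; rewrite eqseq_cat // eqxx /= => /eqP.
case: d => [|x [|y c]] /=.
- move=> [e1 e2 <-]; rewrite cats0 -mulrBl -mulrBr.
  apply: (low_rel_cat a0 b (v := lead j)); apply: same_lead.
  by rewrite /lead e1 e2.
- move=> [-> e1 <-].
  have -> : wd (a0 ++ [:: lead1 j0]) * reln j * wd b -
      wd a0 * reln j0 * wd (lead2 j :: b) =
    wd a0 * (- (reln j0 * wd [:: lead2 j] - wd [:: lead1 j0] * reln j)) * wd b.
    rewrite wd_cat -(cat1s _ b) wd_cat; move: (reln j) (reln j0) => r r0.
    by rewrite opprB mulrBr mulrBl !mulrA.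
  have := low_rel_cat a0 b (v := [:: lead1 j0, lead2 j0 & [:: lead2 j]]).
  by rewrite /= e1; apply; rewrite rpredN; apply: overlap.
move=> [-> -> <-].
set f := (X in X \in _); set N' := mu _.
rewrite -[N']/(mu (a0 ++ lead j0 ++ c ++ lead j ++ b)) {N'}.
rewrite -[f]/(wd (a0 ++ lead j0 ++ c) * reln j * wd b -
  wd a0 * reln j0 * wd (c ++ lead j ++ b)) {f}.
have -> : wd (a0 ++ lead j0 ++ c) * reln j * wd b -
    wd a0 * reln j0 * wd (c ++ lead j ++ b) =
  wd a0 * tail j0 * wd c * reln j * wd b - wd a0 * reln j0 * (wd c * tail j * wd b).
  rewrite !wd_cat.
  have -> : wd (lead j0) = reln j0 + tail j0 by rewrite subrK.
  have -> : wd (lead j) = reln j + tail j by rewrite subrK.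
  move: (reln j) (reln j0) (tail j) (tail j0) => r r0 t t0.
  rewrite !(mulrDr, mulrDl) !mulrA [X in X - _]addrC opprD addrA.
  by rewrite addrK.
rewrite rpredB //.
  have [s [lt ->]] := tail_ctx a0 j0 c.
  rewrite !mulr_suml big_seq; apply: rpred_sum => t /lt {}lt.
  rewrite -!scalerAl; apply/rpredZ/lin_span_gen; exists t.2, j, b; split=> //.
  by have := mu_cat [::] (lead j ++ b) lt; rewrite /= -!catA.
have [s [lt ->]] := tail_ctx c j b.
rewrite !mulr_sumr big_seq; apply: rpred_sum => t /lt {}lt.
rewrite -!scalerAr; apply/rpredZ/lin_span_gen; exists a0, j0, t.2; split=> //.
by have := mu_cat (a0 ++ lead j0) [::] lt; rewrite !cats0 -!catA.
Qed.

(** Reduction replaces a word by smaller ones, so a word that is not smaller than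
    [v] can only come from [v] itself. *)
Lemma reduce_coef v t : (mu v <= mu t)%N ->
  (reduce (wd v))@_t = ((t == v) && normal v)%:R.
Proof.
have [N] := ubnP (mu v); elim: N v => // N IH v; rewrite ltnS => vN vt.
have [vn|] := boolP (normal v).
  by rewrite reduce_normal // mcoeffU andbT eq_sym.
rewrite -first_redex_normal andbF.
case e: (first_redex v) => [[[a j] b]|] // _; rewrite (reduce_redex e).
have [s [lt ->]] := tail_ctx a j b.
rewrite !linear_sum /= raddf_sum big_seq big1 //= => u /lt {}lt.
rewrite -(first_redexE e) in lt.
rewrite linearZ /= mcoeffZ IH ?(leq_trans lt) //; last exact: leq_trans (ltnW lt) vt.
by case: eqP => [tu|_]; rewrite ?mulr0 //; rewrite tu leqNgt lt in vt.
Qed.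

(** The value of a map that kills the relations is not changed by reduction: a
    word and its reduction have the same class in the quotient. *)
Lemma reduce_mod (U : lmodType K) (h : {linear T -> U}) :
  (forall a j b, h (wd a * reln j * wd b) = 0) ->
  forall v, malg_lift (h \o wd) (reduce (wd v)) = h (wd v).
Proof.
move=> h0 v; have [N] := ubnP (mu v); elim: N v => // N IH v.
rewrite ltnS => vN.
case e: (first_redex v) => [[[a j] b]|]; last first.
  by rewrite reduce_normal ?malg_liftU // -first_redex_normal e.
rewrite (reduce_redex e); have := h0 a j b.
rewrite /reln mulrBr mulrBl linearB /= => /eqP; rewrite subr_eq0.
rewrite -!wd_cat -catA -(first_redexE e) => /eqP->.
have [s [lt ->]] := tail_ctx a j b.
rewrite !linear_sum /= big_seq [RHS]big_seq; apply: eq_bigr => u /lt {}lt.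
rewrite !linearZ /= IH //; apply: leq_trans vN.
by rewrite (first_redexE e).
Qed.

End Diamond.

(** * The rewriting system of a pair of bilinear forms *)

Section Isometries.
Variables (K : fieldType) (m n : nat) (A : algType K).
Variables (E : 'M[K]_m) (G : 'M[K]_n) (u : 'M[A]_(m, n)).

Local Notation scal := (scal_mx A).

(** The defect of u G u^T = E^-1. The relation u^T E u = G^-1 is the same one
    for the transpose of u, with the two forms exchanged. *)
Definition defect : 'M[A]_m := u *m scal G *m u^T - scal (invmx E).

Lemma mulmx_scal_entry (v : 'M[A]_(m, n)) j k :
  (v *m scal G) j k = \sum_a G a k *: v j a.
Proof.
by rewrite mxE; apply: eq_bigr => a _; rewrite mxE -scalerAr mulr1.
Qed.

Lemma defectE i j :
  defect i j = \sum_a \sum_b G a b *: (u i a * u j b) - (invmx E i j)%:A.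
Proof.
rewrite !mxE exchange_big; congr (_ - _); apply: eq_bigr => b _.
rewrite mulmx_scal_entry mulr_suml; apply: eq_bigr => a _.
by rewrite scalerAl [_^T _ _]mxE.
Qed.

End Isometries.

Section OverlapIdentities.
Variables (K : fieldType) (m n : nat) (A : algType K).
Variables (E : 'M[K]_m) (G : 'M[K]_n) (u : 'M[A]_(m, n)).
Hypotheses (E_unit : E \in unitmx) (G_unit : G \in unitmx).

Local Notation scal := (scal_mx A).

Lemma scal_mxV k (M : 'M[K]_k) : M \in unitmx ->
  scal M *m scal (invmx M) = 1%:M /\ scal (invmx M) *m scal M = 1%:M.
Proof.
by move=> Mu; rewrite /scal_mx -!map_mxM mulmxV // mulVmx // !map_mx1.
Qed.

(** Both sides are u G u^T E u - u: this resolves the overlap of a relation of the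
    first kind with one of the second kind. *)
Lemma defect_overlap i k :
  \sum_c \sum_d E c d *: (defect E G u i c * u d k) =
  \sum_a \sum_b G a b *: (u i a * defect G E u^T b k).
Proof.
have [E1 E2] := scal_mxV E_unit; have [G1 G2] := scal_mxV G_unit.
have /matrixP/(_ i k) : defect E G u *m scal E *m u =
    u *m scal G *m defect G E u^T.
  rewrite /defect trmxK !(mulmxBl, mulmxBr) !mulmxA.
  by rewrite E2 -[X in _ = _ - X]mulmxA G1 mulmx1 mul1mx.
rewrite [LHS]mxE [RHS]mxE => e.
transitivity (\sum_d (defect E G u *m scal E) i d * u d k).
  rewrite exchange_big; apply: eq_bigr => d _.
  rewrite mulmx_scal_entry mulr_suml; apply: eq_bigr => c _.
  by rewrite scalerAl.
rewrite {}e exchange_big; apply: eq_bigr => b _.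
rewrite mulmx_scal_entry mulr_suml; apply: eq_bigr => a _.
by rewrite scalerAl.
Qed.

Hypothesis tr_eq : \tr (E^T *m invmx E) = \tr (G^T *m invmx G).

(** Contracted with E and with G, the two relations have the same quadratic part,
    the sum of the E c d G a b u c a u d b; the constants are the two traces. *)
Lemma defect_trace :
  \sum_c \sum_d E c d *: defect E G u c d =
  \sum_a \sum_b G a b *: defect G E u^T a b.
Proof.
have side k l (M : 'M[K]_k) (N : 'M[K]_l) (v : 'M[A]_(k, l)) :
    \sum_c \sum_d M c d *: defect M N v c d =
    \sum_c \sum_d \sum_a \sum_b (N a b * M c d) *: (v c a * v d b) -
    (\tr (M^T *m invmx M))%:A.
  have -> : \tr (M^T *m invmx M) = \sum_c \sum_d M c d * invmx M c d.
    rewrite /mxtrace exchange_big; apply: eq_bigr => d _; rewrite mxE.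
    by apply: eq_bigr => c _; rewrite mxE.
  rewrite scaler_suml -sumrB; apply: eq_bigr => c _.
  rewrite scaler_suml -sumrB; apply: eq_bigr => d _.
  rewrite defectE scalerBr scalerA scaler_sumr; congr (_ - _).
  apply: eq_bigr => a _; rewrite scaler_sumr; apply: eq_bigr => b _.
  by rewrite scalerA mulrC.
rewrite !side tr_eq; congr (_ - _).
under eq_bigr => c _ do rewrite exchange_big.
under eq_bigr => c _ do under eq_bigr => a _ do rewrite exchange_big.
rewrite exchange_big; apply: eq_bigr => a _.
rewrite exchange_big; apply: eq_bigr => b _.
by apply: eq_bigr => c _; apply: eq_bigr => d _; rewrite !mxE mulrC.
Qed.

End OverlapIdentities.

(** Isolating the leading entry of a form whose row [p] is the unit vector. *)
Lemma form_sum_split (K : comNzRingType) (V : lmodType K) k (E : 'M[K]_k) p q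
    (f : 'I_k -> 'I_k -> V) : (forall j, E p j = (j == q)%:R) ->
  \sum_c \sum_d E c d *: f c d =
  f p q + \sum_(c | c != p) \sum_d E c d *: f c d.
Proof.
move=> Ep; rewrite (bigD1 p) //=; congr (_ + _).
rewrite (bigD1 q) //= big1 => [|d /negPf dq]; first by rewrite Ep eqxx scale1r addr0.
by rewrite Ep dq scale0r.
Qed.

Section WordMeasure.
Variables (X : Type) (wt : X -> nat).
Hypothesis wt_le : forall x, (wt x <= 2)%N.

(** The value in base 4 of the word whose letters have digits 1 to 3: words are
    compared by length, then lexicographically by weight. *)
Definition word_mu (w : seq X) : nat := foldl (fun k x => k * 4 + (wt x).+1)%N 0%N w.

Lemma word_mu_rcons w x : word_mu (rcons w x) = (word_mu w * 4 + (wt x).+1)%N.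
Proof. by rewrite /word_mu -cats1 foldl_cat. Qed.

Lemma word_mu_catE a w : word_mu (a ++ w) = (word_mu a * 4 ^ size w + word_mu w)%N.
Proof.
elim/last_ind: w => [|w x IH]; first by rewrite cats0 muln1 addn0.
by rewrite -rcons_cat !word_mu_rcons IH size_rcons expnSr mulnDl mulnA addnA.
Qed.

Lemma word_mu_bounds w :
  (word_mu w < 4 ^ size w)%N /\ (4 ^ size w <= 3 * word_mu w + 1)%N.
Proof.
elim/last_ind: w => // w x [IH1 IH2].
rewrite word_mu_rcons size_rcons expnSr; have := wt_le x.
by move: (4 ^ _)%N IH1 IH2 => N; lia.
Qed.

Lemma word_mu_size v w : (word_mu v < word_mu w)%N -> (size v <= size w)%N.
Proof.
move=> vw; rewrite leqNgt; apply/negP => lt.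
have [_ h1] := word_mu_bounds v; have [h2 _] := word_mu_bounds w.
have : (4 ^ (size w).+1 <= 4 ^ size v)%N by rewrite leq_exp2l.
by rewrite expnSr; move: (4 ^ size w)%N (4 ^ size v)%N h1 h2 => a b; lia.
Qed.

Lemma word_mu_cat a b v w : (word_mu v < word_mu w)%N ->
  (word_mu (a ++ v ++ b) < word_mu (a ++ w ++ b))%N.
Proof.
move=> vw; rewrite !catA word_mu_catE [X in (_ < X)%N]word_mu_catE ltn_add2r.
rewrite ltn_pmul2r ?expn_gt0 // !word_mu_catE -addnS leq_add //.
by rewrite leq_mul // leq_exp2l // word_mu_size.
Qed.

End WordMeasure.

Lemma addr_eq_sub (V : zmodType) (x y s t : V) : x + s = y + t -> x - y = t - s.
Proof.
by move=> e; apply/eqP; rewrite subr_eq addrAC eq_sym subr_eq addrC e addrC.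
Qed.

Section Rewriting.
Variables (K : fieldType) (m n : nat).
Variables (E : 'M[K]_m) (G : 'M[K]_n) (p q : 'I_m) (p' q' : 'I_n).
Hypotheses (E_unit : E \in unitmx) (G_unit : G \in unitmx).
Hypotheses (Ep : forall j, E p j = (j == q)%:R).
Hypotheses (Gp : forall j, G p' j = (j == q')%:R).
Hypotheses (pq : p != q) (pq' : p' != q').
Hypothesis tr_eq : \tr (E^T *m invmx E) = \tr (G^T *m invmx G).

Definition letter : Type := ('I_m * 'I_n)%type.
HB.instance Definition _ := Finite.on letter.

Variables (T : algType K) (wd : seq letter -> T).
Variable ext :
  (seq letter -> {malg K[seq letter]}) -> {linear T -> {malg K[seq letter]}}.
Hypothesis wd_cat : forall a b, wd (a ++ b) = wd a * wd b.
Hypothesis wd_nil : wd [::] = 1.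
Hypothesis ext_wd : forall f w, ext f (wd w) = f w.

Definition letter_wt (x : letter) : nat := (x.1 == p) + (x.2 == p').
Definition mu := word_mu letter_wt.

Lemma letter_wt_le x : (letter_wt x <= 2)%N.
Proof. by rewrite /letter_wt; do 2!case: eqP. Qed.

Definition letter_mx : 'M[T]_(m, n) := \matrix_(i, j) wd [:: (i, j)].
Local Notation U := letter_mx.

(** The rule [inl (i, j)] solves the entry (i, j) of u G u^T = E^-1 for its term
    in G p' q', and [inr (i, j)] that of u^T E u = G^-1 for its term in E p q. *)
Definition rule : Type := ('I_m * 'I_m + 'I_n * 'I_n)%type.
HB.instance Definition _ := Finite.on rule.

Definition rule_lead1 (j : rule) : letter :=
  match j with inl ij => (ij.1, p') | inr ij => (p, ij.1) end.
Definition rule_lead2 (j : rule) : letter :=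
  match j with inl ij => (ij.2, q') | inr ij => (q, ij.2) end.
Definition rule_rel (j : rule) : T :=
  match j with inl ij => defect E G U ij.1 ij.2
             | inr ij => defect G E U^T ij.1 ij.2 end.
Definition rule_tail j : T :=
  wd [:: rule_lead1 j; rule_lead2 j] - rule_rel j.

Local Notation lead := (lead rule_lead1 rule_lead2).
Local Notation rrel := (reln wd rule_lead1 rule_lead2 rule_tail).
Local Notation low N :=
  (lin_span (low_rel wd rule_lead1 rule_lead2 rule_tail mu N)).

Lemma rule_relE j : rrel j = rule_rel j.
Proof. by rewrite /reln /rule_tail opprB addrC subrK. Qed.

Lemma wd2 x y : wd [:: x; y] = wd [:: x] * wd [:: y].
Proof. exact: (wd_cat [:: x] [:: y]). Qed.

Lemma mu2_lt x y x' y' : (letter_wt x < letter_wt x')%N ->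
  (mu [:: x; y] < mu [:: x'; y'])%N.
Proof.
rewrite /mu /word_mu /=; have := letter_wt_le y; have := letter_wt_le y'.
by move: (letter_wt x) (letter_wt x') (letter_wt y) (letter_wt y'); lia.
Qed.

(** Row [r] of M is a unit vector, so only one term of the form starts with [x r];
    the others start with a lighter letter and are smaller. *)
Lemma form_tail_low k (M : 'M[K]_k) r s (x y : 'I_k -> letter) (c : K) :
  (forall j, M r j = (j == s)%:R) ->
  (forall a, a != r -> (letter_wt (x a) < letter_wt (x r))%N) ->
  exists t : seq (K * seq letter),
    (forall t', t' \in t -> (mu t'.2 < mu [:: x r; y s])%N) /\
    wd [:: x r; y s] - (\sum_a \sum_b M a b *: (wd [:: x a] * wd [:: y b]) - c%:A)
      = \sum_(t' <- t) t'.1 *: wd t'.2.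
Proof.
move=> Mr lt.
exists ((c, [::]) :: [seq (- M a b, [:: x a; y b]) | a <- enum (predC1 r),
   b <- enum 'I_k]); split.
  move=> t'; rewrite inE => /orP[/eqP->|/allpairsP[[a b] [+ _ ->]]] /=.
    by rewrite /mu /word_mu /= addn_gt0 orbT.
  by rewrite mem_enum => /lt; apply: mu2_lt.
rewrite (form_sum_split _ Mr) big_cons big_allpairs_dep /= wd_nil.
rewrite wd2 opprB addrCA opprD addNKr; congr (_ + _).
rewrite -sumrN [RHS]big_enum; apply: eq_bigr => a _; rewrite big_enum -sumrN.
by apply: eq_bigr => b _; rewrite scaleNr wd2.
Qed.

Lemma rule_tail_low j : exists s : seq (K * seq letter),
  (forall t, t \in s -> (mu t.2 < mu (lead j))%N) /\
  rule_tail j = \sum_(t <- s) t.1 *: wd t.2.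
Proof.
case: j => -[i j]; rewrite /rule_tail /rule_rel /= defectE.
  under eq_bigr => a _ do under eq_bigr => b _ do rewrite !mxE.
  apply: (form_tail_low (x := fun a => (i, a))
    (fun b => (j, b)) _ Gp) => a /negPf ap.
  by rewrite /letter_wt /= ap eqxx addn0 addn1.
under eq_bigr => a _ do under eq_bigr => b _ do rewrite !mxE.
apply: (form_tail_low (x := fun a => (a, i))
  (fun b => (b, j)) _ Ep) => a /negPf ap.
by rewrite /letter_wt /= ap eqxx.
Qed.

Lemma low_rule N j : (mu (lead j) < N)%N -> rule_rel j \in low N.
Proof.
move=> lt; apply: lin_span_gen; exists [::], j, [::]; rewrite cats0; split=> //.
by rewrite rule_relE wd_nil mulr1 mul1r.
Qed.

Lemma low_rule_l N j x : (mu (x :: lead j) < N)%N ->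
  wd [:: x] * rule_rel j \in low N.
Proof.
move=> lt; apply: lin_span_gen; exists [:: x], j, [::]; rewrite cats0; split=> //.
by rewrite rule_relE wd_nil mulr1.
Qed.

Lemma low_rule_r N j x : (mu (lead j ++ [:: x]) < N)%N ->
  rule_rel j * wd [:: x] \in low N.
Proof.
move=> lt; apply: lin_span_gen; exists [::], j, [:: x]; split=> //.
by rewrite rule_relE wd_nil mul1r.
Qed.

Lemma low_form N k (M : 'M[K]_k) r (f : 'I_k -> 'I_k -> T) :
  (forall a b, a != r -> f a b \in low N) ->
  \sum_(a | a != r) \sum_b M a b *: f a b \in low N.
Proof.
move=> fN; apply: rpred_sum => a ar; apply: rpred_sum => b _.
by apply: rpredZ; apply: fN.
Qed.

(** The only word with two rules is (p, p') (q, q'); the trace identity compares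
    them. *)
Lemma rule_same_lead j j' : lead j = lead j' ->
  rrel j - rrel j' \in low (mu (lead j)).
Proof.
have tr := defect_trace letter_mx tr_eq.
rewrite (form_sum_split _ Ep) (form_sum_split _ Gp) in tr.
have {}tr : rule_rel (inl (p, q)) - rule_rel (inr (p', q')) \in
    low (mu [:: (p, p'); (q, q')]).
  rewrite [X in X \in _](addr_eq_sub tr).
  rewrite rpredB //; apply: low_form => a b /negPf ar.
    by apply: (@low_rule _ (inr (a, b))); apply: mu2_lt;
       rewrite /letter_wt /= !eqxx ar.
  by apply: (@low_rule _ (inl (a, b))); apply: mu2_lt;
     rewrite /letter_wt /= !eqxx ar.
rewrite !rule_relE; case: j j' => -[i j] [] [k l] [] /=.
- by move=> -> ->; rewrite subrr rpred0.
- by move=> -> <- -> <-.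
- by move=> <- -> <- ->; rewrite -rpredN opprB.
by move=> -> ->; rewrite subrr rpred0.
Qed.

(** As p <> q and p' <> q', two rules of the same kind do not overlap; rules of
    different kinds do so at the letter (p, q') or (q, p'), where
    [defect_overlap] applies. *)
Lemma rule_overlap j j' : rule_lead2 j = rule_lead1 j' ->
  rrel j * wd [:: rule_lead2 j'] - wd [:: rule_lead1 j] * rrel j'
  \in low (mu [:: rule_lead1 j, rule_lead2 j & [:: rule_lead2 j']]).
Proof.
have mu3 x y z x' y' z' : (mu [:: x; y] < mu [:: x'; y'])%N ->
    (mu [:: x; y; z] < mu [:: x'; y'; z'])%N.
  rewrite /mu /word_mu /=; have := letter_wt_le z; have := letter_wt_le z'.
  by move: (letter_wt x) (letter_wt x') (letter_wt y) (letter_wt y')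
    (letter_wt z) (letter_wt z'); lia.
have mu2' x y y' : (letter_wt y < letter_wt y')%N ->
    (mu [:: x; y] < mu [:: x; y'])%N.
  by rewrite /mu /word_mu /= ltn_add2l.
rewrite !rule_relE; case: j j' => -[i j] [] [k l] [] /= e1 e2.
- by move: pq'; rewrite e2 eqxx.
- subst j k.
  have := defect_overlap letter_mx E_unit G_unit i l.
  rewrite (form_sum_split _ Ep) (form_sum_split _ Gp).
  rewrite [letter_mx q l]mxE [letter_mx i p']mxE => /addr_eq_sub->.
  rewrite rpredB //; apply: low_form => a b /negPf ar; rewrite [letter_mx _ _]mxE.
    apply: (@low_rule_l _ (inr (b, l))); apply: mu3; apply: mu2_lt.
    by rewrite /letter_wt /= !eqxx ar addn0 addn1.
  apply: (@low_rule_r _ (inl (i, a))); apply: mu3; apply: mu2'.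
  by rewrite /letter_wt /= !eqxx ar ltn_add2r.
- subst j k.
    have := defect_overlap letter_mx^T G_unit E_unit i l.
  rewrite trmxK (form_sum_split _ Gp) (form_sum_split _ Ep).
  rewrite ![letter_mx^T _ _]mxE [letter_mx l q']mxE [letter_mx p i]mxE.
  move=> /addr_eq_sub->; rewrite rpredB //; apply: low_form => a b /negPf ar;
    rewrite [letter_mx^T _ _]mxE [letter_mx _ _]mxE.
    apply: (@low_rule_l _ (inl (b, l))); apply: mu3; apply: mu2_lt.
    by rewrite /letter_wt /= !eqxx ar.
  apply: (@low_rule_r _ (inr (i, a))); apply: mu3; apply: mu2'.
  by rewrite /letter_wt /= !eqxx ar ltn_add2l.
by move: pq; rewrite e1 eqxx.
Qed.
End Rewriting.

Section NormalForms.
Variables (K : fieldType) (m n : nat).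
Variables (E : 'M[K]_m) (G : 'M[K]_n) (p q : 'I_m) (p' q' : 'I_n).
Hypotheses (E_unit : E \in unitmx) (G_unit : G \in unitmx).
Hypotheses (Ep : forall j, E p j = (j == q)%:R).
Hypotheses (Gp : forall j, G p' j = (j == q')%:R).
Hypotheses (pq : p != q) (pq' : p' != q').
Hypothesis tr_eq : \tr (E^T *m invmx E) = \tr (G^T *m invmx G).

Local Notation letter := (letter m n).
Local Notation mu := (mu p p').
Local Notation lead1 := (@rule_lead1 m n p p').
Local Notation lead2 := (@rule_lead2 m n q q').

Definition normal_word (w : seq letter) := normal lead1 lead2 w.

Lemma irreducibleE (x y : letter) : irreducible lead1 lead2 x y =
  ~~ [&& x.2 == p' & y.2 == q'] && ~~ [&& x.1 == p & y.1 == q].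
Proof.
apply/forallP/andP => [irr|[h1 h2] [] [i j]].
- split; apply/negP => /andP[/eqP e1 /eqP e2].
    have := irr (inl (x.1, y.1)); rewrite /lead /= -e1 -e2.
    by case: (x) (y) => [? ?] [? ?]; rewrite eqxx.
  have := irr (inr (x.2, y.2)); rewrite /lead /= -e1 -e2.
  by case: (x) (y) => [? ?] [? ?]; rewrite eqxx.
- by apply: contra h1 => /eqP[<- <-] /=; rewrite !eqxx.
by apply: contra h2 => /eqP[<- <-] /=; rewrite !eqxx.
Qed.

Definition word_in (A : algType K) (v : 'M[A]_(m, n)) (w : seq letter) : A :=
  \prod_(x <- w) v x.1 x.2.

(** Normal words form a basis of A, triangularly for [mu]: [nf] writes an element
    in the words of the entries of [v], and the expansion of a word has no other
    term of the same or of a larger measure. *)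
Definition normal_form (A : algType K) (v : 'M[A]_(m, n))
    (nf : {linear A -> {malg K[seq letter]}}) :=
  (forall a, malg_lift (word_in v) (nf a) = a) /\
  (forall w t, (mu w <= mu t)%N ->
     (nf (word_in v w))@_t = ((t == w) && normal_word w)%:R).

(** An algebra with the right presentation has normal forms: [pi] is the
    presentation, and [theta] and [phi] are inverse changes of variables. *)
Section Transfer.
Variables (F T B : algType K) (pi : {lrmorphism F -> B}).
Variables (theta : {lrmorphism F -> T}) (phi : {lrmorphism T -> F}).
Hypotheses (thetaK : cancel theta phi) (phiK : cancel phi theta).
Variable R : F -> Prop.
Hypothesis pi_surj : forall x, exists y, pi y = x.
Hypothesis pi_ker : forall y, pi y = 0 -> y \in gen_ideal R.
Variable wd : seq letter -> T.
Variable ext :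
  (seq letter -> {malg K[seq letter]}) -> {linear T -> {malg K[seq letter]}}.
Hypothesis wd_cat : forall a b, wd (a ++ b) = wd a * wd b.
Hypothesis wd_nil : wd [::] = 1.
Hypothesis wd_span :
  forall f, exists s : seq (K * seq letter), f = \sum_(t <- s) t.1 *: wd t.2.
Hypothesis ext_wd : forall f w, ext f (wd w) = f w.

Local Notation U := (letter_mx wd).
Hypothesis R_defect : forall r, R r -> exists (M1 M2 : 'M[K]_m) (N1 N2 : 'M[K]_n),
  (exists a b, theta r =
     (scal_mx T M1 *m defect E G U *m scal_mx T M2) a b) \/
  (exists a b, theta r =
     (scal_mx T N1 *m defect G E U^T *m scal_mx T N2) a b).
Hypothesis pi_defect : map_mx (pi \o phi) (defect E G U) = 0 /\
  map_mx (pi \o phi) (defect G E U^T) = 0.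

Local Notation tail := (rule_tail E G p q p' q' wd).
Let red := reduce wd ext lead1 lead2 tail mu.

Let red_rel f j g : red (f * rule_rel E G wd j * g) = 0.
Proof.
have [s ->] := wd_span f; have [s' ->] := wd_span g.
rewrite !mulr_suml linear_sum big1 // => t _.
rewrite mulr_sumr linear_sum big1 // => t' _.
rewrite -scalerAr -!scalerAl !linearZ /= -(rule_relE E G p q p' q' wd).
rewrite (@reduce_rel K letter (rule m n) T wd ext wd_cat ext_wd lead1 lead2 tail
  mu) ?scaler0 //.
- by move=> a b v w; apply: word_mu_cat; apply: letter_wt_le.
- exact: rule_tail_low.
- exact: rule_same_lead.
exact: rule_overlap.
Qed.

Let red_mx k (D : 'M[T]_k) (M N : 'M[K]_k) a b :
  (forall f g c d, red (f * D c d * g) = 0) ->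
  forall f g, red (f * (scal_mx T M *m D *m scal_mx T N) a b * g) = 0.
Proof.
move=> D0 f g; rewrite mulmx_scal_entry mulr_sumr mulr_suml linear_sum big1 // => c _.
rewrite mxE scaler_sumr mulr_sumr mulr_suml linear_sum big1 // => d _.
by rewrite mxE -scalerAl mul1r scalerA -scalerAr -scalerAl linearZ /= D0 scaler0.
Qed.

Let red_theta f : f \in gen_ideal R -> red (theta f) = 0.
Proof.
move=> /asboolP[s sR ->]; rewrite linear_sum linear_sum big_seq big1 //= => t.
move=> /sR /R_defect [M1 [M2 [N1 [N2 r]]]].
rewrite !rmorphM /=; case: r => -[a [b ->]]; apply: red_mx => f' g' c d.
  exact: (red_rel _ (inl (c, d))).
exact: (red_rel _ (inr (c, d))).
Qed.

Let pi_surjb x : exists y, pi y == x.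
Proof. by have [y <-] := pi_surj x; exists y. Qed.

Definition transfer_fun (x : B) := red (theta (xchoose (pi_surjb x))).

Let transfer_pi y : transfer_fun (pi y) = red (theta y).
Proof.
apply/eqP; rewrite -subr_eq0 -!linearB; apply/eqP/red_theta/pi_ker.
by rewrite linearB /= (eqP (xchooseP (pi_surjb (pi y)))) subrr.
Qed.

Fact transfer_linear : linear transfer_fun.
Proof.
move=> c x y; have [x' <-] := pi_surj x; have [y' <-] := pi_surj y.
by rewrite -linearP !transfer_pi !linearP.
Qed.

Let word_phi w : word_in (map_mx (pi \o phi) U) w = pi (phi (wd w)).
Proof.
elim: w => [|x w IH]; first by rewrite /word_in big_nil wd_nil !rmorph1.
rewrite /word_in big_cons [X in _ * X]IH (wd_cat [:: x] w) !rmorphM !mxE.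
by case: x.
Qed.

Lemma normal_form_transfer :
  exists nf, normal_form (map_mx (pi \o phi) U) nf.
Proof.
exists (lin_of transfer_linear); split=> [a|w t le] /=; last first.
  rewrite word_phi transfer_pi phiK.
  by rewrite (reduce_coef wd_cat ext_wd) //; [
    move=> a b v w'; apply: word_mu_cat; apply: letter_wt_le
  | exact: rule_tail_low].
have [y <-] := pi_surj a; rewrite transfer_pi -[y]thetaK phiK.
have [s ->] := wd_span (theta y); rewrite !linear_sum; apply: eq_bigr => u _.
rewrite !linearZ /=; congr (_ *: _).
have -> : word_in (map_mx (pi \o phi) U) = (pi \o phi) \o wd.
  by apply: funext => w; apply: word_phi.
apply: (@reduce_mod K letter (rule m n) T wd ext wd_cat ext_wd lead1 lead2 tail
  mu _ _ B ((pi : {linear F -> B}) \o (phi : {linear T -> F}))%FUN).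
- by move=> a' b v w; apply: word_mu_cat; apply: letter_wt_le.
- exact: rule_tail_low.
move=> f j g; rewrite /= (rule_relE E G p q p' q' wd) !rmorphM /=.
have [/matrixP d1 /matrixP d2] := pi_defect.
case: j => -[i j] /=; [have := d1 i j | have := d2 i j];
  by rewrite !mxE /= => ->; rewrite mulr0 mul0r.
Qed.

End Transfer.
End NormalForms.

(** * Adapted bases of a bilinear form *)

(** Take an isotropic vector x as the vector [p] of a basis, all the others but one,
    [q], being orthogonal to x: the row [p] of the form is then a unit vector. *)
Lemma adapted_basis (K : closedFieldType) n (E : 'M[K]_n) :
  (2 <= n)%N -> E \in unitmx ->
  exists (P : 'M[K]_n) (p q : 'I_n), [/\ P \in unitmx, p != q &
    forall j, (P^T *m E *m P) p j = (j == q)%:R].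
Proof.
move=> n2 Eu; pose i0 := Ordinal (ltnW n2); pose i1 := Ordinal n2.
have [x [[r xr] x0]] : exists x : 'rV[K]_n,
    (exists r, x 0 r = 1) /\ x *m E *m x^T = 0.
  have quad (v w : 'rV[K]_n) : v *m E *m w^T = ((v *m E *m w^T) 0 0)%:M.
    exact: mx11_scalar.
  have entry i j : (delta_mx 0 i : 'rV_n) *m E *m (delta_mx 0 j : 'rV_n)^T =
      (E i j)%:M.
    by rewrite quad trmx_delta -rowE -colE !mxE.
  have [E00|E00] := eqVneq (E i0 i0) 0.
    exists (delta_mx 0 i0); split; first by exists i0; rewrite mxE !eqxx.
    by rewrite entry E00; apply/matrixP => a b; rewrite !mxE mul0rn.
  (* t e_0 + e_1 is isotropic when t is a root of this quadratic polynomial *)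
  pose c k := if k is 0%N then - E i1 i1 / E i0 i0
    else - (E i0 i1 + E i1 i0) / E i0 i0.
  have [t /eqP] := @solve_monicpoly K 2 c isT.
  rewrite !big_ord_recl big_ord0 /= mulr1 expr1 addr0 => /eqP t2.
  exists (t *: delta_mx 0 i0 + delta_mx 0 i1); split.
    by exists i1; rewrite !mxE eqxx /= mulr0 add0r.
  rewrite linearD linearZ /= !(mulmxDl, mulmxDr) -!scalemxAl -!scalemxAr.
  rewrite !entry scalerA -expr2 t2.
  apply/matrixP => a b; rewrite !mxE !ord1 !eqxx /=.
  by field.
have [y yE] : exists y, y = x *m E by exists (x *m E).
rewrite -yE in x0.
have [s /andP[sr ys]] : exists s, (s != r) && (y 0 s != 0).
  apply/existsP; apply: contraT; rewrite negb_exists => /forallP y0.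
  have {}y0 i : i != r -> y 0 i = 0.
    by move=> ir; have := y0 i; rewrite ir negbK => /eqP.
  have yr : y 0 r = 0.
    move/matrixP: x0 => /(_ 0 0); rewrite !mxE (bigD1 r) //= big1 => [|i ir].
      by rewrite mxE xr mulr1 addr0.
    by rewrite y0 // mul0r.
  have /(congr1 (fun v : 'rV_n => (v *m invmx E) 0 r)) : y = 0.
    by apply/rowP => i; rewrite [RHS]mxE; have [->|/y0] := eqVneq i r.
  by rewrite /= yE mulmxK // xr mul0mx mxE => /eqP; rewrite oner_eq0.
(* the columns of P are x at r, e_s / y s at s, and e_j - (y j / y s) e_s, which
   y = x E annihilates, elsewhere *)
pose P := \matrix_(i, j) if j == r then x 0 i
  else if j == s then (i == s)%:R / y 0 s
  else (i == j)%:R - (i == s)%:R * (y 0 j / y 0 s).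
exists P, r, s; split; last 2 first.
- by rewrite eq_sym.
- move=> j; have -> : (P^T *m E *m P) r j = \sum_k y 0 k * P k j.
    rewrite mxE; apply: eq_bigr => k _; congr (_ * _).
    by rewrite yE !mxE; apply: eq_bigr => l _; rewrite !mxE eqxx.
  under eq_bigr => k _ do rewrite mxE.
  have [->|jr] := eqVneq j r.
    rewrite eq_sym (negPf sr); move/matrixP: x0 => /(_ 0 0).
    rewrite mxE [RHS]mxE => e; apply: etrans e; apply: eq_bigr => k _.
    by rewrite [x^T _ _]mxE.
  have delta k (f : 'I_n -> K) : \sum_i f i * (i == k)%:R = f k.
    rewrite (bigD1 k) //= eqxx mulr1 big1 ?addr0 // => i /negPf->.
    by rewrite mulr0.
  have [_|js] := eqVneq j s.
    by under eq_bigr => k _ do rewrite mulrA; rewrite -mulr_suml delta divff.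
  transitivity (\sum_k (y 0 k * (k == j)%:R -
      y 0 k * (k == s)%:R * (y 0 j / y 0 s))).
    by apply: eq_bigr => k _; rewrite mulrBr -mulrA.
  by rewrite sumrB -mulr_suml !delta mulrCA divff // mulr1 subrr.
rewrite -unitmx_tr -row_free_unit; apply/inj_row_free => v /matrixP vP.
have {}vP i : \sum_j v 0 j * P i j = 0.
  have := vP 0 i; move=> e; rewrite mxE [RHS]mxE in e.
  by apply: etrans e; apply: eq_bigr => j _; rewrite [P^T _ _]mxE.
have vr : v 0 r = 0.
  have := vP r; rewrite (bigD1 r) //= mxE eqxx xr mulr1 big1 ?addr0 // => j jr.
  rewrite mxE (negPf jr); rewrite eq_sym in sr; rewrite (negPf sr) !mul0r.
  by case: eqP => _; rewrite ?mulr0 // eq_sym (negPf jr) subrr mulr0.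
have vi i : i != s -> v 0 i = 0.
  move=> is_; have [-> //|ir] := eqVneq i r.
  have := vP i; rewrite (bigD1 i) //= mxE (negPf ir) (negPf is_) eqxx mul0r.
  rewrite subr0 mulr1 big1 ?addr0 // => j ji; rewrite mxE.
  have [->|jr] := eqVneq j r; first by rewrite vr mul0r.
  rewrite (negPf is_) !mul0r; case: eqP => _; rewrite ?mulr0 //.
  by rewrite eq_sym (negPf ji) subrr mulr0.
apply/rowP => i; rewrite [RHS]mxE; have [->|/vi //] := eqVneq i s.
have := vP s; rewrite (bigD1 s) //= big1 => [|j /vi->]; last by rewrite mul0r.
rewrite addr0 mxE (negPf sr) eqxx => /eqP; rewrite mulf_eq0 mul1r invr_eq0.
by rewrite (negPf ys) orbF => /eqP.
Qed.

Section BaseChange.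
Variables (K : fieldType) (n : nat) (E0 P Q : 'M[K]_n).
Hypotheses (E0u : E0 \in unitmx) (Pu : P \in unitmx) (Qu : Q \in unitmx).

Definition left_form : 'M[K]_n := P^T *m E0 *m P.
Definition right_form : 'M[K]_n := invmx Q *m invmx E0 *m (invmx Q)^T.
Local Notation E := left_form.
Local Notation G := right_form.

Lemma left_form_unit : E \in unitmx.
Proof. by rewrite !unitmx_mul unitmx_tr Pu E0u. Qed.

Lemma right_form_unit : G \in unitmx.
Proof. by rewrite !unitmx_mul unitmx_tr !unitmx_inv Qu E0u. Qed.

Lemma invmxM (A B : 'M[K]_n) : A \in unitmx -> B \in unitmx ->
  invmx (A *m B) = invmx B *m invmx A.
Proof.
move=> Au Bu; have ABu : A *m B \in unitmx by rewrite unitmx_mul Au.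
apply: (can_inj (mulKmx ABu)); rewrite mulmxV // mulmxA mulmxK // mulmxV //.
Qed.

Lemma left_form_inv : invmx E = invmx P *m invmx E0 *m (invmx P)^T.
Proof.
rewrite /left_form !invmxM ?unitmx_mul ?unitmx_tr ?Pu ?E0u //.
by rewrite trmx_inv mulmxA.
Qed.

Lemma right_form_inv : invmx G = Q^T *m E0 *m Q.
Proof.
rewrite /right_form !invmxM ?unitmx_mul ?unitmx_tr ?unitmx_inv ?Qu ?E0u //.
by rewrite trmx_inv !invmxK mulmxA.
Qed.

(** Both matrices are conjugate to E0^T E0^-1, up to transposition. *)
Lemma base_change_trace :
  \tr (E^T *m invmx E) = \tr (G^T *m invmx G).
Proof.
have conj_tr (M N : 'M[K]_n) : M \in unitmx ->
    \tr (M^T *m N *m (invmx M)^T) = \tr N.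
  move=> Mu; rewrite mxtrace_mulC mulmxA -trmx_mul mulmxV // trmx1.
  by rewrite mul1mx.
rewrite left_form_inv right_form_inv /left_form /right_form !trmx_mul !trmxK.
rewrite !mulmxA (mulmxK Pu) -(mulmxA P^T) conj_tr //.
have Q1 : (invmx Q)^T *m Q^T = 1%:M by rewrite -trmx_mul mulmxV // trmx1.
rewrite -(mulmxA _ (invmx Q)^T) Q1 mulmx1 [RHS]mxtrace_mulC !mulmxA mulmxV //.
by rewrite mul1mx -[RHS]mxtrace_tr trmx_mul trmxK.
Qed.

Section Algebra.
Variables (T : algType K) (U : 'M[T]_n).
Local Notation scal := (scal_mx T).

Lemma scal_mxM (A B : 'M[K]_n) : scal (A *m B) = scal A *m scal B.
Proof. exact: map_mxM. Qed.

Lemma trmx_scal_mull (M : 'M[K]_n) (V : 'M[T]_n) :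
  (scal M *m V)^T = V^T *m scal M^T.
Proof.
apply/matrixP => i j; rewrite !mxE; apply: eq_bigr => k _.
by rewrite !mxE mulr_algr mulr_algl.
Qed.

Lemma trmx_scal_mulr (M : 'M[K]_n) (V : 'M[T]_n) :
  (V *m scal M)^T = scal M^T *m V^T.
Proof.
apply/matrixP => i j; rewrite !mxE; apply: eq_bigr => k _.
by rewrite !mxE mulr_algr mulr_algl.
Qed.

Definition base_change : 'M[T]_n := scal P *m U *m scal (invmx Q).
Local Notation V := base_change.

Let PV : scal P *m scal (invmx P) = 1%:M.
Proof. by have [] := scal_mxV T Pu. Qed.
Let EV : scal (invmx E0) *m scal E0 = 1%:M.
Proof. by have [] := scal_mxV T E0u. Qed.
Let PTV : scal (invmx P)^T *m scal P^T = 1%:M.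
Proof. by rewrite -scal_mxM -trmx_mul mulmxV // trmx1 /scal_mx map_mx1. Qed.
Let QTV : scal (invmx Q)^T *m scal Q^T = 1%:M.
Proof. by rewrite -scal_mxM -trmx_mul mulmxV // trmx1 /scal_mx map_mx1. Qed.

Lemma BE_right_base_change :
  BE_right E0 V - 1%:M = scal P *m defect E G U *m scal (P^T *m E0).
Proof.
rewrite /BE_right /base_change /defect left_form_inv trmx_scal_mulr trmx_scal_mull.
rewrite /right_form mulmxBr mulmxBl !scal_mxM !mulmxA; congr (_ - _).
by rewrite PV mul1mx -(mulmxA _ _ (scal P^T)) PTV mulmx1 EV.
Qed.

Lemma BE_left_base_change :
  BE_left E0 V - 1%:M =
  scal (invmx E0 *m (invmx Q)^T) *m defect G E U^T *m scal (invmx Q).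
Proof.
rewrite /BE_left /base_change /defect right_form_inv trmx_scal_mulr trmx_scal_mull.
rewrite trmxK /left_form mulmxBr mulmxBl !scal_mxM !mulmxA; congr (_ - _).
rewrite -(mulmxA _ _ (scal Q^T)) QTV mulmx1 EV mul1mx.
by have [] := scal_mxV T Qu.
Qed.

End Algebra.
End BaseChange.

Section MapBaseChange.
Variables (K : fieldType) (n : nat) (A B : algType K) (f : {lrmorphism A -> B}).

Lemma map_scal_mx (M : 'M[K]_n) : map_mx f (scal_mx A M) = scal_mx B M.
Proof. by apply/matrixP => i j; rewrite !mxE rmorph_alg. Qed.

Lemma map_defect (E G : 'M[K]_n) (U : 'M[A]_n) :
  map_mx f (defect E G U) = defect E G (map_mx f U).
Proof. by rewrite /defect raddfB /= !map_mxM !map_scal_mx map_trmx. Qed.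

Lemma map_base_change (P Q : 'M[K]_n) (U : 'M[A]_n) :
  map_mx f (base_change P Q U) = base_change P Q (map_mx f U).
Proof. by rewrite /base_change !map_mxM !map_scal_mx. Qed.

End MapBaseChange.

Lemma base_changeK (K : fieldType) n (A : algType K) (P Q : 'M[K]_n)
    (U : 'M[A]_n) : P \in unitmx -> Q \in unitmx ->
  base_change (invmx P) (invmx Q) (base_change P Q U) = U.
Proof.
move=> Pu Qu; have [_ P1] := scal_mxV A Pu; have [_ Q1] := scal_mxV A Qu.
rewrite /base_change invmxK !mulmxA P1 mul1mx -mulmxA Q1 mulmx1 //.
Qed.

Lemma scal_mx_conj0 (K : fieldType) n (A : algType K) (M N : 'M[K]_n)
    (D : 'M[A]_n) : M \in unitmx -> N \in unitmx ->
  scal_mx A M *m D *m scal_mx A N = 0 -> D = 0.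
Proof.
move=> Mu Nu; have [_ M1] := scal_mxV A Mu; have [N1 _] := scal_mxV A Nu.
move=> /(congr1 (fun D => scal_mx A (invmx M) *m D *m scal_mx A (invmx N))).
by rewrite mulmx0 mul0mx !mulmxA M1 mul1mx -mulmxA N1 mulmx1.
Qed.

Lemma free_alg_morph_ext (K : comNzRingType) (X : choiceType) (B : algType K)
    (f g : {lrmorphism free_alg K X -> B}) :
  (forall x, f (wd K [:: x]) = g (wd K [:: x])) -> f =1 g.
Proof.
move=> fg; apply: free_alg_ext; [exact: linearP | exact: linearP |].
elim=> [|x w IH]; first by rewrite wd_nil !rmorph1.
by rewrite wd_cons !rmorphM /= fg IH.
Qed.

Lemma quot_alg_lift (K : comNzRingType) (A C : algType K) (S : A -> Prop)
    (S1 : 1 \notin gen_ideal S) (f : {lrmorphism A -> C}) :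
  (forall r, S r -> f r = 0) ->
  exists2 h : quot_alg S1 -> C,
    [/\ linear h, h 1 = 1 & {morph h : x y / x * y}] &
    forall y, h (qpi S1 y) = f y.
Proof.
move=> fS; pose h x := f (sval (qpi_surj (S1 := S1) x)).
have hE y : h (qpi S1 y) = f y.
  rewrite /h; case: (qpi_surj _) => z /= /(qpiP S1)/asboolP[s sS e].
  apply/eqP; rewrite eq_sym -subr_eq0 -linearB e linear_sum big_seq big1 //.
  by move=> t /sS /fS t0; rewrite !rmorphM /= t0 mulr0 mul0r.
exists h => //; split.
- move=> c x y; have [x' ->] := qpi_surj x; have [y' ->] := qpi_surj y.
  by rewrite -linearP !hE linearP.
- by rewrite -(rmorph1 (qpi S1)) hE rmorph1.
move=> x y; have [x' ->] := qpi_surj x; have [y' ->] := qpi_surj y.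
by rewrite -rmorphM !hE rmorphM.
Qed.

Lemma isometry_inv (K : fieldType) n (E G a : 'M[K]_n) :
  E \in unitmx -> G \in unitmx -> a^T *m E *m a = invmx G ->
  a *m G *m a^T = invmx E.
Proof.
move=> Eu Gu aE.
have /mulmx1C : G *m a^T *m E *m a = 1%:M.
  by rewrite -!mulmxA (mulmxA a^T) aE mulmxV.
by rewrite !mulmxA => /(congr1 (mulmx^~ (invmx E))); rewrite mul1mx mulmxK.
Qed.

Definition character (K : fieldType) (A : algType K) (chi : A -> K^o) :=
  [/\ linear chi, chi 1 = 1 & {morph chi : x y / x * y}].

Section Presentation.
Variables (K : fieldType) (n : nat) (E0 P Q : 'M[K]_n).
Variables (p q p' q' : 'I_n).
Hypotheses (E0u : E0 \in unitmx) (Pu : P \in unitmx) (Qu : Q \in unitmx).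
Local Notation E := (left_form E0 P).
Local Notation G := (right_form E0 Q).
Hypotheses (Ep : forall j, E p j = (j == q)%:R).
Hypotheses (Gp : forall j, G p' j = (j == q')%:R).
Hypotheses (pq : p != q) (pq' : p' != q').

Lemma adapted_defect (B : algType K) (gen : 'M[B]_n) :
  BE_left E0 gen = 1%:M -> BE_right E0 gen = 1%:M ->
  let v := base_change (invmx P) (invmx Q) gen in
  defect E G v = 0 /\ defect G E v^T = 0.
Proof.
move=> l r v; have genE : base_change P Q v = gen.
  have := base_changeK gen (P := invmx P) (Q := invmx Q).
  by rewrite !invmxK !unitmx_inv; apply.
split.
  have := BE_right_base_change Q E0u Pu v.
  rewrite genE r subrr => /esym; apply: scal_mx_conj0 => //.
  by rewrite unitmx_mul unitmx_tr Pu.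
have := BE_left_base_change P E0u Qu v.
rewrite genE l subrr => /esym; apply: scal_mx_conj0.
  by rewrite unitmx_mul unitmx_tr !unitmx_inv Qu E0u.
by rewrite unitmx_inv.
Qed.

Variables (F T B : algType K) (pi : {lrmorphism F -> B}).
Variables (uF : 'M[F]_n) (theta : {lrmorphism F -> T}) (phi : {lrmorphism T -> F}).
Variable wd : seq (letter n n) -> T.
Variable ext : (seq (letter n n) -> {malg K[seq (letter n n)]}) ->
  {linear T -> {malg K[seq (letter n n)]}}.
Local Notation U := (letter_mx wd).
Hypothesis wd_cat : forall a b, wd (a ++ b) = wd a * wd b.
Hypothesis wd_nil : wd [::] = 1.
Hypothesis wd_span : forall f,
  exists s : seq (K * seq (letter n n)), f = \sum_(t <- s) t.1 *: wd t.2.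
Hypothesis ext_wd : forall f w, ext f (wd w) = f w.
Hypothesis theta_u : map_mx theta uF = base_change P Q U.
Hypothesis phi_U : map_mx phi U = base_change (invmx P) (invmx Q) uF.
Hypothesis F_ext : forall f : {lrmorphism F -> F}, map_mx f uF = uF -> f =1 id.
Hypothesis T_ext : forall f : {lrmorphism T -> T}, map_mx f U = U -> f =1 id.
Let R x := exists i j,
  x = (BE_left E0 uF - 1%:M) i j \/ x = (BE_right E0 uF - 1%:M) i j.
Hypothesis pi_surj : forall x, exists y, pi y = x.
Hypothesis pi_ker : forall y, pi y = 0 -> y \in gen_ideal R.
Hypothesis pi_rel :
  BE_left E0 (map_mx pi uF) = 1%:M /\ BE_right E0 (map_mx pi uF) = 1%:M.

Let thetaK : cancel theta phi.
Proof.
apply: (F_ext (f := phi \o theta)).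
rewrite map_mx_comp theta_u map_base_change phi_U.
have := base_changeK uF (P := invmx P) (Q := invmx Q).
by rewrite !invmxK !unitmx_inv; apply.
Qed.

Let phiK : cancel phi theta.
Proof.
apply: (T_ext (f := theta \o phi)).
by rewrite map_mx_comp phi_U map_base_change theta_u base_changeK.
Qed.

Lemma adapted_normal_form : exists nf, normal_form p q p' q'
  (base_change (invmx P) (invmx Q) (map_mx pi uF)) nf.
Proof.
have vE : map_mx (pi \o phi) U =
    base_change (invmx P) (invmx Q) (map_mx pi uF).
  by rewrite map_mx_comp phi_U map_base_change.
rewrite -vE; have [l r] := pi_rel; have [d1 d2] := adapted_defect l r.
apply: (@normal_form_transfer K n n E G p q p' q' (left_form_unit E0u Pu)
  (right_form_unit E0u Qu) Ep Gp pq pq' (base_change_trace E0u Pu Qu) F T B pi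
  theta phi thetaK phiK R pi_surj pi_ker wd ext wd_cat wd_nil wd_span ext_wd).
  move=> _ [i [j [->|->]]].
    exists 1%:M, 1%:M, (invmx E0 *m (invmx Q)^T), (invmx Q); right; exists i, j.
    rewrite -BE_left_base_change // -theta_u -(map_BE E0 theta uF).1.
    by rewrite -(map_mx1 theta) -map_mxB [RHS]mxE.
  exists P, (P^T *m E0), 1%:M, 1%:M; left; exists i, j.
  rewrite -BE_right_base_change // -theta_u -(map_BE E0 theta uF).2.
  by rewrite -(map_mx1 theta) -map_mxB [RHS]mxE.
rewrite !(map_defect (pi \o phi)); split; first by rewrite vE.
by rewrite -map_trmx vE.
Qed.

End Presentation.

(** What the construction of a resolution of B(E) uses: generators in adapted
    bases, with their normal forms, and enough one-dimensional representations. *)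
Lemma BE_adapted_presentation (K : closedFieldType) n (E0 : 'M[K]_n)
    (E0u : E0 \in unitmx) : (2 <= n)%N ->
  exists (E G : 'M[K]_n) (p q p' q' : 'I_n) (v : 'M[BE E0u]_n) nf,
  [/\ [/\ E \in unitmx, G \in unitmx, p != q & p' != q'],
      (forall j, E p j = (j == q)%:R) /\ (forall j, G p' j = (j == q')%:R),
      defect E G v = 0 /\ defect G E v^T = 0,
      normal_form p q p' q' v nf &
      (exists a : 'M[K]_n, a^T *m E *m a = invmx G) /\
      forall a : 'M[K]_n, a^T *m E *m a = invmx G ->
        exists2 chi : BE E0u -> K^o, character chi &
          forall i j, chi (v i j) = a i j].
Proof.
move=> n2; have [P [p [q [Pu pq Ep]]]] := adapted_basis n2 E0u.
have [Q0 [p' [q' [Q0u pq' Gp]]]] : exists (Q : 'M[K]_n) (p q : 'I_n),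
    [/\ Q \in unitmx, p != q & forall j,
      (Q^T *m invmx E0 *m Q) p j = (j == q)%:R].
  by apply: adapted_basis; rewrite ?unitmx_inv.
pose Q := invmx Q0^T.
have Qu : Q \in unitmx by rewrite unitmx_inv unitmx_tr.
have {}Gp j : right_form E0 Q p' j = (j == q')%:R.
  by rewrite -Gp /right_form /Q invmxK trmxK.
exists (left_form E0 P), (right_form E0 Q), p, q, p', q'.
pose pi := qpi (BE_rel_proper E0u).
have piE : map_mx pi (BE_u K n) = BE_gen E0u by [].
have pi_rel : BE_left E0 (map_mx pi (BE_u K n)) = 1%:M /\
    BE_right E0 (map_mx pi (BE_u K n)) = 1%:M.
  by rewrite piE; apply: BE_gen_rel.
have pi_surj x : exists y, pi y = x by have [y ->] := qpi_surj x; exists y.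
have pi_ker y : pi y = 0 -> y \in gen_ideal (@BE_rel K n E0).
  by move=> y0; rewrite -[y]subr0; apply/(qpiP (BE_rel_proper E0u));
    rewrite [RHS]raddf0.
pose U := letter_mx (@wd K (letter n n)).
have [nf nfP] : exists nf, normal_form p q p' q'
    (base_change (invmx P) (invmx Q) (map_mx pi (BE_u K n))) nf.
  apply: (@adapted_normal_form K n E0 P Q p q p' q' E0u Pu Qu Ep Gp pq pq'
    _ (free_alg K (letter n n)) _ pi (BE_u K n)
    (free_lift (fun x : 'I_n * 'I_n => base_change P Q U x.1 x.2))
    (free_lift (fun x : letter n n =>
       base_change (invmx P) (invmx Q) (BE_u K n) x.1 x.2))
    (@wd K (letter n n))
    (fun f => malg_lift (fun m : {fmonom letter n n} => f (fmonom_val m)))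
    (@wd_cat _ _) (wd_nil _ _) (@free_algE _ _)).
- by move=> f w; apply: malg_liftU.
- by apply/matrixP => i j; rewrite [LHS]mxE [BE_u _ _ _ _]mxE; apply: free_lift_gen.
- apply/matrixP => i j; rewrite [LHS]mxE [letter_mx _ _ _]mxE -free_genE.
  exact: free_lift_gen.
- move=> f /matrixP fu; apply: (free_alg_morph_ext (g := idfun)) => -[i j].
  by have := fu i j; rewrite [LHS]mxE ![BE_u _ _ _ _]mxE free_genE.
- move=> f /matrixP fu; apply: (free_alg_morph_ext (g := idfun)) => -[i j].
  by have := fu i j; rewrite [LHS]mxE ![letter_mx _ _ _]mxE.
- exact: pi_surj.
- exact: pi_ker.
- exact: pi_rel.
exists (base_change (invmx P) (invmx Q) (BE_gen E0u)), nf; split.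
- by rewrite left_form_unit // right_form_unit.
- by split.
- by have [l r] := BE_gen_rel E0u; apply: adapted_defect.
- exact: nfP.
split.
  exists (invmx P *m Q); rewrite trmx_mul /left_form right_form_inv // !mulmxA.
  rewrite -(mulmxA Q^T) -trmx_mul mulmxV // trmx1 mulmx1.
  by rewrite -(mulmxA (Q^T *m E0)) mulmxV // mulmx1.
move=> a aE; pose b := base_change P Q (a : 'M[K^o]_n).
pose f : {lrmorphism free_alg K ('I_n * 'I_n)%type -> K^o} :=
  free_lift (fun x : 'I_n * 'I_n => b x.1 x.2).
have fu : map_mx f (BE_u K n) = b.
  by apply/matrixP => i j; rewrite [LHS]mxE [BE_u _ _ _ _]mxE; apply: free_lift_gen.
have scalE k (M : 'M[K]_k) : scal_mx K^o M = M.
  by apply/matrixP => i j; rewrite mxE; apply: mulr1.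
have Eu := left_form_unit E0u Pu; have Gu := right_form_unit E0u Qu.
have aG := isometry_inv Eu Gu aE.
have [bl br] : BE_left E0 b = 1%:M /\ BE_right E0 b = 1%:M.
  split; apply/eqP; rewrite -subr_eq0; apply/eqP.
    rewrite [LHS](BE_left_base_change P E0u Qu) /defect !scalE trmxK.
    by rewrite aE subrr mulmx0 mul0mx.
  rewrite [LHS](BE_right_base_change Q E0u Pu) /defect !scalE.
  by rewrite aG subrr mulmx0 mul0mx.
have fR r : BE_rel E0 r -> f r = 0.
  have [l r'] := map_BE E0 f (BE_u K n); rewrite fu bl in l; rewrite fu br in r'.
  have l0 : map_mx f (BE_left E0 (BE_u K n) - 1%:M) = 0.
    by rewrite map_mxB l map_mx1 subrr.
  have r0 : map_mx f (BE_right E0 (BE_u K n) - 1%:M) = 0.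
    by rewrite map_mxB r' map_mx1 subrr.
  move=> [i [j [|]]] ->; [move/matrixP: l0 | move/matrixP: r0] => /(_ i j);
    by rewrite [LHS]mxE [RHS]mxE.
have [chi chiP chif] := quot_alg_lift (BE_rel_proper E0u) fR.
exists chi => // i j.
have [chiL chi1 chiM] := chiP.
pose chi' : {lrmorphism BE E0u -> K^o} :=
  HB.pack chi (GRing.isLinear.Build _ _ _ _ _ chiL)
    (GRing.isMonoidMorphism.Build _ _ _ (conj chi1 chiM)).
have -> : a = map_mx chi' (base_change (invmx P) (invmx Q) (BE_gen E0u)).
  rewrite map_base_change.
  have -> : map_mx chi' (BE_gen E0u) = b.
    by rewrite -fu; apply/matrixP => k l; rewrite !mxE /= chif.
  by rewrite base_changeK.
by rewrite [RHS]mxE.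
Qed.

(** * The resolution *)

Section Resolution.
Variables (K : fieldType) (m n : nat).
Variables (E : 'M[K]_m) (G : 'M[K]_n).
Hypotheses (E_unit : E \in unitmx) (G_unit : G \in unitmx).
Variables (A : algType K) (u : 'M[A]_(m, n)).
Hypotheses (uGu : defect E G u = 0) (uEu : defect G E u^T = 0).

Local Notation letter := (letter m n).
Local Notation scal := (scal_mx A).

Definition uE : 'M[A]_(n, m) := u^T *m scal E.
Definition Eu : 'M[A]_(m, n) := scal E *m u.
Definition uG : 'M[A]_(m, n) := u *m scal G.
Definition Gu : 'M[A]_(n, m) := scal G *m u^T.

Lemma uE_u : uE *m u = scal (invmx G).
Proof. by have /eqP := uEu; rewrite subr_eq0 trmxK => /eqP. Qed.

Lemma u_Gu : u *m Gu = scal (invmx E).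
Proof. by rewrite /Gu mulmxA; have /eqP := uGu; rewrite subr_eq0 => /eqP. Qed.

Lemma uG_uE : uG *m uE = 1%:M.
Proof.
rewrite /uG /uE mulmxA -(mulmxA u) -/Gu u_Gu.
by have [_] := scal_mxV A E_unit.
Qed.

Lemma Eu_Gu : Eu *m Gu = 1%:M.
Proof. by rewrite /Eu -mulmxA u_Gu; have [] := scal_mxV A E_unit. Qed.

Lemma Gu_Eu : Gu *m Eu = 1%:M.
Proof.
rewrite /Gu /Eu mulmxA -(mulmxA _ u^T) -/uE -mulmxA uE_u.
by have [] := scal_mxV A G_unit.
Qed.

Lemma uE_entry i d : uE i d = \sum_c E c d *: u c i.
Proof.
by rewrite /uE mulmx_scal_entry; apply: eq_bigr => c _; rewrite mxE.
Qed.

Lemma uG_entry k b : uG k b = \sum_a G a b *: u k a.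
Proof. exact: mulmx_scal_entry. Qed.

Lemma Gu_entry c l : Gu c l = \sum_b G c b *: u l b.
Proof.
rewrite mxE; apply: eq_bigr => b _.
by rewrite !mxE /= mulr_algl.
Qed.

Lemma Eu_entry k j : Eu k j = \sum_l E k l *: u l j.
Proof. by rewrite mxE; apply: eq_bigr => l _; rewrite !mxE /= mulr_algl. Qed.

Lemma act_ten (X : choiceType) a b c x d :
  ract (lact a (ten c x d : FreeB A X)) b = ten (a * c) x (d * b).
Proof. by rewrite lact_ten ract_ten. Qed.

Lemma act_sum (M : bimodule A) a b I r (P : pred I) (F : I -> M) :
  ract (lact a (\sum_(i <- r | P i) F i)) b =
  \sum_(i <- r | P i) ract (lact a (F i)) b.
Proof. by rewrite linear_sum ract_suml. Qed.

Lemma actZ (M : bimodule A) a b c (x : M) :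
  ract (lact a (c *: x)) b = c *: ract (lact a x) b.
Proof. by rewrite linearZ ractZl. Qed.

Lemma actD (M : bimodule A) a b (x y : M) :
  ract (lact a (x + y)) b = ract (lact a x) b + ract (lact a y) b.
Proof. by rewrite linearD ractDl. Qed.

Lemma actB (M : bimodule A) a b (x y : M) :
  ract (lact a (x - y)) b = ract (lact a x) b - ract (lact a y) b.
Proof. by rewrite linearB ractBl. Qed.

Local Notation C0 := (FreeB A unit).
Local Notation C1 := (FreeB A letter).
Local Notation C2 := (FreeB A ('I_n * 'I_m)%type).
Local Notation C3 := (FreeB A unit).

Definition aug : C0 -> regular_bimodule A :=
  free_hom (fun _ => 1 : regular_bimodule A).

(** The generator (i, j) of C1 is the differential of u i j. *)
Definition d0 : C1 -> C0 :=
  free_hom (fun x : letter => ten (u x.1 x.2) tt 1 - ten 1 tt (u x.1 x.2) : C0).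

(** The inverse of u is G u^T E, so d(u^-1) = - u^-1 du u^-1 reads
    du^T + (u^T E) du (G u^T) = 0; the image of the generator (i, j) is the entry
    (i, j) of the left-hand side. *)
Definition d1 : C2 -> C1 :=
  free_hom (fun x : 'I_n * 'I_m => ten 1 (x.2, x.1) 1 +
    \sum_d \sum_k ten (uE x.1 d) (d, k) (Gu k x.2) : C1).

(** The elements of C2 that [d1] sends to the derivatives of the entries of u^T E u
    and of u G u^T. *)
Definition row_rel (i j : 'I_n) : C2 := \sum_k ten 1 (i, k) (Eu k j).
Definition col_rel (k l : 'I_m) : C2 := \sum_b ten (uG k b) (b, l) 1.

(** Contracting both families of relations with the forms gives, under [d1], the
    same derivative: that of the sum of the E k l G a b u k a u l b. *)
Definition syzygy : C2 :=
  \sum_k \sum_l E k l *: col_rel k l - \sum_i \sum_j G i j *: row_rel i j.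

Definition d2 : C3 -> C2 := free_hom (fun _ => syzygy).

Lemma augP : bimod_hom aug. Proof. exact: free_homP. Qed.
Lemma d0P : bimod_hom d0. Proof. exact: free_homP. Qed.
Lemma d1P : bimod_hom d1. Proof. exact: free_homP. Qed.
Lemma d2P : bimod_hom d2. Proof. exact: free_homP. Qed.

Lemma regular_lact a (x : A) : lact a (x : regular_bimodule A) = a * x :> A.
Proof. by []. Qed.

Lemma regular_ract a (x : A) : ract (x : regular_bimodule A) a = x * a :> A.
Proof. by []. Qed.

Lemma augE a x b : aug (ten a x b) = a * b :> A.
Proof. by rewrite /aug free_homE regular_lact regular_ract mulr1. Qed.

Lemma d0E a x b : d0 (ten a x b) =
  ten (a * u x.1 x.2) tt b - ten a tt (u x.1 x.2 * b).
Proof.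
by rewrite /d0 free_homE actB !act_ten mulr1 mul1r.
Qed.

Lemma d1E a x b : d1 (ten a x b) = ten a (x.2, x.1) b +
  \sum_d \sum_k ten (a * uE x.1 d) (d, k) (Gu k x.2 * b).
Proof.
rewrite /d1 free_homE actD act_ten mulr1 mul1r act_sum; congr (_ + _).
apply: eq_bigr => d _; rewrite act_sum; apply: eq_bigr => k _.
by rewrite act_ten.
Qed.

Lemma d1_act a x b : d1 (ract (lact a x) b) = ract (lact a (d1 x)) b.
Proof. by have [_ dl dr] := d1P; rewrite dr dl. Qed.

Lemma mulmx_entry1 k l (M : 'M[A]_(k, l)) (N : 'M[A]_(l, k)) i j :
  M *m N = 1%:M -> \sum_c M i c * N c j = (i == j)%:R.
Proof. by move=> /matrixP/(_ i j); rewrite !mxE. Qed.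

Lemma ten_delta_r (X : choiceType) k a (x : 'I_k -> X) (j : 'I_k) :
  \sum_l ten a (x l) (l == j)%:R = ten a (x j) 1 :> free_bimod A X.
Proof.
rewrite (bigD1 j) //= eqxx big1 ?addr0 // => l /negPf->.
exact: linear0P (ten_linearr a (x l)).
Qed.

Lemma ten_delta_l (X : choiceType) k b (x : 'I_k -> X) (j : 'I_k) :
  \sum_l ten (j == l)%:R (x l) b = ten 1 (x j) b :> free_bimod A X.
Proof.
rewrite (bigD1 j) //= eqxx big1 ?addr0 // => l; rewrite eq_sym => /negPf->.
exact: linear0P (ten_linearl (x l) b).
Qed.

Lemma d1_row_rel i j : d1 (row_rel i j) =
  \sum_k ten 1 (k, i) (Eu k j) + \sum_d ten (uE i d) (d, j) 1.
Proof.
have [dL _ _] := d1P; rewrite (linear_sumP dL).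
under eq_bigr => k _ do rewrite d1E /=.
rewrite big_split /=; congr (_ + _).
rewrite exchange_big; apply: eq_bigr => d _.
rewrite exchange_big /= -(ten_delta_r _ (fun l => (d, l))); apply: eq_bigr => l _.
by rewrite -ten_sumr (mulmx_entry1 _ _ Gu_Eu) mul1r.
Qed.

Lemma d1_col_rel k l : d1 (col_rel k l) =
  \sum_b ten (uG k b) (l, b) 1 + \sum_c ten 1 (k, c) (Gu c l).
Proof.
have [dL _ _] := d1P; rewrite (linear_sumP dL).
under eq_bigr => b _ do rewrite d1E /=.
rewrite big_split /=; congr (_ + _).
under eq_bigr => b _ do rewrite exchange_big.
rewrite exchange_big; apply: eq_bigr => c _ /=.
rewrite exchange_big /= -(ten_delta_l _ (fun d => (d, c))); apply: eq_bigr => d _.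
by rewrite -ten_suml (mulmx_entry1 _ _ uG_uE) mulr1.
Qed.

Lemma zero_hom (M N : bimodule A) : bimod_hom (fun _ : M => 0 : N).
Proof.
split=> [c a b|a b|b a] /=.
- by rewrite scaler0 addr0.
- by rewrite linear0.
by symmetry; apply: (linear0P (f := (@ract K A N)^~ a)); apply: ract_linear.
Qed.

Lemma aug_d0 x : aug (d0 x) = 0.
Proof.
apply: (free_hom_ext (bimod_hom_comp augP d0P) (zero_hom _ _)) => y.
have [aL _ _] := augP; rewrite /= d0E (linearBP aL) !augE.
by rewrite !mul1r mulr1 subrr.
Qed.

Lemma d0_d1 x : d0 (d1 x) = 0.
Proof.
apply: (free_hom_ext (bimod_hom_comp d0P d1P) (zero_hom _ _)) => -[i j].
have [dL _ _] := d0P; rewrite /= d1E (linearDP dL) d0E /= (linear_sumP dL).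
under eq_bigr => d _ do rewrite (linear_sumP dL).
under eq_bigr => d _ do under eq_bigr => k _ do
  rewrite d0E mul1r mulr1 /=.
under eq_bigr => d _ do rewrite sumrB.
rewrite sumrB mul1r mulr1.
have -> : \sum_d \sum_k ten (uE i d * u d k) tt (Gu k j) = ten 1 tt (u j i).
  rewrite exchange_big /=; under eq_bigr => k _ do rewrite -ten_suml.
  have /matrixP e : scal (invmx G) *m Gu = u^T.
    by rewrite /Gu mulmxA; have [_ ->] := scal_mxV A G_unit; rewrite mul1mx.
  have := e i j; rewrite !mxE => <-; rewrite ten_sumr; apply: eq_bigr => k _.
  have /matrixP/(_ i k) := uE_u; rewrite !mxE => ->.
  by rewrite /= mulr_algl tenZl tenZr.
have -> : \sum_d \sum_k ten (uE i d) tt (u d k * Gu k j) = ten (u j i) tt 1.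
  under eq_bigr => d _ do rewrite -ten_sumr.
  have /matrixP e : uE *m scal (invmx E) = u^T.
    by rewrite /uE -mulmxA; have [-> _] := scal_mxV A E_unit; rewrite mulmx1.
  have := e i j; rewrite !mxE => <-; rewrite ten_suml; apply: eq_bigr => d _.
  have /matrixP/(_ d j) := u_Gu; rewrite !mxE => ->.
  by rewrite /= mulr_algr tenZl tenZr.
by rewrite addrA subrK subrr.
Qed.

Let syzygy_sides :
  (\sum_k \sum_l E k l *: (\sum_b ten (uG k b) (l, b) 1) =
   \sum_i \sum_j G i j *: (\sum_d ten (uE i d) (d, j) 1) :> C1) /\
  (\sum_k \sum_l E k l *: (\sum_c ten 1 (k, c) (Gu c l)) =
   \sum_i \sum_j G i j *: (\sum_k ten 1 (k, i) (Eu k j)) :> C1).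
Proof.
have exch (f : 'I_m -> 'I_m -> 'I_n -> 'I_n -> C1) :
    \sum_k \sum_l \sum_a \sum_b f k l a b =
    \sum_a \sum_b \sum_k \sum_l f k l a b.
  under eq_bigr => k _ do rewrite exchange_big.
  rewrite exchange_big; apply: eq_bigr => a _.
  under eq_bigr => k _ do rewrite exchange_big.
  by rewrite exchange_big.
split.
  transitivity (\sum_k \sum_l \sum_a \sum_b
      (E k l * G a b) *: (ten (u k a) (l, b) 1 : C1)).
    apply: eq_bigr => k _; apply: eq_bigr => l _.
    rewrite exchange_big scaler_sumr; apply: eq_bigr => b _.
    rewrite uG_entry ten_suml scaler_sumr; apply: eq_bigr => a _.
    by rewrite tenZl scalerA.
  rewrite exch; apply: eq_bigr => i _; apply: eq_bigr => j _.
  rewrite exchange_big scaler_sumr; apply: eq_bigr => d _.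
  rewrite uE_entry ten_suml scaler_sumr; apply: eq_bigr => c _.
  by rewrite tenZl scalerA mulrC.
transitivity (\sum_k \sum_l \sum_a \sum_b
    (E k l * G a b) *: (ten 1 (k, a) (u l b) : C1)).
  apply: eq_bigr => k _; apply: eq_bigr => l _.
  rewrite scaler_sumr; apply: eq_bigr => a _.
  rewrite Gu_entry ten_sumr scaler_sumr; apply: eq_bigr => b _.
  by rewrite tenZr scalerA.
rewrite exch; apply: eq_bigr => i _; apply: eq_bigr => j _.
rewrite scaler_sumr; apply: eq_bigr => k _.
rewrite Eu_entry ten_sumr scaler_sumr; apply: eq_bigr => l _.
by rewrite tenZr scalerA mulrC.
Qed.

Lemma d1_d2 x : d1 (d2 x) = 0.
Proof.
apply: (free_hom_ext (bimod_hom_comp d1P d2P) (zero_hom _ _)) => y.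
have [dL _ _] := d1P; have [s1 s2] := syzygy_sides.
rewrite /= /d2 free_hom1 /syzygy (linearBP dL) !(linear_sumP dL).
apply/eqP; rewrite subr_eq0; apply/eqP.
transitivity (\sum_k \sum_l E k l *: (\sum_b ten (uG k b) (l, b) 1 : C1) +
  \sum_k \sum_l E k l *: (\sum_c ten 1 (k, c) (Gu c l) : C1)).
  rewrite -big_split; apply: eq_bigr => k _; rewrite (linear_sumP dL) -big_split.
  by apply: eq_bigr => l _; rewrite (linearZP dL) d1_col_rel scalerDr.
apply: etrans (congr2 +%R s1 s2) _; apply: etrans (esym (big_split _ _ _ _ _)) _.
apply: eq_bigr => i _; rewrite (linear_sumP dL).
apply: etrans (esym (big_split _ _ _ _ _)) _; apply: eq_bigr => j _.
by rewrite (linearZP dL) d1_row_rel scalerDr [RHS]addrC.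
Qed.

End Resolution.

(** * Exactness, by leading words *)

(** A family with distinct leading terms is independent: [lam] reads off
    coefficients, and the largest leading term of a combination survives. *)
Lemma lead_independence (S T : eqType) (A C D : zmodType) (v : S -> A -> C)
    (f : C -> D) (allowed : pred S) (lead : S -> T) (mu : T -> nat)
    (lam : T -> D -> A) :
  (forall s, {morph v s : b c / b + c}) -> {morph f : x y / x + y} ->
  (forall t, {morph lam t : x y / x + y}) ->
  {in allowed &, injective lead} ->
  (forall s b t, s \in allowed -> (mu (lead s) <= mu t)%N ->
     lam t (f (v s b)) = if t == lead s then b else 0) ->
  forall l : seq (S * A), (forall t, t \in l -> t.1 \in allowed) ->
    f (\sum_(t <- l) v t.1 t.2) = 0 -> \sum_(t <- l) v t.1 t.2 = 0.
Proof.
move=> vD fD lamD leadI lamE l la.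
have add0 (U V : zmodType) (g : U -> V) : {morph g : x y / x + y} -> g 0 = 0.
  by move=> gD; apply: (addrI (g 0)); rewrite -gD !addr0.
have gsum (U V : zmodType) (g : U -> V) : {morph g : x y / x + y} ->
    forall I (r : seq I) (P : pred I) F,
    g (\sum_(i <- r | P i) F i) = \sum_(i <- r | P i) g (F i).
  by move=> gD I r P F; apply: big_morph => //; apply: add0.
pose B s := \sum_(t <- l | t.1 == s) t.2; pose U := undup (map fst l).
have -> : \sum_(t <- l) v t.1 t.2 = \sum_(s <- U) v s (B s).
  under [RHS]eq_bigr => s _ do rewrite (gsum _ _ _ (vD s)).
  rewrite (exchange_big_dep xpredT) //= big_seq [RHS]big_seq.
  apply: eq_bigr => t tl; have tU : t.1 \in U by rewrite mem_undup map_f.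
  rewrite -big_filter (_ : [seq s <- U | t.1 == s] = [:: t.1]) ?big_seq1 //.
  rewrite -[RHS](filter_pred1_uniq (undup_uniq (map fst l)) tU).
  by apply: eq_filter => s /=; rewrite eq_sym.
move=> f0; rewrite big_seq big1 // => s sU.
suff -> : B s = 0 by apply: add0.
pose N := (\sum_(s <- U) mu (lead s))%N.
have muN r : r \in U -> (mu (lead r) <= N)%N.
  by move=> rU; rewrite /N (bigD1_seq r) ?undup_uniq //= leq_addr.
have [k] := ubnP (N - mu (lead s))%N.
elim: k s sU => // k IH s sU; rewrite ltnS => sk.
have Ua r : r \in U -> r \in allowed.
  by rewrite mem_undup => /mapP[t tl ->]; apply: la.
have := add0 _ _ _ (lamD (lead s)); rewrite -f0 (gsum _ _ _ fD).
rewrite (gsum _ _ _ (lamD _)) (bigD1_seq s) ?undup_uniq //= lamE ?Ua // eqxx.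
rewrite big_seq_cond big1 ?addr0 // => r /andP[rU rs].
have [lt|le] := ltnP (mu (lead s)) (mu (lead r)).
  rewrite IH // ?(add0 _ _ _ (vD _)) ?(add0 _ _ _ fD) ?(add0 _ _ _ (lamD _)) //.
  by apply: leq_trans (_ : N - mu (lead r) < N - mu (lead s))%N sk;
     rewrite ltn_sub2l // (leq_trans lt) // muN.
rewrite lamE ?Ua //; case: eqP => // /leadI; rewrite !Ua // => /(_ isT isT) e.
by rewrite e eqxx in rs.
Qed.

Section Spanned.
Variables (K : comNzRingType) (A B C : lmodType K) (S : eqType).
Variables (v : S -> A -> C) (allowed : pred S) (d : B -> C).
Hypotheses (vL : forall s, linear (v s)) (dL : linear d).

Definition spanned (y : C) := exists (l : seq (S * A)) (z : B),
  (forall t, t \in l -> t.1 \in allowed) /\ y = \sum_(t <- l) v t.1 t.2 + d z.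

Lemma spanned_gen s b : s \in allowed -> spanned (v s b).
Proof.
move=> sa; exists [:: (s, b)], 0; split; last first.
  by rewrite big_seq1 (linear0P dL) addr0.
by move=> t; rewrite inE => /eqP->.
Qed.

Lemma spanned_im z : spanned (d z).
Proof. by exists [::], z; split=> //; rewrite big_nil add0r. Qed.

Lemma spanned0 : spanned 0.
Proof. by rewrite -(linear0P dL); apply: spanned_im. Qed.

Lemma spannedD y y' : spanned y -> spanned y' -> spanned (y + y').
Proof.
move=> [l [z [la ->]]] [l' [z' [la' ->]]]; exists (l ++ l'), (z + z'); split.
  by move=> t; rewrite mem_cat => /orP[/la|/la'].
by rewrite big_cat (linearDP dL) addrACA.
Qed.

Lemma spannedZ c y : spanned y -> spanned (c *: y).
Proof.
move=> [l [z [la ->]]]; exists [seq (t.1, c *: t.2) | t <- l], (c *: z); split.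
  by move=> _ /mapP[t /la ta ->].
rewrite big_map scalerDr (linearZP dL) scaler_sumr; congr (_ + _).
by apply: eq_bigr => t _; rewrite (linearZP (vL _)).
Qed.

Lemma spannedB y y' : spanned y -> spanned y' -> spanned (y - y').
Proof. by move=> sy sy'; rewrite -scaleN1r; apply/spannedD/spannedZ. Qed.

Lemma spanned_sum I r (P : pred I) F : (forall i, P i -> spanned (F i)) ->
  spanned (\sum_(i <- r | P i) F i).
Proof. by move=> FS; elim/big_ind: _ => //; [apply: spanned0 | apply: spannedD]. Qed.

Lemma spanned_form k (M : 'M[K]_k) r (F : 'I_k -> 'I_k -> C) :
  (forall a b, a != r -> spanned (F a b)) ->
  spanned (\sum_(a | a != r) \sum_b M a b *: F a b).
Proof.
move=> FS; apply: spanned_sum => a ar; apply: spanned_sum => b _.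
by apply: spannedZ; apply: FS.
Qed.

End Spanned.

Lemma spanned_free (K : comNzRingType) (A : algType K) (Y : choiceType)
    (B : lmodType K) (S : eqType) (v : S -> A -> free_bimod A Y)
    (allowed : pred S) (d : B -> free_bimod A Y) : linear d ->
  (forall a y b, spanned v allowed d (ten a y b)) -> forall z, spanned v allowed d z.
Proof.
move=> dL vten z; have [s ->] := free_bimodE z.
by apply: (spanned_sum dL) => t _; apply: vten.
Qed.

Section Exactness.
Variables (K : fieldType) (m n : nat).
Variables (E : 'M[K]_m) (G : 'M[K]_n) (p q : 'I_m) (p' q' : 'I_n).
Hypotheses (E_unit : E \in unitmx) (G_unit : G \in unitmx).
Hypotheses (Ep : forall j, E p j = (j == q)%:R).
Hypotheses (Gp : forall j, G p' j = (j == q')%:R).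
Hypotheses (pq : p != q) (pq' : p' != q').
Variables (A : algType K) (u : 'M[A]_(m, n)).
Hypotheses (uGu : defect E G u = 0) (uEu : defect G E u^T = 0).

Local Notation letter := (letter m n).
Local Notation mu := (mu p p').
Local Notation uE := (uE E u).
Local Notation Eu := (Eu E u).
Local Notation uG := (uG G u).
Local Notation Gu := (Gu G u).

Variable nf : {linear A -> {malg K[seq letter]}}.
Hypothesis nfP : normal_form p q p' q' u nf.

Local Notation tn a y b := (@ten K A _ a y b : FreeB A _).
Local Notation nw := (normal_word p q p' q').
Local Notation uw := (word_in u).

Lemma uw_rcons w x : uw (rcons w x) = uw w * u x.1 x.2.
Proof. by rewrite /word_in -cats1 big_cat big_seq1. Qed.

Lemma uw_nil : uw [::] = 1.
Proof. by rewrite /word_in big_nil. Qed.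

Lemma mu_rcons w x :
  mu (rcons w x) = (mu w * 4 + (letter_wt p p' x).+1)%N.
Proof. exact: word_mu_rcons. Qed.

Lemma mu_prefix w x : (mu w < mu (rcons w x))%N.
Proof. by rewrite mu_rcons; lia. Qed.

Lemma mu_rcons_lt w x y : (letter_wt p p' x < letter_wt p p' y)%N ->
  (mu (rcons w x) < mu (rcons w y))%N.
Proof. by rewrite !mu_rcons ltn_add2l ltnS. Qed.

Lemma mu_row w c i : c != p -> (mu (rcons w (c, i)) < mu (rcons w (p, i)))%N.
Proof. by move=> /negPf cp; apply: mu_rcons_lt; rewrite /letter_wt /= cp eqxx. Qed.

Lemma mu_col w k a : a != p' -> (mu (rcons w (k, a)) < mu (rcons w (k, p')))%N.
Proof.
move=> /negPf ap; apply: mu_rcons_lt.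
by rewrite /letter_wt /= ap eqxx addn0 addn1.
Qed.

Lemma mu_corner w k a : k != p ->
  (mu (rcons w (k, a)) < mu (rcons w (p, p')))%N.
Proof.
move=> /negPf kp; apply: mu_rcons_lt.
by rewrite /letter_wt /= kp !eqxx; case: eqP.
Qed.

(** Induction on leading words: a property closed under linear combinations
    holds once it holds for normal words, given smaller words. *)
Lemma word_ind (P : A -> Prop) : P 0 ->
  (forall a b, P a -> P b -> P (a + b)) -> (forall c a, P a -> P (c *: a)) ->
  (forall w, nw w -> (forall w', (mu w' < mu w)%N -> P (uw w')) -> P (uw w)) ->
  forall a, P a.
Proof.
move=> P0 PD PZ Pw; have [nfK nfc] := nfP.
have comb (g : {malg K[seq letter]}) :
    (forall w, w \in msupp g -> P (uw w)) -> P (malg_lift uw g).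
  move=> gP; rewrite /malg_lift big_seq; elim/big_ind: _ => // w wg.
  by apply: PZ; apply: gP.
suff Puw w : P (uw w) by move=> a; rewrite -(nfK a); apply: comb => w _.
have [k] := ubnP (mu w); elim: k w => // k IH w; rewrite ltnS => wk.
have {}IH w' : (mu w' < mu w)%N -> P (uw w').
  by move=> lt; apply: IH; apply: leq_trans lt wk.
have [wn|wn] := boolP (nw w); first exact: Pw.
rewrite -(nfK (uw w)); apply: comb => t; apply: contraTP => Pt.
have le : (mu w <= mu t)%N.
  by rewrite leqNgt; apply/negP => /IH.
by rewrite -mcoeff_eq0 nfc // (negPf wn) andbF.
Qed.

Lemma nw_rcons w x : nw w -> nw (rcons w x) = false ->
  exists w' y, w = rcons w' y /\
    ((y.2 = p' /\ x.2 = q') \/ (y.1 = p /\ x.1 = q)).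
Proof.
case/lastP: w => [//|w y] wn; rewrite -!cats1 -catA /= => e.
exists w, y; split; first by rewrite cats1.
move: wn e; rewrite /normal_word /normal -cats1.
case: w => [_|z w] /=.
  rewrite andbT irreducibleE => /negbT; rewrite negb_and !negbK.
  by case/orP => /andP[/eqP-> /eqP->]; [left|right].
rewrite !cat_path /= andbT => /andP[-> ->] /=; rewrite andbT irreducibleE.
move=> /negbT; rewrite negb_and !negbK.
by case/orP => /andP[/eqP-> /eqP->]; [left|right].
Qed.

Lemma nw_corner w : nw w -> nw (rcons w (p, p')).
Proof.
move=> wn; apply: contraT => /negbTE /(nw_rcons wn) [w' [y [_ [[_]|[_]]]]] /= /eqP.
  by rewrite (negPf pq').
by rewrite (negPf pq).
Qed.

(** The coordinate of [free_bimod A Y] on a word and a basis element, with values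
    in the right factor A. *)
Section Coef.
Variable Y : choiceType.

Definition coef (t : seq letter * Y) : FreeB A Y -> A :=
  ten_lift (fun a (z : Y) b => ((z == t.2)%:R * (nf a)@_(t.1)) *: b).

Let coef_l t (z : Y) (b : A) : linear (fun a => ((z == t.2)%:R * (nf a)@_(t.1)) *: b).
Proof.
move=> c a a'; rewrite linearP mcoeffD mcoeffZ mulrDr scalerDl mulrCA.
by rewrite scalerA.
Qed.

Let coef_r t a (z : Y) : linear (fun b => ((z == t.2)%:R * (nf a)@_(t.1)) *: b : A).
Proof. by move=> c b b'; rewrite scalerDr !scalerA mulrC. Qed.

Lemma coef_linear t : linear (coef t).
Proof. by apply: ten_lift_linear; [apply: coef_l | apply: coef_r]. Qed.

Lemma coefD t : {morph coef t : x y / x + y}.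
Proof. exact: linearDP (coef_linear t). Qed.

Lemma coef_word t w z b : (mu w <= mu t.1)%N ->
  coef t (tn (uw w) z b) = if [&& t.1 == w, nw w & t.2 == z] then b else 0.
Proof.
move=> le; rewrite /coef ten_liftE; [|apply: coef_l|apply: coef_r].
have [_ nfc] := nfP; rewrite nfc // (eq_sym z).
case: (t.1 == w); case: (nw w); case: (t.2 == z) => /=;
  by rewrite ?mulr1 ?mul1r ?mulr0 ?mul0r ?scale1r ?scale0r.
Qed.

Lemma coef_low t w z b : (mu w < mu t.1)%N -> coef t (tn (uw w) z b) = 0.
Proof.
move=> lt; rewrite coef_word ?(ltnW lt) //; case: eqP => // e.
by rewrite e ltnn in lt.
Qed.

Lemma coef_sum0 t I r (P : pred I) F : (forall i, P i -> coef t (F i) = 0) ->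
  coef t (\sum_(i <- r | P i) F i) = 0.
Proof. by move=> F0; rewrite (linear_sumP (coef_linear t)) big1. Qed.

Lemma coef_form0 t k (M : 'M[K]_k) r (F : 'I_k -> 'I_k -> FreeB A Y) :
  (forall a b, a != r -> coef t (F a b) = 0) ->
  coef t (\sum_(a | a != r) \sum_b M a b *: F a b) = 0.
Proof.
move=> F0; apply: coef_sum0 => a ar; apply: coef_sum0 => b _.
by rewrite (linearZP (coef_linear t)) F0 // scaler0.
Qed.

Lemma ten_uG (f : 'I_n -> Y) w k b : \sum_c tn (uw w * uG k c) (f c) b =
  tn (uw (rcons w (k, p'))) (f q') b +
  \sum_(d | d != p') \sum_c G d c *: tn (uw (rcons w (k, d))) (f c) b.
Proof.
rewrite -(form_sum_split (fun d c => tn (uw (rcons w (k, d))) (f c) b) Gp).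
rewrite exchange_big; apply: eq_bigr => c _.
rewrite uG_entry mulr_sumr ten_suml; apply: eq_bigr => d _.
by rewrite (uw_rcons w (k, d)) -scalerAr tenZl.
Qed.

Lemma ten_uE (f : 'I_m -> Y) w i b : \sum_d tn (uw w * uE i d) (f d) b =
  tn (uw (rcons w (p, i))) (f q) b +
  \sum_(c | c != p) \sum_d E c d *: tn (uw (rcons w (c, i))) (f d) b.
Proof.
rewrite -(form_sum_split (fun c d => tn (uw (rcons w (c, i))) (f d) b) Ep).
rewrite exchange_big; apply: eq_bigr => d _.
rewrite uE_entry mulr_sumr ten_suml; apply: eq_bigr => c _.
by rewrite (uw_rcons w (c, i)) -scalerAr tenZl.
Qed.

End Coef.

Local Notation C0 := (FreeB A unit).
Local Notation C1 := (FreeB A letter).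
Local Notation C2 := (FreeB A ('I_n * 'I_m)%type).
Local Notation C3 := (FreeB A unit).
Local Notation d0 := (d0 u).
Local Notation d1 := (d1 E G u).
Local Notation d2 := (d2 E G u).
Local Notation aug := (@aug K A).
Local Notation row_rel := (row_rel E u).
Local Notation col_rel := (col_rel G u).

(** By induction on leading words, a (x) b = 1 (x) a b modulo the image of [d0]. *)
Lemma aug_exact y : aug y = 0 -> exists z, d0 z = y.
Proof.
have [d0L _ _] := d0P u; have [aL _ _] := augP A.
have im a b : exists z, d0 z = tn a tt b - tn 1 tt (a * b).
  move: a b; apply: word_ind => [b|a a' IH IH' b|c a IH b|w wn IH b].
  - exists 0; rewrite (linear0P d0L) mul0r.
    by rewrite (linear0P (ten_linearl tt b)) (linear0P (ten_linearr 1 tt)) subrr.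
  - have [z ze] := IH b; have [z' ze'] := IH' b; exists (z + z').
    by rewrite (linearDP d0L) ze ze' mulrDl tenDl tenDr opprD addrACA.
  - have [z ze] := IH b; exists (c *: z).
    by rewrite (linearZP d0L) ze -scalerAl tenZl tenZr scalerBr.
  case/lastP: w wn IH => [_ _|w x wn IH].
    by exists 0; rewrite (linear0P d0L) uw_nil mul1r subrr.
  have [z ze] := IH w (mu_prefix w x) (u x.1 x.2 * b).
  exists (tn (uw w) x b + z).
  by rewrite (linearDP d0L) ze d0E uw_rcons mulrA addrA subrK.
have im' : exists z, d0 z = y - tn 1 tt (aug y).
  have [s ->] := free_bimodE y; elim: s => [|t s [z ze]].
    exists 0; rewrite big_nil (linear0P d0L) (linear0P aL).
    by rewrite (linear0P (ten_linearr 1 tt)) subrr.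
  have [z' ze'] := im t.1.1 t.2; exists (z' + z).
  rewrite big_cons (linearDP d0L) ze ze' (linearDP aL) augE tenDr opprD addrACA.
  by case: (t.1.2).
move=> y0; have [z ze] := im'; exists z.
by rewrite ze y0 (linear0P (ten_linearr 1 tt)) subr0.
Qed.

(** The words w dx b with w x normal: [d0] sends such an element to w x (x) b, up to
    smaller words, and modulo the image of [d1] they span C1. *)
Definition fam1 (s : seq letter * letter) (b : A) : C1 := tn (uw s.1) s.2 b.
Definition allowed1 : pred (seq letter * letter) :=
  fun s => nw (rcons s.1 s.2).

(** The derivative of the entry (i, j) of u^T E u, with its leading term u p i d(u q j)
    isolated. *)
Lemma d1_row w i j b :
  d1 (ract (lact (uw w) (row_rel i j)) b) =
  tn (uw (rcons w (p, i))) (q, j) b +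
  (\sum_k tn (uw w) (k, i) (Eu k j * b) +
   \sum_(c | c != p) \sum_d E c d *: tn (uw (rcons w (c, i))) (d, j) b).
Proof.
rewrite d1_act d1_row_rel // actD !act_sum addrCA; congr (_ + _).
  by apply: eq_bigr => k _; rewrite act_ten mulr1.
under eq_bigr => d _ do rewrite act_ten mul1r.
exact: (ten_uE (fun d => (d, j)) w i b).
Qed.

Lemma d1_col w k l b :
  d1 (ract (lact (uw w) (col_rel k l)) b) =
  tn (uw (rcons w (k, p'))) (l, q') b +
  (\sum_c tn (uw w) (k, c) (Gu c l * b) +
   \sum_(a | a != p') \sum_c G a c *: tn (uw (rcons w (k, a))) (l, c) b).
Proof.
rewrite d1_act d1_col_rel // actD !act_sum addrC addrCA; congr (_ + _).
  by apply: eq_bigr => c _; rewrite act_ten mulr1.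
under eq_bigr => c _ do rewrite act_ten mul1r.
exact: (ten_uG (fun c => (l, c)) w k b).
Qed.

Lemma C1_spanned y : spanned fam1 allowed1 d1 y.
Proof.
have [d1L _ _] := d1P E G u.
have vL s : linear (fam1 s) by apply: ten_linearr.
apply: spanned_free => // a x b; move: a x b.
apply: word_ind => [x b|a a' IH IH' x b|c a IH x b|w wn IH x b].
- by rewrite (linear0P (ten_linearl x b)); apply: spanned0.
- by rewrite tenDl; apply: spannedD.
- by rewrite tenZl; apply: spannedZ.
have [wxn|/negbTE wxn] := boolP (nw (rcons w x)).
  exact: (spanned_gen fam1 d1L b (s := (w, x))).
have [w' [[k i] [ww /= h]]] := nw_rcons wn wxn; case: x h wxn => l j /= h _.
case: h => -[ek el].
  rewrite {}ek {}el in ww *.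
  have e := d1_col w' k l b.
  have -> : tn (uw w) (l, q') b = d1 (ract (lact (uw w') (col_rel k l)) b) -
     (\sum_c tn (uw w') (k, c) (Gu c l * b) +
      \sum_(a | a != p') \sum_c G a c *: tn (uw (rcons w' (k, a))) (l, c) b).
    by rewrite e ww addrK.
  apply: spannedB => //; first exact: spanned_im.
  apply: spannedD => //; first apply: spanned_sum => // c _.
    by apply: IH; rewrite ww mu_prefix.
  apply: (spanned_form vL d1L G
    (F := fun a c => tn (uw (rcons w' (k, a))) (l, c) b)) => a c ap.
  by apply: IH; rewrite ww; apply: mu_col.
rewrite {}ek {}el in ww *.
have e := d1_row w' i j b.
have -> : tn (uw w) (q, j) b = d1 (ract (lact (uw w') (row_rel i j)) b) -
   (\sum_k tn (uw w') (k, i) (Eu k j * b) +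
    \sum_(c | c != p) \sum_d E c d *: tn (uw (rcons w' (c, i))) (d, j) b).
  by rewrite e ww addrK.
apply: spannedB => //; first exact: spanned_im.
apply: spannedD => //; first apply: spanned_sum => // c _.
  by apply: IH; rewrite ww mu_prefix.
apply: (spanned_form vL d1L E
  (F := fun a c => tn (uw (rcons w' (a, i))) (c, j) b)) => a c ap.
by apply: IH; rewrite ww; apply: mu_row.
Qed.

Lemma exact1 y : d0 y = 0 -> exists z, d1 z = y.
Proof.
have [d0L _ _] := d0P u; have [l [z [la ->]]] := C1_spanned y.
rewrite (linearDP d0L) d0_d1 // addr0 => e; exists z.
suff -> : \sum_(t <- l) fam1 t.1 t.2 = 0 by rewrite add0r.
apply: (lead_independence (allowed := allowed1)
  (lead := fun s => (rcons s.1 s.2, tt)) (mu := fun t => mu t.1)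
  (lam := fun t => @coef unit t) _ _ _ _ _ la e).
- by move=> s; apply: linearDP; apply: ten_linearr.
- exact: linearDP.
- by move=> t; apply: coefD.
- by move=> [w x] [w' x'] _ _ [] /eqP; rewrite eqseq_rcons => /andP[/eqP-> /eqP->].
move=> [w x] b [t []] wn /= le; have {}wn : nw (rcons w x) by [].
rewrite /fam1 d0E -uw_rcons.
rewrite (linearBP (coef_linear _)) coef_word //= wn.
rewrite coef_low ?subr0 /=; last exact: leq_trans (mu_prefix _ _) le.
by rewrite xpair_eqE eqxx !andbT.
Qed.

(** Relations in a context, whose images under [d1] have distinct leading terms. The
    column relation (p, q) is left out, as [d2] expresses it through the others. *)
Definition fam2
    (s : seq letter * ('I_n * 'I_n) + seq letter * ('I_m * 'I_m)) (b : A) : C2 :=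
  match s with
  | inl s => ract (lact (uw s.1) (row_rel s.2.1 s.2.2)) b
  | inr s => ract (lact (uw s.1) (col_rel s.2.1 s.2.2)) b
  end.
Definition allowed2 :
    pred (seq letter * ('I_n * 'I_n) + seq letter * ('I_m * 'I_m)) :=
  fun s => match s with
  | inl s => nw (rcons s.1 (p, s.2.1))
  | inr s => nw (rcons s.1 (s.2.1, p')) && (s.2 != (p, q))
  end.
Definition lead2
    (s : seq letter * ('I_n * 'I_n) + seq letter * ('I_m * 'I_m)) :
    seq letter * letter :=
  match s with
  | inl s => (rcons s.1 (p, s.2.1), (q, s.2.2))
  | inr s => (rcons s.1 (s.2.1, p'), (s.2.2, q'))
  end.

Lemma row_word w i j b : ract (lact (uw w) (row_rel i j)) b =
  \sum_k tn (uw w) (i, k) (Eu k j * b).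
Proof.
by rewrite act_sum; apply: eq_bigr => k _; rewrite act_ten mulr1.
Qed.

Lemma col_word w k l b : ract (lact (uw w) (col_rel k l)) b =
  tn (uw (rcons w (k, p'))) (q', l) b +
  \sum_(a | a != p') \sum_c G a c *: tn (uw (rcons w (k, a))) (c, l) b.
Proof.
rewrite act_sum; under eq_bigr => c _ do rewrite act_ten mul1r.
exact: (ten_uG (fun c => (c, l)) w k b).
Qed.

(** The rows of E u form a basis of row vectors over A, with inverse G u^T: so C2 is
    also free on the row relations. *)
Lemma ten_row w i j b : tn (uw w) (i, j) b =
  \sum_k ract (lact (uw w) (row_rel i k)) (Gu k j * b).
Proof.
under eq_bigr => k _ do rewrite row_word.
rewrite exchange_big (bigD1 j) //= [X in _ + X]big1 ?addr0 => [|l lj];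
  under eq_bigr => k _ do rewrite mulrA; rewrite -ten_sumr -mulr_suml.
  by rewrite (mulmx_entry1 _ _ (Eu_Gu E_unit uGu)) eqxx mul1r.
rewrite (mulmx_entry1 _ _ (Eu_Gu E_unit uGu)) (negPf lj) mul0r.
exact: linear0P (ten_linearr _ _).
Qed.

Lemma d2_word w b : d2 (tn (uw w) tt b) =
  ract (lact (uw w) (col_rel p q)) b +
  \sum_(k | k != p) \sum_l E k l *: ract (lact (uw w) (col_rel k l)) b -
  \sum_i \sum_j G i j *: ract (lact (uw w) (row_rel i j)) b.
Proof.
rewrite /d2 free_homE /syzygy actB; congr (_ - _).
  apply: etrans _
    (form_sum_split (fun k l => ract (lact (uw w) (col_rel k l)) b) Ep).
  apply: etrans (act_sum _ _ _ _ _) _; apply: eq_bigr => k _.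
  by apply: etrans (act_sum _ _ _ _ _) _; apply: eq_bigr => l _; rewrite actZ.
apply: etrans (act_sum _ _ _ _ _) _; apply: eq_bigr => k _.
by apply: etrans (act_sum _ _ _ _ _) _; apply: eq_bigr => l _; rewrite actZ.
Qed.

Lemma C2_spanned y : spanned fam2 allowed2 d2 y.
Proof.
have [d2L _ _] := d2P E G u.
have vL s : linear (fam2 s) by case: s => s; apply: ract_linearr.
apply: spanned_free => // a x b; move: a x b.
apply: word_ind => [x b|a a' IH IH' x b|c a IH x b|w wn IH [i j] b].
- by rewrite (linear0P (ten_linearl x b)); apply: spanned0.
- by rewrite tenDl; apply: spannedD.
- by rewrite tenZl; apply: spannedZ.
have [wxn|/negbTE wxn] := boolP (nw (rcons w (p, i))).
  rewrite ten_row; apply: (spanned_sum d2L) => k _.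
  exact: (spanned_gen fam2 d2L _ (s := inl (w, (i, k)))).
have [w' [[k i'] [ww /= h]]] := nw_rcons wn wxn.
case: h => -[ek el]; last by move: pq; rewrite el eqxx.
rewrite {}ek {}el in ww *.
have low v x b' : (mu v < mu w)%N -> spanned fam2 allowed2 d2 (tn (uw v) x b').
  by move=> lt; apply: IH.
have -> : tn (uw w) (q', j) b = ract (lact (uw w') (col_rel k j)) b -
    \sum_(a | a != p') \sum_c G a c *: tn (uw (rcons w' (k, a))) (c, j) b.
  by rewrite col_word ww addrK.
apply: (spannedB vL d2L); last first.
  apply: (spanned_form vL d2L G
    (F := fun a c => tn (uw (rcons w' (k, a))) (c, j) b)) => a c ap.
  by apply: low; rewrite ww; apply: mu_col.
have [kj|kj] := eqVneq (k, j) (p, q); last first.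
  apply: (spanned_gen fam2 d2L b (s := inr (w', (k, j)))).
  by rewrite unfold_in /= -ww wn.
case: kj ww => -> -> ww.
have -> : ract (lact (uw w') (col_rel p q)) b = d2 (tn (uw w') tt b) -
    \sum_(k | k != p) \sum_l E k l *: ract (lact (uw w') (col_rel k l)) b +
    \sum_i \sum_j G i j *: ract (lact (uw w') (row_rel i j)) b.
  by rewrite d2_word addrAC subrK addrK.
apply: (spannedD d2L); first apply: (spannedB vL d2L); first exact: spanned_im.
  apply: (spanned_form vL d2L E
    (F := fun c l => ract (lact (uw w') (col_rel c l)) b)) => c l cp.
  rewrite col_word.
  apply: (spannedD d2L); first by apply: low; rewrite ww; apply: mu_corner.
  apply: (spanned_form vL d2L G
    (F := fun a c' => tn (uw (rcons w' (c, a))) (c', l) b)) => a c' ap.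
  by apply: low; rewrite ww; apply: mu_corner.
apply: (spanned_sum d2L) => c _; apply: (spanned_sum d2L) => l _.
apply: (spannedZ vL d2L); rewrite row_word; apply: (spanned_sum d2L) => c' _.
by apply: low; rewrite ww; apply: mu_prefix.
Qed.

Lemma exact2 y : d1 y = 0 -> exists z, d2 z = y.
Proof.
have [d1L _ _] := d1P E G u; have [l [z [la ->]]] := C2_spanned y.
rewrite (linearDP d1L) d1_d2 // addr0 => e; exists z.
suff -> : \sum_(t <- l) fam2 t.1 t.2 = 0 by rewrite add0r.
apply: (lead_independence (allowed := allowed2) (lead := lead2)
  (mu := fun t => mu t.1) (lam := fun t => @coef letter t) _ _ _ _ _ la e).
- by case=> s; apply: linearDP; apply: ract_linearr.
- exact: linearDP.
- by move=> t; apply: coefD.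
- move=> [[w [i j]]|[w [k l']]] [[w' [i' j']]|[w2 [k' l2]]];
    rewrite !unfold_in /= => h1 h2 [/eqP]; rewrite eqseq_rcons.
  + by move=> /andP[/eqP-> /eqP[->]] ->.
  + move=> /andP[_ /eqP[e1 _]] e2 _; case/andP: h2.
    by rewrite -e1 -e2 eqxx.
  + move=> /andP[_ /eqP[e1 _]] e2 _; case/andP: h1.
    by rewrite e1 e2 eqxx.
  by move=> /andP[/eqP-> /eqP[->]] ->.
move=> [[w [i j]]|[w [k l']]] b [t y'] sa le; rewrite unfold_in /= in sa le;
  rewrite [fam2 _ _]/=.
  rewrite d1_row !coefD coef_word // sa xpair_eqE /=.
  rewrite coef_sum0 => [|k _]; last first.
    by rewrite coef_low //; apply: leq_trans (mu_prefix _ _) le.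
  rewrite coef_form0 ?addr0 ?add0r // => c d cp.
  by rewrite coef_low //; apply: leq_trans (mu_row _ _ cp) le.
case/andP: sa => sa _.
rewrite d1_col !coefD coef_word // sa xpair_eqE /=.
rewrite coef_sum0 => [|c _]; last first.
  by rewrite coef_low //; apply: leq_trans (mu_prefix _ _) le.
rewrite coef_form0 ?addr0 ?add0r // => a c ap.
by rewrite coef_low //; apply: leq_trans (mu_col _ _ ap) le.
Qed.

Definition fam3 (w : seq letter) (b : A) : C3 := tn (uw w) tt b.

Lemma C3_spanned y : spanned fam3 nw (fun _ : C3 => 0 : C3) y.
Proof.
have zL : linear (fun _ : C3 => 0 : C3) by move=> c x z; rewrite scaler0 addr0.
have vL s : linear (fam3 s) by apply: ten_linearr.
apply: spanned_free => // a [] b; move: a b.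
apply: word_ind => [b|a a' IH IH' b|c a IH b|w wn IH b].
- by rewrite (linear0P (ten_linearl tt b)); apply: spanned0.
- by rewrite tenDl; apply: spannedD.
- by rewrite tenZl; apply: spannedZ.
exact: (spanned_gen fam3 zL b (s := w)).
Qed.

(** The leading term of w d2(1) b is that of the column relation (p, q), namely
    w u p p' (q', q) b, as the word w (p, p') is normal with w. *)
Lemma d2_inj y : d2 y = 0 -> y = 0.
Proof.
have [d2L _ _] := d2P E G u; have [l [z [la ->]]] := C3_spanned y.
rewrite addr0 => e.
apply: (lead_independence (allowed := nw)
  (lead := fun w => (rcons w (p, p'), (q', q)))
  (mu := fun t => mu t.1)
  (lam := fun t => @coef ('I_n * 'I_m)%type t) _ _ _ _ _ la e).
- by move=> s; apply: linearDP; apply: ten_linearr.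
- exact: linearDP.
- by move=> t; apply: coefD.
- by move=> w w' _ _ [] /eqP; rewrite eqseq_rcons => /andP[/eqP].
move=> w b [t y'] wn le; rewrite /= in le; have {}wn : nw w by [].
rewrite /fam3 d2_word col_word (linearBP (coef_linear _)) !coefD.
rewrite coef_word // nw_corner // xpair_eqE /=.
have low v x b' : (mu v < mu (rcons w (p, p')))%N ->
    coef (t, y') (tn (uw v) x b' : C2) = 0.
  by move=> lt; rewrite coef_low //; apply: leq_trans lt le.
have z1 : coef (t, y') (\sum_(a | a != p') \sum_c
    G a c *: tn (uw (rcons w (p, a))) (c, q) b) = 0.
  by apply: (coef_form0 G) => a c ap; apply: low; apply: mu_col.
have z2 : coef (t, y') (\sum_(k | k != p) \sum_l
    E k l *: ract (lact (uw w) (col_rel k l)) b) = 0.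
  apply: (coef_form0 E) => k l' kp; rewrite col_word coefD low ?mu_corner //.
  by rewrite add0r; apply: (coef_form0 G) => a c ap; apply: low; apply: mu_corner.
have z3 : coef (t, y') (\sum_i \sum_j
    G i j *: ract (lact (uw w) (row_rel i j)) b) = 0.
  apply: coef_sum0 => i _; apply: coef_sum0 => j _.
  rewrite (linearZP (coef_linear _)) row_word coef_sum0 ?scaler0 // => k _.
  by rewrite low // mu_prefix.
have low0 (x c1 c2 c3 : A) : c1 = 0 -> c2 = 0 -> c3 = 0 -> x + c1 + c2 - c3 = x.
  by move=> -> -> ->; rewrite subr0 !addr0.
exact: low0 z1 z2 z3.
Qed.

End Exactness.

(** * Dimension shifting *)

Definition right_linear (K : comNzRingType) (A : algType K) (M N : bimodule A)
    (f : M -> N) := linear f /\ forall x b, f (ract x b) = ract (f x) b.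

(** As a right module, A (x) K[Y] (x) A is free when A is free over K: so this holds
    over a field, by choosing a basis of A. *)
Definition right_lifting (K : comNzRingType) (A : algType K) :=
  forall (Y : choiceType) (D N : bimodule A) (d : D -> N) (g : FreeB A Y -> N),
  bimod_hom d -> right_linear g -> (forall y, exists x, d x = g y) ->
  exists2 s : FreeB A Y -> D, right_linear s & forall y, d (s y) = g y.

(** The words of a normal form serve as the basis of A. *)
Lemma normal_form_right_lifting (K : fieldType) (m n : nat) (p q : 'I_m)
    (p' q' : 'I_n) (A : algType K) (u : 'M[A]_(m, n)) nf :
  normal_form p q p' q' u nf -> right_lifting A.
Proof.
move=> [nfK _] Y D N d g [dL dl dr] [gL gr] gd.
have {}gd w y : exists x, d x == g (ten (word_in u w) y 1).
  by have [x <-] := gd (ten (word_in u w) y 1); exists x.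
pose s w y := xchoose (gd w y).
have sE w y : d (s w y) = g (ten (word_in u w) y 1).
  exact/eqP/(xchooseP (gd w y)).
pose F (a : A) (y : Y) (b : A) : D := ract (malg_lift (s^~ y) (nf a)) b.
have Fl y b : linear (fun a => F a y b).
  by move=> c a a'; rewrite /F linearP linearP ract_linear.
have Fr a y : linear (F a y) by exact: ract_linearr.
have fE a y b : ten_lift F (ten a y b) = F a y b by apply: ten_liftE.
have fL : linear (ten_lift F) by apply: ten_lift_linear.
exists (ten_lift F).
  split=> // x b.
  apply: (free_bimod_ext (f := ten_lift F \o (@ract K A (FreeB A Y))^~ b)
    (h := (@ract K A D)^~ b \o ten_lift F)) => [||a y b'].
  - by move=> c y z; rewrite /= ract_linear fL.
  - by move=> c y z; rewrite /= fL ract_linear.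
  by rewrite /= ract_ten !fE /F ractM.
apply: (free_bimod_ext (f := d \o ten_lift F) (h := g)) => // [|a y b].
  by move=> c x z; rewrite /= fL dL.
rewrite /= fE /F dr.
have -> : ten a y b = ract (ten a y 1 : FreeB A Y) b by rewrite ract_ten mul1r.
rewrite gr; congr (ract _ b).
rewrite -[in RHS](nfK a) /malg_lift (linear_sumP dL) ten_suml.
rewrite (linear_sumP gL); apply: eq_bigr => w _.
by rewrite (linearZP dL) sE tenZl (linearZP gL).
Qed.

(** The bimodule of linear maps A -> M vanishing at 1: the cokernel of M in the
    coinduced bimodule of all linear maps A -> M, through which Ext shifts. *)
Section Cosyzygy.
Variables (K : comNzRingType) (A : algType K) (M : bimodule A).

Definition cosyz_pred : {pred A -> M} := fun f => `[< linear f /\ f 1 = 0 >].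

Fact cosyz_submod_closed : submod_closed cosyz_pred.
Proof.
split=> [|c f g /asboolP[fL f1] /asboolP[gL g1]]; apply/asboolP; split=> //.
- by move=> d x y; rewrite scaler0 addr0.
- move=> d x y; rewrite !fctE fL gL !scalerDr !scalerA mulrC.
  by rewrite addrACA.
by rewrite !fctE f1 g1 scaler0 addr0.
Qed.

HB.instance Definition _ := GRing.isSubmodClosed.Build K (A -> M)
  cosyz_pred cosyz_submod_closed.

Definition cosyz_type : Type := {f : A -> M | f \in cosyz_pred}.
HB.instance Definition _ := SubChoice.on cosyz_type.
HB.instance Definition _ := [SubChoice_isSubZmodule of cosyz_type by <:].
HB.instance Definition _ := [SubZmodule_isSubLmodule of cosyz_type by <:].

Lemma cosyz_linear (f : cosyz_type) : linear (val f).
Proof. by have /asboolP[] := svalP f. Qed.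

Lemma cosyz1 (f : cosyz_type) : val f 1 = 0.
Proof. by have /asboolP[] := svalP f. Qed.

(** A map f represents, modulo the maps x |-> x m, the same class as f(x) - x f(1):
    this normalisation gives the second term. *)
Definition cosyz_lact_fun (a : A) (f : cosyz_type) : A -> M :=
  fun x => val f (x * a) - lact x (val f a).
Definition cosyz_ract_fun (f : cosyz_type) (b : A) : A -> M :=
  fun x => ract (val f x) b.

Fact cosyz_lact_subproof a f : cosyz_lact_fun a f \in cosyz_pred.
Proof.
have fL := cosyz_linear f; apply/asboolP; split=> [c x y|].
  rewrite /cosyz_lact_fun mulrDl -scalerAl fL lact_linearl scalerBr.
  by rewrite opprD addrACA.
by rewrite /cosyz_lact_fun mul1r lact1 subrr.
Qed.

Fact cosyz_ract_subproof f b : cosyz_ract_fun f b \in cosyz_pred.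
Proof.
have fL := cosyz_linear f; apply/asboolP; split=> [c x y|].
  by rewrite /cosyz_ract_fun fL ract_linear.
rewrite /cosyz_ract_fun cosyz1.
by apply: (linear0P (f := (@ract K A M)^~ b)); apply: ract_linear.
Qed.

Definition cosyz_lact a f : cosyz_type :=
  Sub (cosyz_lact_fun a f) (cosyz_lact_subproof a f).
Definition cosyz_ract f b : cosyz_type :=
  Sub (cosyz_ract_fun f b) (cosyz_ract_subproof f b).

Lemma cosyz_lactE a f x : val (cosyz_lact a f) x =
  val f (x * a) - lact x (val f a).
Proof. by []. Qed.

Lemma cosyz_ractE f b x : val (cosyz_ract f b) x = ract (val f x) b.
Proof. by []. Qed.

Lemma cosyz_linE c (f g : cosyz_type) x :
  val (c *: f + g) x = c *: val f x + val g x.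
Proof. by []. Qed.

Lemma cosyzP (f g : cosyz_type) : (forall x, val f x = val g x) -> f = g.
Proof. by move=> fg; apply/val_inj/funext. Qed.

Fact cosyz_lact_linear a : linear (cosyz_lact a).
Proof.
move=> c f g; apply: cosyzP => x.
rewrite !(cosyz_linE, cosyz_lactE) lact_linear scalerBr.
by rewrite opprD addrACA.
Qed.

Fact cosyz_lact_linearl f : linear (cosyz_lact^~ f).
Proof.
have fL := cosyz_linear f; move=> c a b; apply: cosyzP => x.
rewrite !(cosyz_linE, cosyz_lactE) mulrDr -scalerAr !fL lact_linear scalerBr.
by rewrite opprD addrACA.
Qed.

Fact cosyz_lact1 f : cosyz_lact 1 f = f.
Proof.
by apply: cosyzP => x; rewrite cosyz_lactE mulr1 cosyz1 linear0 subr0.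
Qed.

Fact cosyz_lactM a b f : cosyz_lact (a * b) f = cosyz_lact a (cosyz_lact b f).
Proof.
apply: cosyzP => x; rewrite !cosyz_lactE !mulrA linearB lactM /=.
by rewrite opprB addrA subrK.
Qed.

Fact cosyz_ract_linear b : linear (cosyz_ract^~ b).
Proof.
by move=> c f g; apply: cosyzP => x;
   rewrite !(cosyz_linE, cosyz_ractE) ract_linear.
Qed.

Fact cosyz_ract_linearr f : linear (cosyz_ract f).
Proof.
by move=> c f' g; apply: cosyzP => x;
   rewrite !(cosyz_linE, cosyz_ractE) ract_linearr.
Qed.

Fact cosyz_ract1 f : cosyz_ract f 1 = f.
Proof. by apply: cosyzP => x; rewrite cosyz_ractE ract1. Qed.

Fact cosyz_ractM f a b : cosyz_ract f (a * b) = cosyz_ract (cosyz_ract f a) b.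
Proof. by apply: cosyzP => x; rewrite !cosyz_ractE ractM. Qed.

Fact cosyz_lractA a f b :
  cosyz_lact a (cosyz_ract f b) = cosyz_ract (cosyz_lact a f) b.
Proof.
by apply: cosyzP => x; rewrite !(cosyz_lactE, cosyz_ractE) ractBl lractA.
Qed.

Definition cosyz : bimodule A := @Bimodule K A cosyz_type
  cosyz_lact cosyz_ract cosyz_lact_linear cosyz_lact_linearl cosyz_lact1
  cosyz_lactM cosyz_ract_linear cosyz_ract_linearr cosyz_ract1 cosyz_ractM
  cosyz_lractA.

End Cosyzygy.

(** Vanishing of Ext in the degree of [P], for the complex containing [d]. *)
Definition factors (K : comNzRingType) (A : algType K) (P P' : bimodule A)
    (d : P -> P') (M : bimodule A) :=
  forall f : P -> M, bimod_hom f -> (forall x, d x = 0 -> f x = 0) ->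
  exists2 g : P' -> M, bimod_hom g & forall x, f x = g (d x).

Section Shift.
Variables (K : comNzRingType) (A : algType K).

(** A bimodule map to the cosyzygy of M is a right-linear map to M modulo bimodule
    maps: [t] gives zero exactly when it is left linear. The converse direction
    uses a free source. *)
Lemma cosyz_hom_of_right (P M : bimodule A) (t : P -> M) : right_linear t ->
  exists2 F : P -> cosyz M, bimod_hom F &
    forall c y, val (F c) y = t (lact y c) - lact y (t c).
Proof.
move=> [tL tr]; pose F0 c y := t (lact y c) - lact y (t c).
have F0P c : F0 c \in @cosyz_pred K A M.
  apply/asboolP; split=> [k x y|]; rewrite /F0; last by rewrite !lact1 subrr.
  rewrite lact_linearl tL lact_linearl scalerBr.
  by rewrite opprD addrACA.
exists (fun c => Sub (F0 c) (F0P c) : cosyz M) => //.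
split=> [k x y|a c|c a]; apply: cosyzP => z.
- rewrite cosyz_linE /= /F0 lact_linear tL tL lact_linear scalerBr.
  by rewrite opprD addrACA.
- rewrite cosyz_lactE /= /F0 linearB /= !lactM.
  by rewrite opprB addrA subrK.
by rewrite cosyz_ractE /= /F0 lractA !tr lractA ractBl.
Qed.

Lemma right_of_cosyz_hom (Y : choiceType) (M : bimodule A)
    (f : FreeB A Y -> cosyz M) : bimod_hom f ->
  exists2 t : FreeB A Y -> M, right_linear t &
    forall c y, val (f c) y = t (lact y c) - lact y (t c).
Proof.
move=> [fL fl fr].
pose F (a : A) (y : Y) (b : A) : M := ract (val (f (ten 1 y 1)) a) b.
have Fl y b : linear (fun a => F a y b).
  by move=> c a a'; rewrite /F cosyz_linear ract_linear.
have Fr a y : linear (F a y) by exact: ract_linearr.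
have tE a y b : ten_lift F (ten a y b) = F a y b by apply: ten_liftE.
have tL : linear (ten_lift F) by apply: ten_lift_linear.
exists (ten_lift F).
  split=> // x b.
  apply: (free_bimod_ext (f := ten_lift F \o (@ract K A (FreeB A Y))^~ b)
    (h := (@ract K A M)^~ b \o ten_lift F)) => [||a y b'].
  - by move=> c y z; rewrite /= ract_linear tL.
  - by move=> c y z; rewrite /= tL ract_linear.
  by rewrite /= ract_ten !tE /F ractM.
move=> c y; move: c.
apply: (free_bimod_ext (f := fun c : FreeB A Y => val (f c) y)
  (h := fun c : FreeB A Y => ten_lift F (lact y c) - lact y (ten_lift F c)))
  => [||a z b].
- by move=> k c c'; rewrite fL cosyz_linE.
- move=> k c c'; rewrite lact_linear !tL lact_linear scalerBr.
  by rewrite opprD addrACA.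
have -> : ten a z b = ract (lact a (ten 1 z 1 : FreeB A Y)) b.
  by rewrite lact_ten ract_ten mul1r mulr1.
rewrite fr fl lact_ten ract_ten lact_ten mulr1 mul1r !tE /F.
by rewrite lractA -ractBl.
Qed.

(** A map f to the cosyzygy that kills ker d' comes from a right-linear t0, which is a
    bimodule map on the image of [d]; there it agrees with some bimodule map g,
    so t0 - g represents f and kills ker d', and descends along the splitting
    [s]. *)
Lemma factors_shift (P2 P0 : bimodule A) (Y : choiceType)
    (d : P2 -> FreeB A Y) (d' : FreeB A Y -> P0) (s : P0 -> FreeB A Y)
    (M : bimodule A) :
  bimod_hom d -> bimod_hom d' -> right_linear s ->
  (forall x, d' x = 0 <-> exists z, d z = x) ->
  (forall x, d' (s (d' x)) = d' x) ->
  factors d M -> factors d' (cosyz M).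
Proof.
move=> [dL dl dr] [d'L d'l d'r] [sL sr] ex sp fac f fH f0.
have [t0 [t0L t0r] ft0] := right_of_cosyz_hom fH.
have t0d y z : t0 (lact y (d z)) = lact y (t0 (d z)).
  apply/eqP; rewrite -subr_eq0 -ft0 f0 //.
  by apply/ex; exists z.
have [g [gL gl gr] gE] : exists2 g : FreeB A Y -> M, bimod_hom g &
    forall z, t0 (d z) = g (d z).
  apply: fac => [|z ->]; last exact: linear0P.
  split=> [|a z|z a]; first exact: linear_comp.
    by rewrite dl t0d.
  by rewrite dr t0r.
pose t x := t0 x - g x.
have tL : linear t.
  by move=> c x y; rewrite /t t0L gL scalerBr opprD addrACA.
have t0d' x : d' x = 0 -> t x = 0.
  by move=> /ex[z <-]; rewrite /t gE subrr.
have td' x : t (s (d' x)) = t x.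
  apply/eqP; rewrite -subr_eq0 -(linearBP tL) t0d' //.
  by rewrite (linearBP d'L) sp subrr.
have [F FH FE] : exists2 F : P0 -> cosyz M, bimod_hom F &
    forall c y, val (F c) y = t (s (lact y c)) - lact y (t (s c)).
  apply: cosyz_hom_of_right; split; first exact: (linear_comp tL sL).
  by move=> x b; rewrite sr /t t0r gr ractBl.
exists F => // x; apply: cosyzP => y; rewrite FE -d'l !td' ft0 /t gl linearB /=.
by rewrite opprB addrA subrK.
Qed.

End Shift.

Section FreeResolution.
Variables (K : fieldType) (A : algType K) (X1 X2 X3 : choiceType).
Local Notation C0 := (FreeB A unit).
Local Notation C1 := (FreeB A X1).
Local Notation C2 := (FreeB A X2).
Local Notation C3 := (FreeB A X3).
Local Notation aug := (@aug K A).
Variables (d0 : C1 -> C0) (d1 : C2 -> C1) (d2 : C3 -> C2).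
Hypotheses (d0P : bimod_hom d0) (d1P : bimod_hom d1) (d2P : bimod_hom d2).
Hypotheses (ex0 : forall x, aug x = 0 <-> exists z, d0 z = x)
           (ex1 : forall x, d0 x = 0 <-> exists z, d1 z = x)
           (ex2 : forall x, d1 x = 0 <-> exists z, d2 z = x)
           (ex3 : forall x, d2 x = 0 -> x = 0).
Hypothesis lift : right_lifting A.

Lemma right_linearB (M N : bimodule A) (f g : M -> N) :
  right_linear f -> right_linear g -> right_linear (fun x => f x - g x).
Proof.
move=> [fL fr] [gL gr]; split=> [c x y|x b].
  by rewrite fL gL scalerBr opprD addrACA.
by rewrite fr gr ractBl.
Qed.

Lemma right_linear_comp (M N P : bimodule A) (f : N -> P) (g : M -> N) :
  right_linear f -> right_linear g -> right_linear (f \o g).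
Proof.
by move=> [fL fr] [gL gr]; split=> [c x y|x b] /=; rewrite ?gL ?fL ?gr ?fr.
Qed.

Lemma bimod_hom_right (M N : bimodule A) (f : M -> N) :
  bimod_hom f -> right_linear f.
Proof. by move=> [fL _ fr]. Qed.

Let id_right (M : bimodule A) : right_linear (@id M). Proof. by split. Qed.

(** One step of a right-linear contraction: [s'] contracts up to the previous
    degree, and freeness provides [s] in the next one. *)
Lemma contraction_step (Y : choiceType) (P D : bimodule A)
    (d : D -> FreeB A Y) (d' : FreeB A Y -> P) (s' : P -> FreeB A Y) :
  bimod_hom d -> bimod_hom d' -> right_linear s' ->
  (forall x, d' x = 0 <-> exists z, d z = x) ->
  (forall x, d' (s' (d' x)) = d' x) ->
  exists2 s : FreeB A Y -> D, right_linear s & forall x, d (s (d x)) = d x.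
Proof.
move=> dP d'P s'r ex sp; have [d'L _ _] := d'P; have [dL _ _] := dP.
have [s sr sE] : exists2 s : FreeB A Y -> D, right_linear s &
    forall y, d (s y) = y - s' (d' y).
  apply: lift => // [|y].
    apply: right_linearB; first exact: id_right.
    exact: (right_linear_comp s'r (bimod_hom_right d'P)).
  by apply/ex; rewrite (linearBP d'L) sp subrr.
exists s => // x; rewrite sE; have -> : d' (d x) = 0 by apply/ex; exists x.
by have [s'L _] := s'r; rewrite (linear0P s'L) subr0.
Qed.

Let unit_section (a : regular_bimodule A) : C0 := ten 1 tt (a : A).

(** Beyond the end of the resolution there is nothing to factor, and three shifts
    bring this down to [d0]. *)
Lemma factors_d0 (M : bimodule A) : factors d0 (cosyz (cosyz (cosyz M))).
Proof.
have sr : right_linear unit_section.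
  by split=> [|x b]; [apply: ten_linearr | rewrite /unit_section ract_ten].
have sp x : aug (unit_section (aug x)) = aug x.
  by rewrite /unit_section augE mul1r.
have [s0 s0r s0p] := contraction_step d0P (augP A) sr ex0 sp.
have [s1 s1r s1p] := contraction_step d1P d0P s0r ex1 s0p.
have [s2 s2r s2p] := contraction_step d2P d1P s1r ex2 s1p.
apply: (factors_shift d1P d0P s0r ex1 s0p).
apply: (factors_shift d2P d1P s1r ex2 s1p).
have zP : bimod_hom (fun _ : C3 => 0 : C3) by apply: zero_hom.
apply: (factors_shift zP d2P s2r _ s2p) => [x|f fP f0].
  have [d2L _ _] := d2P.
  by split=> [/ex3->|[_ <-]]; [exists 0 | apply: linear0P].
by exists (fun=> 0); [apply: zero_hom | move=> x; apply: f0].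
Qed.

(** Derivations are inner when bimodule maps factor through [d0]: a derivation D
    defines the map a (x) b |-> D(a) b, which is a bimodule map on ker aug. *)
Lemma derivation_inner (N : bimodule A) (D : A -> N) : factors d0 N ->
  linear D -> (forall a b, D (a * b) = lact a (D b) + ract (D a) b) ->
  exists n, forall a, D a = lact a n - ract n a.
Proof.
move=> fac DL Dder.
pose F (a : A) (_ : unit) (b : A) : N := ract (D a) b.
have Fl y b : linear (fun a => F a y b).
  by move=> c a a'; rewrite /F DL ract_linear.
have Fr a y : linear (F a y) by exact: ract_linearr.
have tE a y b : ten_lift F (ten a y b) = F a y b by apply: ten_liftE.
have tL : linear (ten_lift F) by apply: ten_lift_linear.
have tr (x : C0) b : ten_lift F (ract x b) = ract (ten_lift F x) b.
  apply: (free_bimod_ext (f := ten_lift F \o (@ract K A C0)^~ b)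
    (h := (@ract K A N)^~ b \o ten_lift F)) => [||a y b'].
  - by move=> c y z; rewrite /= ract_linear tL.
  - by move=> c y z; rewrite /= tL ract_linear.
  by rewrite /= ract_ten !tE /F ractM.
have tl a (x : C0) : ten_lift F (lact a x) =
    lact a (ten_lift F x) + ract (D a) (aug x).
  have [aL _ _] := augP A.
  move: x; apply: (free_bimod_ext (f := fun x : C0 => ten_lift F (lact a x))
    (h := fun x : C0 => lact a (ten_lift F x) + ract (D a) (aug x)))
    => [||a' y b].
  - by move=> c y z; rewrite lact_linear tL.
  - move=> c y z; rewrite tL lact_linear aL ract_linearr scalerDr.
    by rewrite addrACA.
  by rewrite lact_ten !tE /F augE Dder ractDl -lractA -ractM.
have [d0L d0l d0r] := d0P.
have [g [gL gl gr] gE] : exists2 g : C0 -> N, bimod_hom g &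
    forall x, ten_lift F (d0 x) = g (d0 x).
  apply: fac => [|x ->]; last exact: linear0P.
  split=> [c x y|a x|x b]; first by rewrite d0L tL.
    rewrite d0l tl; have -> : aug (d0 x) = 0 by apply/ex0; exists x.
    by rewrite (linear0P (ract_linearr (D a))) addr0.
  by rewrite d0r tr.
exists (g (ten 1 tt 1)) => a.
have D1 : D 1 = 0.
  have := Dder 1 1; rewrite mulr1 lact1 ract1 => e.
  by apply: (addrI (D 1)); rewrite -e addr0.
have [z ze] : exists z, d0 z = ten a tt 1 - ten 1 tt a :> C0.
  apply/ex0; have [aL _ _] := augP A.
  by rewrite (linearBP aL) !augE mulr1 mul1r subrr.
have := gE z; rewrite ze (linearBP tL) (linearBP gL) !tE /F ract1 D1.
have -> : ract (0 : N) a = 0.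
  by apply: (linear0P (f := (@ract K A N)^~ a)); apply: ract_linear.
rewrite subr0 => ->; rewrite -gl -gr lact_ten ract_ten mulr1 mul1r.
by [].
Qed.

End FreeResolution.

(** * Hochschild cohomology and homology *)

Section TupleCons.
Variables (K : comNzRingType) (A : algType K).

Definition tcons k (x : A) (a : {ffun 'I_k -> A}) : {ffun 'I_k.+1 -> A} :=
  [ffun j => if unlift ord0 j is Some i then a i else x].

Lemma tcons0 k x (a : {ffun 'I_k -> A}) : tcons x a ord0 = x.
Proof. by rewrite ffunE unlift_none. Qed.

Lemma tconsS k x (a : {ffun 'I_k -> A}) i : tcons x a (lift ord0 i) = a i.
Proof. by rewrite ffunE liftK. Qed.

Lemma tup_beheadK k x (a : {ffun 'I_k -> A}) : tup_behead (tcons x a) = a.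
Proof. by apply/ffunP => j; rewrite ffunE tconsS. Qed.

Lemma tcons_eta k (a : {ffun 'I_k.+1 -> A}) :
  tcons (a ord0) (tup_behead a) = a.
Proof.
apply/ffunP => j; rewrite ffunE; case: unliftP => [i|] -> //.
by rewrite ffunE.
Qed.

Lemma upd_tcons0 k x (a : {ffun 'I_k -> A}) y :
  upd (tcons x a) ord0 y = tcons y a.
Proof.
apply/ffunP => j; rewrite ffunE; case: (unliftP ord0 j) => [i|] ->.
  by rewrite !tconsS.
by rewrite eqxx tcons0.
Qed.

Lemma tcons_upd k x (a : {ffun 'I_k -> A}) i y :
  tcons x (upd a i y) = upd (tcons x a) (lift ord0 i) y.
Proof.
apply/ffunP => j; rewrite [RHS]ffunE; case: (unliftP ord0 j) => [l|] ->.
  by rewrite !tconsS ffunE (inj_eq lift_inj).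
by rewrite !tcons0.
Qed.

Lemma tup_merge_tcons0 k x (a : {ffun 'I_k.+1 -> A}) :
  tup_merge (tcons x a) ord0 = tcons (x * a ord0) (tup_behead a).
Proof.
apply/ffunP => j; rewrite ffunE ltn0.
case: (unliftP ord0 j) => [i|] -> /=; last first.
  rewrite ?eqxx tcons0 tconsS; congr (_ * _).
  by rewrite (_ : widen_ord _ _ = ord0) ?tcons0 //; apply: val_inj.
by rewrite !tconsS ffunE.
Qed.

Lemma tup_merge_tconsS k x (a : {ffun 'I_k.+1 -> A}) (i : 'I_k) :
  tup_merge (tcons x a) (lift ord0 i) = tcons x (tup_merge a i).
Proof.
apply/ffunP => j; case: (unliftP ord0 j) => [l|] ->; last first.
  rewrite tcons0 ffunE /= (_ : widen_ord _ _ = ord0) ?tcons0 //.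
  exact: val_inj.
rewrite tconsS !ffunE /= ltnS (inj_eq lift_inj) !liftK.
have -> : widen_ord (leqnSn k.+1) (lift ord0 l) =
  lift ord0 (widen_ord (leqnSn k) l) by apply: val_inj.
by rewrite liftK.
Qed.

Lemma tup_belast_tcons k x (a : {ffun 'I_k.+1 -> A}) :
  tup_belast (tcons x a) = tcons x (tup_belast a).
Proof.
apply/ffunP => j; rewrite ffunE; case: (unliftP ord0 j) => [l|] ->; last first.
  by rewrite tcons0 (_ : widen_ord _ _ = ord0) ?tcons0 //; apply: val_inj.
have -> : widen_ord (leqnSn k.+1) (lift ord0 l) =
  lift ord0 (widen_ord (leqnSn k) l) by apply: val_inj.
by rewrite !tconsS ffunE.
Qed.

Lemma tcons_max k x (a : {ffun 'I_k.+1 -> A}) :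
  tcons x a ord_max = a ord_max.
Proof.
have -> : ord_max = lift ord0 ord_max :> 'I_k.+2 by apply: val_inj.
exact: tconsS.
Qed.

End TupleCons.

Section CochainShift.
Variables (K : comNzRingType) (A : algType K).

(** The part of the coboundary at (x, a) in which x stays alone in the first slot;
    it is common to the coboundary of f and to that of f(x, -). *)
Definition cochain_rest (M : bimodule A) k (f : {ffun 'I_k.+1 -> A} -> M)
    (x : A) (a : {ffun 'I_k.+1 -> A}) : M :=
  \sum_(i < k) (-1) ^+ i.+1 *: f (tcons x (tup_merge a i)) +
  (-1) ^+ k.+1 *: ract (f (tcons x (tup_belast a))) (a ord_max).

Lemma hoch_d_tcons (M : bimodule A) k (f : {ffun 'I_k.+1 -> A} -> M) x a :
  hoch_d_fun f (tcons x a) =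
  lact x (f a) - f (tcons (x * a ord0) (tup_behead a)) - cochain_rest f x a.
Proof.
rewrite /hoch_d_fun tcons0 tup_beheadK big_ord_recl tup_merge_tcons0.
rewrite tup_belast_tcons tcons_max expr1 scaleN1r /cochain_rest opprD !addrA.
congr (_ + _ + _); last by rewrite exprS mulN1r scaleNr.
rewrite -sumrN; apply: eq_bigr => i _.
by rewrite tup_merge_tconsS exprS mulN1r scaleNr.
Qed.

Lemma hoch_d_rest (M : bimodule A) k (f : {ffun 'I_k.+1 -> A} -> M) x a :
  hoch_d_fun (fun b => f (tcons x b)) a =
  lact (a ord0) (f (tcons x (tup_behead a))) + cochain_rest f x a.
Proof. by rewrite /hoch_d_fun /cochain_rest addrA. Qed.

Lemma hoch_d_funB (M : bimodule A) k (f g : {ffun 'I_k -> A} -> M) a :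
  hoch_d_fun (fun b => f b - g b) a = hoch_d_fun f a - hoch_d_fun g a.
Proof.
rewrite /hoch_d_fun linearB ractBl scalerBr !opprD [RHS]addrACA; congr (_ + _).
rewrite [RHS]addrACA -sumrB; congr (_ + _).
by apply: eq_bigr => i _; rewrite -scalerBr.
Qed.

(** H^(k+1)(A, M) = 0. *)
Definition coboundaries (M : bimodule A) k :=
  forall f : {ffun 'I_k.+1 -> A} -> M, multilinear f ->
  (forall a, hoch_d_fun f a = 0) ->
  exists2 g : {ffun 'I_k -> A} -> M, multilinear g &
    forall a, hoch_d_fun g a = f a.

Lemma multilinear_tcons (M : bimodule A) k (f : {ffun 'I_k.+1 -> A} -> M) :
  multilinear f ->
  (forall a, linear (fun x => f (tcons x a))) /\
  (forall x, multilinear (fun a => f (tcons x a))).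
Proof.
move=> fl; split=> [a c x y|x a p c y z].
  by rewrite -(upd_tcons0 0 a (c *: x + y)) fl !upd_tcons0.
by rewrite !tcons_upd fl.
Qed.

(** The class of a cocycle f is determined by a |-> (x |-> f(x, a) - x f(1, a)),
    a cocycle with values in the cosyzygy. *)
Lemma coboundaries_shift (M : bimodule A) k :
  coboundaries (cosyz M) k -> coboundaries M k.+1.
Proof.
move=> cob f fl fd; have [fx fa] := multilinear_tcons fl.
pose g0 (a : {ffun 'I_k.+1 -> A}) (x : A) : M :=
  f (tcons x a) - lact x (f (tcons 1 a)).
have g0P a : g0 a \in @cosyz_pred K A M.
  apply/asboolP; split=> [c x y|]; rewrite /g0; last by rewrite lact1 subrr.
  by rewrite fx lact_linearl scalerBr opprD addrACA.
pose g a : cosyz M := Sub (g0 a) (g0P a).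
have gE a x : val (g a) x = f (tcons x a) - lact x (f (tcons 1 a)) by [].
have lactZr y c (z : M) : lact y (c *: z) = c *: lact y z.
  exact: (linearZP (lact_linear y)).
have restE x a : cochain_rest f x a =
    lact x (f a) - f (tcons (x * a ord0) (tup_behead a)).
  have /eqP := fd (tcons x a); rewrite hoch_d_tcons subr_eq0.
  by move=> /eqP.
have rest1 a : cochain_rest f 1 a = 0.
  by rewrite restE lact1 mul1r tcons_eta subrr.
have valD (h h' : cosyz M) x : val (h + h') x = val h x + val h' x by [].
have val_sum I (r : seq I) (P : pred I) (F : I -> cosyz M) x :
    val (\sum_(i <- r | P i) F i) x = \sum_(i <- r | P i) val (F i) x.
  by elim/big_rec2: _ => // i y z _ <-.
have val_d j (h : {ffun 'I_j -> A} -> cosyz M) a x :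
    val (hoch_d_fun h a) x =
    val (lact (a ord0) (h (tup_behead a))) x +
    (\sum_(i < j) (-1) ^+ i.+1 *: val (h (tup_merge a i)) x +
     (-1) ^+ j.+1 *: ract (val (h (tup_belast a)) x) (a ord_max)).
  by rewrite /hoch_d_fun !valD val_sum addrA; congr (_ + _ + _).
have [g' g'l g'd] : exists2 g' : {ffun 'I_k -> A} -> cosyz M, multilinear g' &
    forall a, hoch_d_fun g' a = g a.
  apply: cob => [a p c y z|a].
    apply: cosyzP => x; rewrite cosyz_linE !gE fa fa lact_linear scalerBr.
    by rewrite opprD addrACA.
  apply: cosyzP => x; rewrite val_d cosyz_lactE !gE.
  have -> : \sum_(i < k.+1) (-1) ^+ i.+1 *: val (g (tup_merge a i)) x +
      (-1) ^+ k.+2 *: ract (val (g (tup_belast a)) x) (a ord_max) =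
      cochain_rest f x a - lact x (cochain_rest f 1 a).
    rewrite /cochain_rest linearD linear_sum opprD addrACA -sumrB.
    congr (_ + _).
      by apply: eq_bigr => i _; rewrite gE scalerBr /= lactZr.
    by rewrite gE ractBl scalerBr /= lactZr lractA.
  rewrite rest1 linear0 subr0 restE tcons_eta lactM.
  by rewrite linearB /= opprB !addrA subrK subrK subrr.
pose f' (a : {ffun 'I_k.+1 -> A}) : M :=
  f (tcons 1 a) - val (g' (tup_behead a)) (a ord0).
exists f' => [a p c y z|a].
  rewrite /f' fa; case: (first_slotP p) => [|i].
    by rewrite !behead_upd0 !upd_same cosyz_linear scalerBr opprD addrACA.
  rewrite !behead_upd !upd_neq // g'l cosyz_linE.
  by rewrite scalerBr opprD addrACA.
rewrite /f' hoch_d_funB hoch_d_rest rest1 addr0.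
rewrite -[a in X in _ - X]tcons_eta hoch_d_tcons.
set x := a ord0; set b := tup_behead a.
have rE : cochain_rest (fun c => val (g' (tup_behead c)) (c ord0)) x b =
    val (hoch_d_fun g' b) x - val (lact (b ord0) (g' (tup_behead b))) x.
  rewrite val_d addrC addKr /cochain_rest; congr (_ + _).
    by apply: eq_bigr => i _; rewrite tup_beheadK tcons0.
  by rewrite tup_beheadK tcons0.
rewrite rE g'd gE tup_beheadK tcons0 cosyz_lactE -(tcons_eta a) -/x -/b.
have alg (L P Q F : M) : L - (P - Q - (F - L - (Q - P))) = F.
  rewrite (opprB Q P); move: (P - Q) => D.
  have -> : D - (F - L + D) = - (F - L) by rewrite opprD addrCA subrr addr0.
  by rewrite opprK addrCA subrr addr0.
exact: alg.
Qed.

(** A 1-cocycle is a derivation, and a 1-coboundary an inner derivation. *)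
Lemma coboundaries0 (N : bimodule A) :
  (forall D : A -> N, linear D ->
    (forall a b, D (a * b) = lact a (D b) + ract (D a) b) ->
    exists n, forall a, D a = lact a n - ract n a) ->
  coboundaries N 0.
Proof.
move=> inner f fl fd; pose e : {ffun 'I_0 -> A} := [ffun=> 0].
have eE (a : {ffun 'I_0 -> A}) : a = e by apply/ffunP => -[].
have [fx _] := multilinear_tcons fl.
have der x y : f (tcons (x * y) e) = lact x (f (tcons y e)) + ract (f (tcons x e)) y.
  have := fd (tcons x (tcons y e)).
  rewrite hoch_d_tcons /cochain_rest big_ord0 add0r expr1 scaleN1r opprK.
  rewrite tcons0 tup_beheadK (eE (tup_belast _)).
  have -> : tcons y e ord_max = y by rewrite (_ : ord_max = ord0) ?tcons0 //;
    apply: val_inj.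
  move=> d; apply/eqP; rewrite eq_sym -subr_eq0 -d.
  by rewrite -!addrA [- _ + _]addrC.
have [n nE] := inner (fun x => f (tcons x e)) (fx e) der.
exists (fun=> n) => [a [] //|a].
rewrite -(tcons_eta a) /hoch_d_fun big_ord0 addr0 expr1 scaleN1r (eE (tup_behead a)).
rewrite nE tcons0; congr (_ - ract _ _).
by rewrite (_ : ord_max = ord0) ?tcons0 //; apply: val_inj.
Qed.

End CochainShift.

Lemma homology_eq0 (U V W : zmodType) (f : {additive U -> V})
    (g : {additive V -> W}) : (forall v, g v = 0 -> exists y, f y = v) ->
  forall x : homology f g, x = 0.
Proof.
move=> fg x; rewrite -[x]reprK -[RHS](raddf0 (\pi_(homology f g))).
apply/eqP; rewrite -Quotient.idealrBE subr0; apply/asboolP; apply: fg.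
by apply/eqP; exact: (valP (repr x)).
Qed.

Section CohomologyVanishing.
Variables (K : comNzRingType) (A : algType K).

Lemma hoch_cohomology_eq0 (M : bimodule A) k : coboundaries M k ->
  forall x : hoch_cohomology M k.+1, x = 0.
Proof.
move=> cob; apply: homology_eq0 => f fd.
have [||g gl gf] := cob (val f).
- by have /asboolP := svalP f.
- move=> a; have /(congr1 (fun h => val h a)) := fd.
  by [].
have gP : g \in @multilinear_pred K A M k by apply/asboolP.
by exists (Sub g gP); apply/val_inj/funext => a; rewrite /= gf.
Qed.

Lemma coboundaries_ge k0 : (forall M : bimodule A, coboundaries M k0) ->
  forall (M : bimodule A) k, (k0 <= k)%N -> coboundaries M k.
Proof.
move=> cob M k /subnKC <-; elim: (k - k0)%N M => [|j IH] M.
  by rewrite addn0.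
by rewrite addnS; apply/coboundaries_shift/IH.
Qed.

End CohomologyVanishing.

(** The bimodule of K-linear maps from M to V: Hochschild cochains with values in
    it are the linear maps from the Hochschild chains of M to V. *)
Section HomBimodule.
Variables (K : comNzRingType) (A : algType K) (M : bimodule A) (V : lmodType K).

Definition lhom_pred : {pred M -> V} := fun f => `[< linear f >].

Fact lhom_submod_closed : submod_closed lhom_pred.
Proof.
split=> [|c f g /asboolP fL /asboolP gL]; apply/asboolP => d x y.
  by rewrite scaler0 addr0.
by rewrite !fctE fL gL !scalerDr !scalerA mulrC addrACA.
Qed.

HB.instance Definition _ := GRing.isSubmodClosed.Build K (M -> V)
  lhom_pred lhom_submod_closed.

Definition lhom_type : Type := {f : M -> V | f \in lhom_pred}.
HB.instance Definition _ := SubChoice.on lhom_type.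
HB.instance Definition _ := [SubChoice_isSubZmodule of lhom_type by <:].
HB.instance Definition _ := [SubZmodule_isSubLmodule of lhom_type by <:].

Lemma lhom_linear (f : lhom_type) : linear (val f).
Proof. by have /asboolP := svalP f. Qed.

Fact lhom_lact_subproof a (f : lhom_type) :
  (fun x => val f (ract x a)) \in lhom_pred.
Proof. by apply/asboolP => c x y; rewrite ract_linear lhom_linear. Qed.

Fact lhom_ract_subproof a (f : lhom_type) :
  (fun x => val f (lact a x)) \in lhom_pred.
Proof. by apply/asboolP => c x y; rewrite lact_linear lhom_linear. Qed.

Definition lhom_lact a (f : lhom_type) : lhom_type :=
  Sub (fun x => val f (ract x a)) (lhom_lact_subproof a f).
Definition lhom_ract (f : lhom_type) a : lhom_type :=
  Sub (fun x => val f (lact a x)) (lhom_ract_subproof a f).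

Lemma lhom_lactE a f x : val (lhom_lact a f) x = val f (ract x a).
Proof. by []. Qed.

Lemma lhom_ractE a f x : val (lhom_ract f a) x = val f (lact a x).
Proof. by []. Qed.

Lemma lhom_linE c (f g : lhom_type) x :
  val (c *: f + g) x = c *: val f x + val g x.
Proof. by []. Qed.

Lemma lhomP (f g : lhom_type) : (forall x, val f x = val g x) -> f = g.
Proof. by move=> fg; apply/val_inj/funext. Qed.

Let lhomE := (lhom_lactE, lhom_ractE, lhom_linE).

Fact lhom_lact_linear a : linear (lhom_lact a).
Proof. by move=> c f g; apply: lhomP => x; rewrite !lhomE. Qed.
Fact lhom_lact_linearl f : linear (lhom_lact^~ f).
Proof.
by move=> c a b; apply: lhomP => x; rewrite !lhomE ract_linearr lhom_linear.
Qed.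
Fact lhom_lact1 f : lhom_lact 1 f = f.
Proof. by apply: lhomP => x; rewrite !lhomE ract1. Qed.
Fact lhom_lactM a b f : lhom_lact (a * b) f = lhom_lact a (lhom_lact b f).
Proof. by apply: lhomP => x; rewrite !lhomE ractM. Qed.
Fact lhom_ract_linear a : linear (lhom_ract^~ a).
Proof. by move=> c f g; apply: lhomP => x; rewrite !lhomE. Qed.
Fact lhom_ract_linearr f : linear (lhom_ract f).
Proof.
by move=> c a b; apply: lhomP => x; rewrite !lhomE lact_linearl lhom_linear.
Qed.
Fact lhom_ract1 f : lhom_ract f 1 = f.
Proof. by apply: lhomP => x; rewrite !lhomE lact1. Qed.
Fact lhom_ractM f a b : lhom_ract f (a * b) = lhom_ract (lhom_ract f a) b.
Proof. by apply: lhomP => x; rewrite !lhomE lactM. Qed.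
Fact lhom_lractA a f b :
  lhom_lact a (lhom_ract f b) = lhom_ract (lhom_lact a f) b.
Proof. by apply: lhomP => x; rewrite !lhomE lractA. Qed.

Definition lhom : bimodule A := @Bimodule K A lhom_type
  lhom_lact lhom_ract lhom_lact_linear lhom_lact_linearl lhom_lact1
  lhom_lactM lhom_ract_linear lhom_ract_linearr lhom_ract1 lhom_ractM
  lhom_lractA.

End HomBimodule.

Section HomologyVanishing.
Variables (K : comNzRingType) (A : algType K) (M : bimodule A) (k : nat).

Local Notation F l := {malg K[(M * {ffun 'I_l -> A})%type]}.

Lemma hoch_b_freeE l m (a : {ffun 'I_l.+1 -> A}) :
  hoch_b_free (pure_tensor m a) = @hoch_b_gen K A M l (m, a).
Proof. exact: malg_liftU. Qed.

Lemma linear_hoch_b l (V : lmodType K) (h : F l -> V) m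
    (a : {ffun 'I_l.+1 -> A}) : linear h ->
  h (hoch_b_free (pure_tensor m a)) =
  h (pure_tensor (ract m (a ord0)) (tup_behead a)) +
  \sum_(i < l) (-1) ^+ i.+1 *: h (pure_tensor m (tup_merge a i)) +
  (-1) ^+ l.+1 *: h (pure_tensor (lact (a ord_max) m) (tup_belast a)).
Proof.
move=> hL; rewrite hoch_b_freeE; apply: etrans (linearDP hL _ _) _.
congr (_ + _); last exact: linearZP.
apply: etrans (linearDP hL _ _) _; congr (_ + _).
apply: etrans (linear_sumP hL _ _ _) _; apply: eq_bigr => i _; exact: linearZP.
Qed.

(** A linear function on chains that vanishes on boundaries is a cocycle with
    values in Hom(M, V); a primitive of it factors it through the boundary. *)
Lemma chain_primitive (V : lmodType K) (pi : F k.+1 -> V) :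
  coboundaries (lhom M V) k -> linear pi ->
  (forall x, tensor_rel x -> pi x = 0) ->
  (forall y, pi (hoch_b_free y) = 0) ->
  exists gamma : F k -> V, [/\ linear gamma,
    forall x, tensor_rel x -> gamma x = 0 &
    forall x, gamma (hoch_b_free x) = pi x].
Proof.
move=> cob piL pi_rel pi_b.
have mod_lin (l : nat) (W : lmodType K) (h : F l -> W) c u v w : linear h ->
    h (u - (c *: v + w)) = 0 -> h u = c *: h v + h w.
  move=> hL; rewrite (linearBP hL) (linearDP hL) (linearZP hL).
  by move=> /eqP; rewrite subr_eq0 => /eqP.
have lin_mod (l : nat) (W : lmodType K) (h : F l -> W) c u v w : linear h ->
    h u = c *: h v + h w -> h (u - (c *: v + w)) = 0.
  by move=> hL e; rewrite (linearBP hL) (linearDP hL) (linearZP hL) e subrr.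
have fP (a : {ffun 'I_k.+1 -> A}) :
    (fun m => pi (pure_tensor m a)) \in @lhom_pred K A M V.
  apply/asboolP => c m1 m2; apply: mod_lin => //.
  exact/pi_rel/Tensor_rel_mod.
pose f a : lhom M V :=
  (Sub (fun m : M => pi (pure_tensor m a)) (fP a) : lhom_type M V).
have fE a m : val (f a) m = pi (pure_tensor m a) by [].
have valD (h h' : lhom M V) x : val (h + h') x = val h x + val h' x by [].
have val_sum I (r : seq I) (P : pred I) (H : I -> lhom M V) x :
    val (\sum_(i <- r | P i) H i) x = \sum_(i <- r | P i) val (H i) x.
  by elim/big_rec2: _ => // i y z' _ <-.
have val_d j (h : {ffun 'I_j -> A} -> lhom M V) a m :
    val (hoch_d_fun h a) m = val (h (tup_behead a)) (ract m (a ord0)) +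
    \sum_(i < j) (-1) ^+ i.+1 *: val (h (tup_merge a i)) m +
    (-1) ^+ j.+1 *: val (h (tup_belast a)) (lact (a ord_max) m).
  by rewrite /hoch_d_fun !valD val_sum; congr (_ + _ + _).
have [||g gl gf] := cob f.
- move=> a p c x y; apply: lhomP => m; rewrite lhom_linE !fE.
  by apply: mod_lin => //; apply/pi_rel/Tensor_rel_arg.
- move=> a; apply: lhomP => m; rewrite val_d -[RHS](pi_b (pure_tensor m a)).
  by rewrite linear_hoch_b.
pose gamma : F k -> V :=
  malg_lift (fun ma : M * {ffun 'I_k -> A} => val (g ma.2) ma.1).
have gammaE m a : gamma (pure_tensor m a) = val (g a) m by apply: malg_liftU.
have gammaL : linear gamma by move=> c x y; rewrite /gamma linearP.
clearbody gamma; exists gamma; split=> // x.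
  case=> [c m1 m2 a|c m a p x' y']; apply: lin_mod => //;
    apply: etrans (gammaE _ _) _; rewrite ?lhom_linear ?gl ?lhom_linE;
    by congr (_ *: _ + _); rewrite gammaE.
apply: (malg_ext (f := gamma \o @hoch_b_free K A M k) (h := pi)) => //.
  by move=> c u v; rewrite /= linearP gammaL.
move=> [m a]; rewrite [LHS](linear_hoch_b m a gammaL) -[RHS](fE a m) -gf val_d.
by rewrite !gammaE; congr (_ + _ + _); apply: eq_bigr => i _; rewrite gammaE.
Qed.

Inductive boundary_rel (x : F k.+1) : Prop :=
| Boundary_rel_tensor : tensor_rel x -> boundary_rel x
| Boundary_rel_b y : x = hoch_b_free y -> boundary_rel x.

Lemma boundary_spanE x : x \in lin_span boundary_rel ->
  exists y, x - hoch_b_free y \in @tensor_null K A M k.+1.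
Proof.
move=> /asboolP[s sS ->]; elim: s sS => [|t s IH] sS.
  by exists 0; rewrite big_nil linear0 subr0 rpred0.
have [|y yE] := IH _; first by move=> r rs; apply: sS; rewrite inE rs orbT.
have [tr|y' ty'] := sS t (mem_head _ _).
  exists y; rewrite big_cons -addrA; apply: rpredD => //.
  by apply: rpredZ; apply: lin_span_gen.
exists (t.1 *: y' + y).
by rewrite big_cons linearP ty' opprD addrACA subrr add0r.
Qed.

(** Let V be the chains modulo boundaries. The projection to V factors through the
    boundary map, so it kills all cycles. *)
Lemma hoch_homology_eq0 : (forall N : bimodule A, coboundaries N k) ->
  forall x : hoch_homology M k.+1, x = 0.
Proof.
move=> cob; apply: homology_eq0 => z bz; pose V := lquot boundary_rel.
have pi0 x : boundary_rel x -> lpi boundary_rel x = 0.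
  move=> xS; rewrite -(linear0P (lpi_linear boundary_rel)); apply/lpiP.
  by rewrite subr0; apply: lin_span_gen.
have [gamma [gL g0 gb]] : exists gamma : F k -> V, [/\ linear gamma,
    forall x, tensor_rel x -> gamma x = 0 &
    forall x, gamma (hoch_b_free x) = lpi boundary_rel x].
  apply: chain_primitive => [|||y].
  - exact: cob.
  - exact: lpi_linear.
  - by move=> x xr; apply/pi0/Boundary_rel_tensor.
  by apply: pi0; apply: (Boundary_rel_b (y := y)).
have bz0 : hoch_b_free (repr z) \in @tensor_null K A M k.
  have : hoch_b z = 0 by exact: bz.
  rewrite -[z in hoch_b z]reprK hoch_b_pi => /eqP.
  by rewrite -(raddf0 (\pi_(hoch_chain M k))) -Quotient.idealrBE subr0.
have [y yE] : exists y, repr z - hoch_b_free y \in @tensor_null K A M k.+1.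
  apply: boundary_spanE; rewrite -[repr z]subr0; apply/lpiP.
  rewrite -gb (linear0P (lpi_linear boundary_rel)).
  move: bz0 => /asboolP[s sS ->]; rewrite (linear_sumP gL) big_seq big1 // => t.
  by move=> /sS /g0 t0; rewrite (linearZP gL) t0 scaler0.
have e : hoch_b (\pi_(hoch_chain M k.+2) y) = z.
  rewrite hoch_b_pi -[RHS]reprK; apply/eqP.
  by rewrite eq_sym -Quotient.idealrBE.
by exists (\pi_(hoch_chain M k.+2) y); exact: e.
Qed.

End HomologyVanishing.

(** * Minimality of the length *)

Section ShortResolution.
Variables (K : fieldType) (A : algType K) (X1 X2 X3 : choiceType).
Local Notation C0 := (FreeB A unit).
Local Notation C1 := (FreeB A X1).
Local Notation C2 := (FreeB A X2).
Local Notation C3 := (FreeB A X3).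
Local Notation aug := (@aug K A).
Variables (d0 : C1 -> C0) (d1 : C2 -> C1) (d2 : C3 -> C2).
Hypotheses (d0P : bimod_hom d0) (d1P : bimod_hom d1) (d2P : bimod_hom d2).
Hypotheses (ex0 : forall x, aug x = 0 <-> exists z, d0 z = x)
           (ex1 : forall x, d0 x = 0 <-> exists z, d1 z = x)
           (ex2 : forall x, d1 x = 0 <-> exists z, d2 z = x)
           (ex3 : forall x, d2 x = 0 -> x = 0).

(** Comparing with a projective resolution P of length at most 2, the identity
    of C is homotopic to a map that factors through P; in degree 3 it factors
    through 0, so the homotopy splits [d2]. *)
Lemma short_resolution_split l : (l < 3)%N -> has_fgp_resolution A l ->
  exists2 h : C2 -> C3, bimod_hom h & forall y, h (d2 y) = y.
Proof.
move=> l3 [P [d [e [Pp P0 [eP dP] [es ee de]]]]].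
have [aP [d0L _ _] [d1L _ _] [d2L _ _]] := And4 (augP A) d0P d1P d2P.
have dinj x : d 1%N x = 0 -> x = 0.
  move=> /de[y <-]; rewrite (P0 _ l3 y).
  by have [dL _ _] := dP 2; apply: linear0P.
have [f0 f0P f0E] := free_lifting eP aP (fun x => es _).
have [f1 f1P f1E] : exists2 h : C1 -> P 1%N, bimod_hom h &
    forall y, d 0%N (h y) = f0 (d0 y).
  apply: (free_lifting (dP 0%N) (bimod_hom_comp f0P d0P)) => x.
  by apply/ee; rewrite /= f0E; apply/ex0; exists (ten 1 x 1).
have [f2 f2P f2E] : exists2 h : C2 -> P 2, bimod_hom h &
    forall y, d 1%N (h y) = f1 (d1 y).
  apply: (free_lifting (dP 1%N) (bimod_hom_comp f1P d1P)) => x.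
  have d01 : d0 (d1 (ten 1 x 1)) = 0 by apply/ex1; exists (ten 1 x 1).
  by apply/de; rewrite /= f1E d01; have [fL _ _] := f0P; apply: linear0P.
have [[f1L _ _] d12] : bimod_hom f1 /\ forall y, d1 (d2 y) = 0.
  by split=> // y; apply/ex2; exists y.
have f2d y : f2 (d2 y) = 0 by apply: dinj; rewrite f2E d12; apply: linear0P.
have [g0 g0P g0E] : exists2 h : P 0%N -> C0, bimod_hom h &
    forall y, aug (h y) = e y.
  apply: (projective_lifting (Pp 0%N).1 aP eP) => x.
  by exists (ten (e x : A) tt 1); rewrite augE mulr1.
have [g1 g1P g1E] : exists2 h : P 1%N -> C1, bimod_hom h &
    forall y, d0 (h y) = g0 (d 0%N y).
  apply: (projective_lifting (Pp 1%N).1 d0P (bimod_hom_comp g0P (dP 0%N))) => x.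
  by apply/ex0; rewrite /= g0E; apply/ee; exists x.
have [g2 g2P g2E] : exists2 h : P 2 -> C2, bimod_hom h &
    forall y, d1 (h y) = g1 (d 1%N y).
  apply: (projective_lifting (Pp 2).1 d1P (bimod_hom_comp g1P (dP 1%N))) => x.
  apply/ex1; rewrite /= g1E (_ : d 0%N _ = 0); last by apply/de; exists x.
  by have [gL _ _] := g0P; apply: linear0P.
have [aL _ _] := aP.
have [h0 h0P h0E] : exists2 h : C0 -> C1, bimod_hom h &
    forall y, d0 (h y) = y - g0 (f0 y).
  apply: (free_lifting d0P
    (bimod_homB (bimod_hom_id C0) (bimod_hom_comp g0P f0P))) => x.
  by apply/ex0; rewrite /= (linearBP aL) g0E f0E subrr.
have [h1 h1P h1E] : exists2 h : C1 -> C2, bimod_hom h &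
    forall y, d1 (h y) = y - g1 (f1 y) - h0 (d0 y).
  apply: (free_lifting d1P (bimod_homB
    (bimod_homB (bimod_hom_id C1) (bimod_hom_comp g1P f1P))
    (bimod_hom_comp h0P d0P))) => x.
  by apply/ex1; rewrite /= !(linearBP d0L) g1E f1E h0E subrr.
have [h2 h2P h2E] : exists2 h : C2 -> C3, bimod_hom h &
    forall y, d2 (h y) = y - g2 (f2 y) - h1 (d1 y).
  apply: (free_lifting d2P (bimod_homB
    (bimod_homB (bimod_hom_id C2) (bimod_hom_comp g2P f2P))
    (bimod_hom_comp h1P d1P))) => x.
  apply/ex2; rewrite /= !(linearBP d1L) g2E f2E h1E.
  have -> : d0 (d1 (ten 1 x 1)) = 0 by apply/ex1; exists (ten 1 x 1).
  have [hL _ _] := h0P; rewrite (linear0P hL) subr0; exact: subrr.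
exists h2 => // y; apply/eqP; rewrite -subr_eq0; apply/eqP/ex3.
have [[gL _ _] [hL _ _]] := conj g2P h1P.
rewrite (linearBP d2L) h2E f2d d12 (linear0P gL) (linear0P hL) !subr0.
exact: subrr.
Qed.

End ShortResolution.

(** The ground field with A acting on the left through [al] and on the right
    through [be]. *)
Section CharacterBimodule.
Variables (K : fieldType) (A : algType K) (al be : A -> K^o).
Hypotheses (alP : character al) (beP : character be).

Definition char_lact (a : A) (x : K^o) : K^o := al a * x.
Definition char_ract (x : K^o) (a : A) : K^o := x * be a.

Let lactL a : linear (char_lact a).
Proof. by move=> c x y; rewrite /char_lact mulrDr scalerAr. Qed.
Let lactLl x : linear (char_lact^~ x).
Proof. by move=> c a b; have [L _ _] := alP; rewrite /char_lact L mulrDl scalerAl. Qed.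
Let lact1 x : char_lact 1 x = x.
Proof. by have [_ e _] := alP; rewrite /char_lact e mul1r. Qed.
Let lactM a b x : char_lact (a * b) x = char_lact a (char_lact b x).
Proof. by have [_ _ e] := alP; rewrite /char_lact e mulrA. Qed.
Let ractL a : linear (char_ract^~ a).
Proof. by move=> c x y; rewrite /char_ract mulrDl scalerAl. Qed.
Let ractLr x : linear (char_ract x).
Proof. by move=> c a b; have [L _ _] := beP; rewrite /char_ract L mulrDr scalerAr. Qed.
Let ract1 x : char_ract x 1 = x.
Proof. by have [_ e _] := beP; rewrite /char_ract e mulr1. Qed.
Let ractM x a b : char_ract x (a * b) = char_ract (char_ract x a) b.
Proof. by have [_ _ e] := beP; rewrite /char_ract e mulrA. Qed.
Let lractA a x b : char_lact a (char_ract x b) = char_ract (char_lact a x) b.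
Proof. exact: mulrA. Qed.

Definition char_bimod : bimodule A := @Bimodule K A K^o char_lact char_ract
  lactL lactLl lact1 lactM ractL ractLr ract1 ractM lractA.

Lemma char_hom_ten (X : choiceType) (f : FreeB A X -> char_bimod) a x b :
  bimod_hom f -> f (ten a x b) = al a * f (ten 1 x 1) * be b :> K^o.
Proof.
move=> [_ fl fr].
have -> : ten a x b = ract (lact a (ten 1 x 1 : FreeB A X)) b.
  by rewrite lact_ten ract_ten mul1r mulr1.
by rewrite fr fl.
Qed.

End CharacterBimodule.

Section SyzygyCharacter.
Variables (K : fieldType) (m n : nat).
Variables (E : 'M[K]_m) (G : 'M[K]_n).
Hypotheses (E_unit : E \in unitmx) (G_unit : G \in unitmx).
Variables (A : algType K) (u : 'M[A]_(m, n)).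

(** For an isometry a, the solution b of E^T a G = E b G^T is again an isometry. *)
Lemma isometry_partner (a : 'M[K]_(m, n)) : a^T *m E *m a = invmx G ->
  exists2 b, b^T *m E *m b = invmx G & E^T *m a *m G = E *m b *m G^T.
Proof.
move=> aE; have [Etu Gtu] : E^T \in unitmx /\ G^T \in unitmx.
  by rewrite !unitmx_tr.
exists (invmx E *m E^T *m a *m G *m invmx G^T); last first.
  by rewrite !mulmxA mulmxV // mul1mx mulmxKV.
rewrite !trmx_mul !trmxK !trmx_inv !trmxK !mulmxA.
rewrite mulmxK // mulmxKV //.
by rewrite -(mulmxA _ a^T E) -(mulmxA _ (a^T *m E) a) aE mulmxKV // mulmxK.
Qed.

(** With T the matrix of values of f on the generators, the two parts of the syzygy
    are sent to tr(E^T a G T) and tr(G^T T E b) = tr(E b G^T T). *)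
Lemma syzygy_hom_eq0 (al be : A -> K^o) (a b : 'M[K]_(m, n))
    (alP : character al) (beP : character be)
    (f : FreeB A ('I_n * 'I_m)%type -> char_bimod alP beP) :
  (forall i j, al (u i j) = a i j) -> (forall i j, be (u i j) = b i j) ->
  E^T *m a *m G = E *m b *m G^T -> bimod_hom f -> f (syzygy E G u) = 0.
Proof.
move=> alE beE ab fP; have [fL _ _] := fP.
have [[aL a1 _] [bL b1 _]] := conj alP beP.
pose T : 'M[K]_(n, m) := \matrix_(i, l) (f (ten 1 (i, l) 1) : K).
have fcol k l : f (col_rel G u k l) = (a *m G *m T) k l.
  rewrite /col_rel (linear_sumP fL) [RHS]mxE; apply: eq_bigr => i _.
  apply: etrans (char_hom_ten _ _ _ fP) _; rewrite b1 mulr1 [T _ _]mxE.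
  congr (_ * _); rewrite uG_entry (linear_sumP aL) mxE.
  by apply: eq_bigr => j _; rewrite (linearZP aL) alE mulrC.
have frow i j : f (row_rel E u i j) = (T *m (E *m b)) i j.
  rewrite /row_rel (linear_sumP fL) [RHS]mxE; apply: eq_bigr => k _.
  apply: etrans (char_hom_ten _ _ _ fP) _; rewrite a1 mul1r [T _ _]mxE.
  congr (_ * _); rewrite Eu_entry (linear_sumP bL) mxE.
  by apply: eq_bigr => l _; rewrite (linearZP bL) beE.
have pair k (M N : 'M[K]_k) : \sum_i \sum_j M i j * N i j = \tr (M^T *m N).
  rewrite exchange_big; apply: eq_bigr => j _; rewrite mxE.
  by apply: eq_bigr => i _; rewrite mxE.
rewrite /syzygy (linearBP fL) !(linear_sumP fL).
apply/eqP; rewrite subr_eq0; apply/eqP.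
transitivity (\tr (E^T *m (a *m G *m T))).
  rewrite -pair; apply: eq_bigr => k _; rewrite (linear_sumP fL).
  by apply: eq_bigr => l _; rewrite (linearZP fL) fcol.
transitivity (\tr (G^T *m (T *m (E *m b)))); last first.
  rewrite -pair; apply: eq_bigr => k _; rewrite (linear_sumP fL).
  by apply: eq_bigr => l _; rewrite (linearZP fL) frow.
by rewrite !mulmxA ab -!mulmxA mulmxA [LHS]mxtrace_mulC -!mulmxA.
Qed.

(** A retraction of [d2] would send the syzygy to the free generator, on which some
    homomorphism to the ground field is 1. *)
Lemma d2_not_split (al be : A -> K^o) (a b : 'M[K]_(m, n))
    (alP : character al) (beP : character be) (h : _ -> FreeB A unit) :
  (forall i j, al (u i j) = a i j) -> (forall i j, be (u i j) = b i j) ->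
  E^T *m a *m G = E *m b *m G^T -> bimod_hom h ->
  ~ forall y, h (d2 E G u y) = y.
Proof.
move=> alE beE ab hP hK.
pose g := free_hom (fun _ : unit => 1 : char_bimod alP beP).
have gP : bimod_hom g := free_homP _.
have := syzygy_hom_eq0 alE beE ab (bimod_hom_comp gP hP).
have <- : d2 E G u (ten 1 tt 1) = syzygy E G u by apply: free_hom1.
by rewrite /= hK /g free_hom1 => /eqP; rewrite oner_eq0.
Qed.

End SyzygyCharacter.

(** * Smoothness and vanishing *)

Section FiniteResolution.
Variables (K : fieldType) (A : algType K) (X1 X2 X3 : finType).
Local Notation C0 := (FreeB A unit).
Local Notation C1 := (FreeB A X1).
Local Notation C2 := (FreeB A X2).
Local Notation C3 := (FreeB A X3).
Local Notation aug := (@aug K A).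
Variables (d0 : C1 -> C0) (d1 : C2 -> C1) (d2 : C3 -> C2).
Hypotheses (d0P : bimod_hom d0) (d1P : bimod_hom d1) (d2P : bimod_hom d2).
Hypotheses (ex0 : forall x, aug x = 0 <-> exists z, d0 z = x)
           (ex1 : forall x, d0 x = 0 <-> exists z, d1 z = x)
           (ex2 : forall x, d1 x = 0 <-> exists z, d2 z = x)
           (ex3 : forall x, d2 x = 0 -> x = 0).

Lemma free_void_eq0 (x : FreeB A void) : x = 0.
Proof. by have [s ->] := free_bimodE x; rewrite big1 // => -[[a []] b]. Qed.

(** The terms beyond degree 3 are free on the empty set. *)
Definition res_term (i : nat) : bimodule A :=
  match i with
  | 0 => C0 | 1 => C1 | 2 => C2 | 3 => C3 | _ => FreeB A void
  end.

Definition res_diff (i : nat) : res_term i.+1 -> res_term i :=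
  match i with
  | 0 => d0 | 1 => d1 | 2 => d2 | _ => fun _ => 0
  end.

Lemma free_resolution_fgp : has_fgp_resolution A 3.
Proof.
exists res_term, res_diff, aug; split.
- by case=> [|[|[|[|i]]]]; split; apply: free_projective || apply: free_fin_gen.
- by case=> [|[|[|[|i]]]] // _; apply: free_void_eq0.
- split; first exact: augP.
  by case=> [|[|[|i]]]; rewrite ?/res_diff //; apply: zero_hom.
- split=> // a; exists (ten a tt 1); exact: etrans (augE _ _ _) (mulr1 a).
case=> [|[|[|i]]] //= x; split.
- by move=> /ex3->; exists 0.
- by move=> [_ <-]; have [dL _ _] := d2P; apply: linear0P.
- by move=> _; exists 0; rewrite [RHS]free_void_eq0.
by [].
Qed.

End FiniteResolution.


Section AdaptedPresentation.
Variables (K : fieldType) (m n : nat).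
Variables (E : 'M[K]_m) (G : 'M[K]_n) (p q : 'I_m) (p' q' : 'I_n).
Hypotheses (E_unit : E \in unitmx) (G_unit : G \in unitmx).
Hypotheses (Ep : forall j, E p j = (j == q)%:R).
Hypotheses (Gp : forall j, G p' j = (j == q')%:R).
Hypotheses (pq : p != q) (pq' : p' != q').
Variables (A : algType K) (u : 'M[A]_(m, n)).
Hypotheses (uGu : defect E G u = 0) (uEu : defect G E u^T = 0).
Variable nf : {linear A -> {malg K[seq (letter m n)]}}.
Hypothesis nfP : normal_form p q p' q' u nf.

Let ex0 x : @aug K A x = 0 <-> exists z, d0 u z = x.
Proof.
split=> [|[z <-]]; first exact: (aug_exact E_unit G_unit pq pq' nfP).
exact: aug_d0.
Qed.

Let ex1 x : d0 u x = 0 <-> exists z, d1 E G u z = x.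
Proof.
split=> [|[z <-]]; last exact: d0_d1.
exact: (exact1 E_unit G_unit Ep Gp pq pq' uGu uEu nfP).
Qed.

Let ex2 x : d1 E G u x = 0 <-> exists z, d2 E G u z = x.
Proof.
split=> [|[z <-]]; last exact: d1_d2.
exact: (exact2 E_unit G_unit Ep Gp pq pq' uGu uEu nfP).
Qed.

Let ex3 x : d2 E G u x = 0 -> x = 0.
Proof. exact: (d2_inj E_unit G_unit Ep Gp pq pq' nfP). Qed.

Lemma adapted_smooth (a : 'M[K]_(m, n)) : a^T *m E *m a = invmx G ->
  (forall b : 'M[K]_(m, n), b^T *m E *m b = invmx G ->
    exists2 chi : A -> K^o, character chi & forall i j, chi (u i j) = b i j) ->
  smooth_of_dim A 3.
Proof.
move=> aE chars; split.
  exact: (free_resolution_fgp (d0P u) (d1P E G u) (d2P E G u) ex0 ex1 ex2 ex3).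
move=> l res; rewrite leqNgt; apply/negP => l3.
have [h hP hK] := short_resolution_split (d0P u) (d1P E G u) (d2P E G u)
  ex0 ex1 ex2 ex3 l3 res.
have [b bE ab] := isometry_partner E_unit G_unit aE.
have [[al alP alE] [be beP beE]] := conj (chars a aE) (chars b bE).
exact: d2_not_split alP beP _ alE beE ab hP hK.
Qed.

Lemma adapted_coboundaries (M : bimodule A) k : (3 <= k)%N -> coboundaries M k.
Proof.
apply: coboundaries_ge => {}M; do 3!apply: coboundaries_shift.
apply: coboundaries0 => D DL Dder; have lift := normal_form_right_lifting nfP.
have fac := factors_d0 (d0P u) (d1P E G u) (d2P E G u) ex0 ex1 ex2 ex3 lift (M := M).
exact: (derivation_inner (d0P u) ex0 fac DL Dder).
Qed.

End AdaptedPresentation.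

Local Open Scope complex_scope.

Theorem theorem6p1 (R : realType) (n : nat) (n_ge2 : (2 <= n)%N)
    (E : 'M[R[i]]_n) (E_unit : E \in unitmx) :
  smooth_of_dim (BE E_unit) 3 /\
  forall (M : bimodule (BE E_unit)) (k : nat), (4 <= k)%N ->
    (forall x : hoch_homology M k, x = 0) /\
    (forall x : hoch_cohomology M k, x = 0).
Proof.
have [E' [G [p [q [p' [q' [v [nf [[E'u Gu pq pq'] [Ep Gp] [vGv vEv] nfP
  [[a aE] chars]]]]]]]]]] := BE_adapted_presentation E_unit n_ge2.
split.
  exact: (adapted_smooth E'u Gu Ep Gp pq pq' vGv vEv nfP aE chars).
move=> M [//|k] k3.
have cob (N : bimodule (BE E_unit)) : coboundaries N k.
  exact: (adapted_coboundaries E'u Gu Ep Gp pq pq' vGv vEv nfP k3).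
by split=> x; [apply: hoch_homology_eq0 | apply: hoch_cohomology_eq0].
Qed.
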